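(* The obstruction polynomial $\Psi$ is nonzero (i.e. does not vanish identically on the space of Killing vector fields) for all $n_+,n_-\ge2$.
   Context: Setting: $n_+,n_-\ge2$, $n=n_++n_-$, $M=\mathrm{SU}(n)/\mathrm{S}(\mathrm{U}(n_+)\times\mathrm{U}(n_-))$, with $\mathfrak{su}(n)=\mathfrak{k}\oplus\mathfrak{m}$ the symmetric decomposition, $\mathfrak{m}\cong T_oM\cong\mathbb{C}^{n_+}\otimes_{\mathbb C}(\mathbb{C}^{n_-})^*$. The metric $g$ is the standard metric, induced by the restriction to $\mathfrak{m}$ of $-B$, where $B$ is the Killing form of $\mathfrak{su}(n)$ (Einstein constant $\frac12$). $J$ is the invariant complex structure given by multiplication by $\mathrm{i}$ on $\mathfrak m$. Conventions: vectors and $1$-forms are identified via $g$, so $dX$ is the exterior derivative of the $1$-form dual to $X$. $2$-forms are identified with skew-symmetric endomorphisms by $g(\alpha X,Y)=\alpha(X,Y)$; $J$ corresponds to the Kähler form $\omega$. Forms carry the usual inner product induced by $g$ (on $2$-forms $\langle\alpha,\beta\rangle=-\frac12\operatorname{tr}(\alpha\circ\beta)$), and $(\cdot,\cdot)_{L^2}$ is the resulting $L^2$ inner product. The isotropy representation $\operatorname{ad}:\mathfrak{k}\cong\mathbb{R}\oplus\mathfrak{su}(n_+)\oplus\mathfrak{su}(n_-)\hookrightarrow\mathfrak{u}(\mathfrak{m})\cong\Lambda^{1,1}\mathfrak{m}$ gives parallel subbundles $\mathbb{E}_\pm$ of the bundle of primitive $(1,1)$-forms, with fibers $\mathfrak{su}(n_\pm)$;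 $\alpha_\pm$ denotes the orthogonal projection of a $2$-form $\alpha$ to $\mathbb{E}_\pm$. For a vector field $X$ set $$e_X=\frac{n_-^2-1}{n_-}(dX)_+-\frac{n_+^2-1}{n_+}(dX)_-.$$ The obstruction polynomial $\Psi$ on the space of Killing vector fields is Koiso's second-order obstruction evaluated on the infinitesimal Einstein deformation $e_X\circ J$; for this Kähler–Einstein metric with Einstein constant $\frac12$ it is given by $$\Psi(X)=6\,(\omega\wedge de_X,\;e_X\wedge de_X)_{L^2}-4\,(e_X\wedge e_X,\;e_X\wedge\omega)_{L^2}.$$ *)

(* Defs.v *)
(* M = G/K with G = SU(n), K = S(U(np) x U(nm)), n = np + nm, and m the
   off-diagonal blocks in su(n).  Tensor fields on M are encoded by their
   pull-backs to G written in the left-invariant frame: a vector field is a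
   K-equivariant map G -> m and a k-form is a map from G to the k-forms on m.
   Functions are total on 'M[R[i]]_n, but only their values on G are used, and
   forms on m are total functions of k matrices, but only their values at
   vectors of m are used. *)
From HB Require Import structures.
From mathcomp Require Import all_boot all_order all_algebra all_fingroup.
From mathcomp Require Import complex.
From mathcomp Require Import all_classical all_reals all_analysis.
From mathcomp Require Import ring lra.

Set Implicit Arguments.
Unset Strict Implicit.
Unset Printing Implicit Defensive.

Import Order.TTheory GRing.Theory Num.Theory numFieldNormedType.Exports.

Local Open Scope classical_set_scope.
Local Open Scope ring_scope.
Local Open Scope sesquilinear_scope.

(* the norm topology of the complex numbers, in the way the library sets it up
   for an abstract numClosedFieldType *)
#[non_forgetful_inheritance, warnings="-redundant-canonical-projection"]
HB.instance Definition _ (R : realType) :=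
  PseudoPointedMetric.copy R[i] (R[i] : numClosedFieldType)^o.
#[non_forgetful_inheritance, warnings="-redundant-canonical-projection"]
HB.instance Definition _ (R : realType) :=
  NormedModule.copy R[i] (R[i] : numClosedFieldType)^o.

Section Unitary.
Context {R : realType} {n : nat}.
Local Notation M := 'M[R[i]]_n.

Definition SU : set M := [set g | g \is unitarymx /\ \det g = 1].

Definition su : set M := [set X | X^t* = - X /\ \tr X = 0].

Definition bracket (X Y : M) : M := X *m Y - Y *m X.

(* orthogonal projection of M_n(C) onto its real subspace su(n) *)
Definition su_proj (Z : M) : M :=
  let S := 2^-1 *: (Z - Z^t*) in S - (\tr S / n%:R)%:M.

(* trace over the real numbers, in the real basis (E_ab, i E_ab) of M_n(C) *)
Definition real_trace (phi : M -> M) : R :=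
  \sum_(a < n) \sum_(b < n)
    (complex.Re (phi (delta_mx a b) a b)
     + complex.Im (phi ('i%C *: delta_mx a b) a b)).

(* The trace of ad X \o ad Y on su(n) is the trace on M_n(C) of its
   composition with the projection onto su(n). *)
Definition killing_form (X Y : M) : R :=
  real_trace (fun Z => bracket X (bracket Y (su_proj Z))).

Definition expm (A : M) : M :=
  limn (series (fun k => (k`!%:R)^-1 *: (A ^+ k))).

(* derivative of f at g along the left-invariant vector field of v *)
Definition lderive (f : M -> R) (g v : M) : R :=
  derive1 (fun t : R => f (g *m expm (t%:C%C *: v))) 0.

Definition lderivable (f : M -> R) (g v : M) : Prop :=
  derivable (fun t : R => f (g *m expm (t%:C%C *: v))) 0 1.

Definition lderive_iter (s : seq M) (f : M -> R) : M -> R :=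
  foldr (fun v h g => lderive h g v) f s.

Definition smooth_on_SU (f : M -> R) : Prop :=
  forall s : seq M, (forall v, v \in s -> su v) ->
    {within SU, continuous (lderive_iter s f)} /\
    (forall g v, SU g -> su v -> lderivable (lderive_iter s f) g v).

Definition borelM := g_sigma_algebraType (@open M).

(* Haar measure of SU(n), of arbitrary positive finite total mass, seen as a
   Borel measure on M_n(C) concentrated on SU(n) *)
Definition is_haar_SU (mu : {measure set borelM -> \bar R}) : Prop :=
  [/\ (0 < mu (SU : set borelM))%E,
      (mu (SU : set borelM) < +oo)%E,
      mu (~` SU : set borelM) = 0%E &
      forall (g : M) (A : set borelM), SU g -> measurable A ->
        mu [set x : borelM | A (g *m (x : M))] = mu A].

Lemma bracket_su_proj (Y Z : M) :
  bracket Y (su_proj Z) = 2^-1 *: (bracket Y Z - bracket Y (Z^t*)).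
Proof.
rewrite /bracket /su_proj mulmxBr mulmxBl mul_mx_scalar mul_scalar_mx.
rewrite opprB addrA subrK -scalemxAr -scalemxAl mulmxBr mulmxBl -scalerBr.
by congr (_ *: _); rewrite !opprD addrACA.
Qed.

Lemma bracketZr (Y Z : M) a : bracket Y (a *: Z) = a *: bracket Y Z.
Proof. by rewrite /bracket -scalemxAr -scalemxAl scalerBr. Qed.

Lemma bracketBr (Y Z T : M) : bracket Y (Z - T) = bracket Y Z - bracket Y T.
Proof.
by rewrite /bracket mulmxBr mulmxBl !opprD addrACA.
Qed.

Lemma sum_ad_ad (X Y : M) :
  \sum_(a < n) \sum_(b < n) (bracket X (bracket Y (delta_mx a b))) a b
  = n%:R * \tr (X *m Y) *+ 2 - \tr X * \tr Y *+ 2.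
Proof.
have E (a b : 'I_n) : (bracket X (bracket Y (delta_mx a b))) a b
   = (X *m Y) a a - X a a * Y b b - Y a a * X b b + (Y *m X) b b.
  rewrite /bracket mulmxBr mulmxBl !mulmxA !mxE.
  have D1 (A : M) : (A *m delta_mx a b) a b = A a a.
    rewrite mxE (bigD1 a) //= big1 ?addr0 => [|i ia]; rewrite mxE ?eqxx ?mulr1 //.
    by rewrite (negPf ia) mulr0.
  have D2 (A B : M) : (A *m delta_mx a b *m B) a b = A a a * B b b.
    rewrite mxE (bigD1 b) //= big1 ?addr0 ?D1 // => i ib.
    rewrite mxE big1 ?mul0r // => j _; rewrite !mxE (negPf ib) andbF mulr0 //.
  have := D1 (X *m Y); rewrite mxE => ->.
  have := D2 X Y; rewrite mxE => ->.
  have := D2 Y X; rewrite mxE => ->.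
  have := D2 1%:M (Y *m X).
  rewrite mul1mx mulmxA [LHS]mxE [1%:M a a]mxE eqxx mul1r => ->.
  rewrite !mxE; ring.
have E2 (a : 'I_n) : \sum_(b < n) (bracket X (bracket Y (delta_mx a b))) a b
   = n%:R * (X *m Y) a a - X a a * \tr Y - Y a a * \tr X + \tr (Y *m X).
  rewrite (eq_bigr _ (fun b _ => E a b)) big_split /= !sumrB sumr_const card_ord.
  by rewrite -!mulr_sumr mulr_natl.
rewrite (eq_bigr _ (fun a _ => E2 a)) big_split /= !sumrB sumr_const card_ord.
rewrite -mulr_sumr -!mulr_suml -!/(mxtrace _) (mxtrace_mulC Y X) -mulr_natl.
by ring.
Qed.

Lemma real_trace_su (A F : M -> M) :
  (forall Z, F Z = 2^-1 *: (A Z - A (Z^t*))) ->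
  (forall a Z, A (a *: Z) = a *: A Z) ->
  real_trace F = complex.Re (\sum_(a < n) \sum_(b < n) A (delta_mx a b) a b).
Proof.
move=> FE AZ; rewrite /real_trace raddf_sum; apply: eq_bigr => a _.
rewrite raddf_sum; apply: eq_bigr => b _; rewrite !FE.
move: (delta_mx a b : M) => E0.
have -> : ('i%C *: E0)^t* = - 'i%C *: E0^t*.
  by apply/matrixP=> i j; rewrite !mxE rmorphM /=; congr (_ * _); simpc.
rewrite !AZ; move: (A E0) (A (E0^t*)) => P Q.
have -> : (2^-1 : R[i]) = (2^-1)%:C%C by rewrite fmorphV rmorph_nat.
rewrite !mxE; case: (P a b) => p1 p2; case: (Q a b) => q1 q2.
by simpc => /=; lra.
Qed.

Lemma killing_formE (X Y : M) : \tr X = 0 ->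
  killing_form X Y = 2 * n%:R * complex.Re (\tr (X *m Y)).
Proof.
move=> trX; rewrite /killing_form.
rewrite (@real_trace_su (fun Z => bracket X (bracket Y Z))); last 2 first.
- by move=> Z; rewrite bracket_su_proj bracketZr bracketBr.
- by move=> a Z; rewrite !bracketZr.
rewrite sum_ad_ad trX mul0r mul0rn subr0 mulr_natl -mulrnA raddfMn /=.
by rewrite -[LHS]mulr_natl mulnC natrM.
Qed.
End Unitary.

Arguments borelM R n : clear implicits.

Section Grassmannian.
Context {R : realType} {np nm : nat}.
Local Notation M := 'M[R[i]]_(np + nm).

Definition isotropy : set M :=
  [set k | [/\ SU k, ursubmx k = 0 & dlsubmx k = 0]].

Definition mspace : set M :=
  [set X | [/\ su X, ulsubmx X = 0 & drsubmx X = 0]].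

Definition metric (X Y : M) : R := - killing_form X Y.

(* m is C^np (x) (C^nm)^* through the upper right block Z of
   [[0, Z], [- Z^t*, 0]], and J multiplies Z by i *)
Definition cplx_str (X : M) : M :=
  block_mx 0 ('i%C *: ursubmx X) (- 'i%C *: dlsubmx X) 0.

Definition form (k : nat) := ('I_k -> M) -> R.

Definition form_field (k : nat) := M -> form k.

(* orthonormal basis of m, see mbasis_orthonormal and mbasis_mspace *)
Definition mbasis_index : finType := (bool * 'I_np * 'I_nm)%type.

Definition mbasis (s : mbasis_index) : M :=
  let: (b, i, j) := s in
  let c : R[i] := if b then 'i%C else 1 in
  ((2 * Num.sqrt (np + nm)%:R)^-1)%:C%C *:
    block_mx 0 (c *: delta_mx i j) (- c^*%C *: delta_mx j i) 0.

(* sum over increasing multi-indices, written as a sum over all of them *)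
Definition form_ip (k : nat) (a b : form k) : R :=
  (k`!%:R)^-1 * \sum_(s : {ffun 'I_k -> mbasis_index})
    a (fun i => mbasis (s i)) * b (fun i => mbasis (s i)).

Definition wedge (p q : nat) (a : form p) (b : form q) : form (p + q) :=
  fun v => ((p`! * q`!)%:R)^-1 * \sum_(s : 'S_(p + q))
    (-1) ^+ s * a (fun i => v (s (lshift q i))) * b (fun j => v (s (rshift p j))).

Definition form_field_wedge (p q : nat) (a : form_field p) (b : form_field q) :
  form_field (p + q) := fun g => wedge (a g) (b g).

(* Cartan's formula on G for the left-invariant fields v_i in m; the terms
   with [v_i, v_j] drop out, since [m, m] is contained in the Lie algebra of
   K, which is annihilated by forms pulled back from M. *)
Definition ext_d (k : nat) (a : form_field k) : form_field k.+1 :=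
  fun g v => \sum_(i < k.+1)
    (-1) ^+ i * lderive (fun x => a x (fun j => v (lift i j))) g (v i).

Definition smooth_vector_field (X : M -> M) : Prop :=
  [/\ forall g, SU g -> mspace (X g),
      forall g k, SU g -> isotropy k -> X (g *m k) = invmx k *m X g *m k &
      forall i j, smooth_on_SU (fun g => complex.Re (X g i j)) /\
                  smooth_on_SU (fun g => complex.Im (X g i j))].

Definition flat (X : M -> M) : form_field 1 :=
  fun g v => metric (X g) (v ord0).

(* The Levi-Civita connection of a symmetric space is the canonical one, so
   (nabla_Y X^flat)(Z) is the derivative of X^flat(Z) along the left-invariant
   field of Y in m. *)
Definition killing_field (X : M -> M) : Prop :=
  smooth_vector_field X /\
  forall g Y Z, SU g -> mspace Y -> mspace Z ->
    lderive (fun x => flat X x (fun=> Z)) g Y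
    + lderive (fun x => flat X x (fun=> Y)) g Z = 0.

Definition endo_form (phi : M -> M) : form 2 :=
  fun v => metric (phi (v ord0)) (v ord_max).

Definition omega : form_field 2 := fun=> endo_form cplx_str.

Definition fiber_Ep : set (form 2) :=
  [set endo_form (bracket (block_mx A 0 0 0)) | A in (su : set 'M[R[i]]_np)].

Definition fiber_Em : set (form 2) :=
  [set endo_form (bracket (block_mx 0 0 0 A)) | A in (su : set 'M[R[i]]_nm)].

Definition ortho_proj (E : set (form 2)) (a : form 2) : form 2 :=
  xget (fun=> 0) [set b : form 2 |
    E b /\ forall c, E c -> form_ip (fun v => a v - b v) c = 0].

Definition e_field (X : M -> M) : form_field 2 := fun g v =>
  (nm%:R ^+ 2 - 1) / nm%:R * ortho_proj fiber_Ep (ext_d (flat X) g) v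
  - (np%:R ^+ 2 - 1) / np%:R * ortho_proj fiber_Em (ext_d (flat X) g) v.

(* For the Haar measure of total mass vol(M, g) this is the L^2 inner product
   of forms on M; another total mass rescales it by a positive constant. *)
Definition L2_ip (mu : {measure set (borelM R (np + nm)) -> \bar R})
    (k : nat) (a b : form_field k) : R :=
  \int[mu]_(g in (SU : set (borelM R (np + nm)))) form_ip (a g) (b g).

Definition Psi (mu : {measure set (borelM R (np + nm)) -> \bar R})
    (X : M -> M) : R :=
  let e := e_field X in
  6 * L2_ip mu (form_field_wedge omega (ext_d e)) (form_field_wedge e (ext_d e))
  - 4 * L2_ip mu (form_field_wedge e e) (form_field_wedge e omega).

Lemma mbasis_mspace (s : mbasis_index) : mspace (mbasis s).
Proof.
case: s => [[b i] j]; split; rewrite /mbasis; last 2 first.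
- by rewrite scale_block_mx block_mxKul scaler0.
- by rewrite scale_block_mx block_mxKdr scaler0.
split; last by rewrite mxtraceZ mxtrace_block !mxtrace0 addr0 mulr0.
set c := (if b then _ else _); set r := (_^-1)%:C%C.
have rc : Num.conj r = r by exact: conjc_real.
have cc : Num.conj (- c^*%C) = - c by rewrite rmorphN; congr (- _); exact: conjcK.
rewrite linearZ /= map_mxZ /= rc -scalerN; congr (_ *: _).
rewrite tr_block_mx map_block_mx !linearZ /= !map_mxZ /= !trmx_delta cc.
by rewrite !map_delta_mx !(trmx0, map_mx0) opp_block_mx !oppr0 -!scaleNr opprK.
Qed.

Lemma mbasis_orthonormal (s t : mbasis_index) :
  metric (mbasis s) (mbasis t) = (s == t)%:R.
Proof.
rewrite /metric killing_formE; last by case: (mbasis_mspace s) => -[].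
case: s t => [[b i] j] [[b' i'] j']; rewrite /mbasis.
set c := (if b then _ else _); set c' := (if b' then _ else _).
set r : R := (_^-1).
rewrite -scalemxAl -scalemxAr scalerA mxtraceZ mulmx_block !(mul0mx, mulmx0, add0r, addr0).
rewrite mxtrace_block -!(scalemxAl, scalemxAr) !mxtraceZ.
have trD (m p : nat) (a e : 'I_m) (d f : 'I_p) :
    \tr (delta_mx a d *m delta_mx f e : 'M[R[i]]_m) = ((a == e) && (d == f))%:R.
  case: (eqVneq d f) => [->|df]; last by rewrite mul_delta_mx_0 // mxtrace0 andbF.
  rewrite mul_delta_mx andbT /mxtrace (bigD1 a) //= mxE eqxx /= big1 ?addr0 // => k ka.
  by rewrite mxE (negPf ka).
rewrite !trD !xpair_eqE [(j == j') && _]andbC -andbA.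
have N0 : (0 : R) < (np + nm)%:R.
  by rewrite ltr0n addn_gt0 (leq_ltn_trans (leq0n i) (ltn_ord i)).
have rr : r * r = (4 * (np + nm)%:R)^-1.
  rewrite /r -invfM; congr (_^-1); rewrite mulrACA -[Num.sqrt _ * _]expr2 sqr_sqrtr ?ltW //.
  by congr (_ * _); rewrite -natrM.
have rrC : r%:C%C * r%:C%C = ((4 * (np + nm)%:R)^-1)%:C%C by simpc; rewrite rr.
move: (_ && _) => e; rewrite rrC.
have <- : (e%:R : R)%:C%C = e%:R by rewrite rmorph_nat.
have {N0} : (np + nm)%:R != 0 :> R by rewrite gt_eqF.
move: ((np + nm)%:R : R) => N N0.
case: b b' e @c @c' => [] [] [] /=; simpc; rewrite //=; by field.
Qed.

End Grassmannian.

Arguments mbasis_index np nm : clear implicits.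

(* Main.v *)
From HB Require Import structures.
From mathcomp Require Import all_boot all_order all_algebra all_fingroup.
From mathcomp Require Import complex.
From mathcomp Require Import all_classical all_reals all_analysis.
From mathcomp Require Import measurable_realfun.
From mathcomp Require Import ring lra.
Require Import Defs.

(** Write [p], [q] for the two ranks, [n = p + q], and lift everything to
    [SU(n)], written in the left-invariant frame. A skew-hermitian matrix [A]
    gives a Killing field, the part of [g^* A g] in [m] ([killing_of]). Its
    exterior derivative at [g] is the two-form of the adjoint action of twice
    the block-diagonal part of [g^* A g], so [e_X] at [g] is the form of the
    adjoint action of an explicit block-diagonal matrix ([e_field_killing]).

    Functions [g |-> tr (B g^* A g)] are stable under left-invariant derivatives
    ([lderive_coef]). Hence [d e_X] is algebraic in [g^* A g] as well, and no
    differential equation enters.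

    Take [A = i v v^*] and let [x], [z] be the blocks of [g^* v]. Then [e_X] and
    [d e_X] become explicit tensors in [x] and [z] ([e_field_frame],
    [ext_d_frame]). Since [e_X] is primitive and divergence-free, few terms of
    the two inner products of wedge products survive, and contracting the tensors
    shows that the integrand of [Psi] is a combination of the four monomials
    [X^2 Y], [X Y^2], [X^3], [Y^3] in [X = |x|^2] and [Y = |z|^2]
    ([form_ip_wde_ede], [form_ip_ee_ew], [derivative_termE], [algebraic_termE]).

    It remains to see that these integrals do not vanish for all [v]. Rather than
    integrating over the group, average over [v]: a Gaussian mean of the
    integrand would not depend on the unitary matrix [g]. As the integrand has
    degree (3, 3) in [v], finitely many vectors with suitable weights have the
    same effect ([avg_quadratic_cube], [avg_moments]). For every [g] the weighted
    sum of the integrands equals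
    [- 192 (p + q) (p q - 1) (p^2 - 1)^2 (q^2 - 1)^2 / (p q)^2]
    ([avg_density]), so the weighted sum of the values of [Psi] is this constant
    times the mass of [SU(n)]. It is not zero for [p], [q] at least two, hence
    [Psi] is nonzero at one of the finitely many Killing fields. *)

Set Implicit Arguments.
Unset Strict Implicit.
Unset Printing Implicit Defensive.

Import Order.TTheory GRing.Theory Num.Theory numFieldNormedType.Exports.

Local Open Scope classical_set_scope.
Local Open Scope ring_scope.
Local Open Scope sesquilinear_scope.

(** * Matrix exponentials *)

Section Exponential.
Context {R : realType}.
Local Notation Re := complex.Re.
Local Notation Im := complex.Im.

Lemma normc_le_ReIm (z : R[i]) : `|z| <= (`|Re z| + `|Im z|)%:C%C.
Proof.
case: z => a b /=.
have -> : (a +i* b)%C = a%:C%C + 'i%C * b%:C%C :> R[i] by simpc.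
apply: le_trans (ler_normD _ _) _.
rewrite normrM !normc_def /= expr0n expr1n /= !addr0 !add0r sqrtr1 !sqrtr_sqr.
by rewrite rmorphD mul1r.
Qed.

Lemma normc_ge_Im (z : R[i]) : `|Im z|%:C%C <= `|z|.
Proof.
have := normc_ge_Re (z * 'i%C); rewrite normrM ReiNIm normrN.
by rewrite [`|'i%C|]normc_def /= expr0n expr1n add0r sqrtr1 mulr1.
Qed.

Lemma mx_hausdorff n : hausdorff_space 'M[R[i]]_n.
Proof. exact: norm_hausdorff. Qed.

(** The matrix norm is complex-valued while the entries of the exponential are
    real power series up to real and imaginary parts. *)
Lemma cvg_mx_ReIm n (u : nat -> 'M[R[i]]_n) (l : 'M[R[i]]_n) :
    (forall i j, Re (u k i j) @[k --> \oo] --> Re (l i j)) ->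
    (forall i j, Im (u k i j) @[k --> \oo] --> Im (l i j)) ->
  u k @[k --> \oo] --> l.
Proof.
move=> cRe cIm; apply/cvg_ballP => eps eps0.
have eps_real : eps = (Re eps)%:C%C by rewrite RRe_real ?gtr0_real.
have e0 : 0 < Re eps by rewrite -ltcR -eps_real.
have d0 : 0 < Re eps / 2 by rewrite divr_gt0.
have nearRe : \forall k \near \oo, forall ij : 'I_n * 'I_n,
    `|Re (l ij.1 ij.2) - Re (u k ij.1 ij.2)| < Re eps / 2.
  by apply: filter_forall => ij; move/cvgrPdist_lt: (cRe ij.1 ij.2); apply.
have nearIm : \forall k \near \oo, forall ij : 'I_n * 'I_n,
    `|Im (l ij.1 ij.2) - Im (u k ij.1 ij.2)| < Re eps / 2.
  by apply: filter_forall => ij; move/cvgrPdist_lt: (cIm ij.1 ij.2); apply.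
apply: filterS2 nearRe nearIm => k HRe HIm.
split=> // i j; rewrite -ball_normE /ball_ /=.
apply: le_lt_trans (normc_le_ReIm _) _; rewrite eps_real ltcR !raddfB /=.
by rewrite [ltRHS]splitr ltrD // ?(HRe (i, j)) ?(HIm (i, j)).
Qed.

(** Domination by the coefficients of an exponential series: it gives
    convergence everywhere and is inherited by the derived series. *)
Definition exp_bounded (c : R^nat) :=
  exists M B : R, [/\ 0 <= M, 0 <= B & forall k, `|c k| <= M * B ^+ k / k`!%:R].

Lemma exp_bounded_cvg (c : R^nat) x : exp_bounded c -> cvgn (pseries c x).
Proof.
move=> [M [B [M0 B0 cB]]]; apply: normed_cvg.
apply: (@series_le_cvg _ _ (fun k => M * exp_coeff (B * `|x|) k)).
- by move=> k; exact: normr_ge0.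
- by move=> k; rewrite mulr_ge0 // exp_coeff_ge0 // mulr_ge0.
- move=> k; rewrite /= normrM normrX /exp_coeff /= exprMn !mulrA mulrAC.
  by rewrite ler_wpM2r ?exprn_ge0.
- by apply: is_cvg_seriesZ; exact: is_cvg_series_exp_coeff.
Qed.

Lemma exp_bounded_diffs (c : R^nat) :
  exp_bounded c -> exp_bounded (pseries_diffs c).
Proof.
move=> [M [B [M0 B0 cB]]]; exists (M * B), B; split; rewrite ?mulr_ge0 // => k.
rewrite /pseries_diffs normrM normr_nat.
apply: le_trans (ler_wpM2l _ (cB _)) _; first by [].
rewrite factS natrM invfM exprS [M * (B * _)]mulrA.
by rewrite [k.+1%:R * _]mulrCA mulVKf ?pnatr_eq0.
Qed.

Lemma pseries_at0 (c : R^nat) : limn (pseries c 0) = c 0%N.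
Proof.
apply: cvg_lim; first exact: Rhausdorff.
rewrite -cvg_shiftS /=; under eq_fun => k.
  rewrite /pseries seriesEnat /= big_nat_recl // expr0 mulr1 big1 ?addr0; last first.
    by move=> j _; rewrite expr0n mulr0.
  over.
exact: cvg_cst.
Qed.

Lemma is_derive_exp_bounded (c : R^nat) : exp_bounded c ->
  is_derive (0 : R) 1 (fun t => limn (pseries c t)) (c 1%N).
Proof.
move=> cB; have dB := exp_bounded_diffs cB; have ddB := exp_bounded_diffs dB.
have := @pseries_snd_diffs R c 1 0 (@exp_bounded_cvg _ 1 cB)
  (@exp_bounded_cvg _ 1 dB)
  (@exp_bounded_cvg _ 1 ddB).
rewrite normr0 normr1 pseries_at0 /pseries_diffs mul1r; exact.
Qed.

Lemma mx_exp_bounded n (v : 'M[R[i]]_n) (i j : 'I_n) :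
  exists B : R, 0 <= B /\ forall k, `|(v ^+ k) i j| <= (B ^+ k)%:C%C.
Proof.
pose b := \sum_(p : 'I_n * 'I_n) (`|Re (v p.1 p.2)| + `|Im (v p.1 p.2)|).
have vb p q : `|v p q| <= b%:C%C.
  apply: le_trans (normc_le_ReIm _) _; rewrite lecR /b (bigD1 (p, q)) //=.
  by rewrite lerDl sumr_ge0 // => ? _; rewrite addr_ge0.
have b0 : 0 <= b by apply: sumr_ge0 => ? _; rewrite addr_ge0.
exists (n%:R * b); split; first by rewrite mulr_ge0.
move=> k; elim: k i => [|k IH] i.
  by rewrite !expr0 mxE; case: (i == j); rewrite ?normr1 ?normr0.
rewrite exprS mxE; apply: le_trans (ler_norm_sum _ _ _) _.
apply: (@le_trans _ _ (\sum_(l < n) (b * (n%:R * b) ^+ k)%:C%C)).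
  by apply: ler_sum => l _; rewrite normrM rmorphM /= ler_pM.
by rewrite sumr_const card_ord exprS -[leLHS]mulr_natl -(rmorph_nat (real_complex R)) -rmorphM mulrA.
Qed.

Lemma mx_exprZ n (a : R[i]) (v : 'M[R[i]]_n) k :
  (a *: v) ^+ k = a ^+ k *: v ^+ k.
Proof.
elim: k => [|k IH]; first by rewrite !expr0 scale1r.
by rewrite !exprS IH -[LHS]/(_ *m _) -scalemxAl -scalemxAr scalerA.
Qed.

(** The entries of [expm (t v)] are power series in [t] that converge
    everywhere, so the exponential curve has velocity [v] at [t = 0]. *)
Lemma expm_entry n (v : 'M[R[i]]_n) (i j : 'I_n) :
  [/\ Re (expm (0%:C%C *: v) i j) = Re (1%:M i j :> R[i]),
      Im (expm (0%:C%C *: v) i j) = Im (1%:M i j :> R[i]),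
      is_derive (0 : R) 1 (fun t : R => Re (expm (t%:C%C *: v) i j)) (Re (v i j))
    & is_derive (0 : R) 1 (fun t : R => Im (expm (t%:C%C *: v) i j)) (Im (v i j))].
Proof.
pose cR i j k := k`!%:R^-1 * Re ((v ^+ k) i j).
pose cI i j k := k`!%:R^-1 * Im ((v ^+ k) i j).
have cRB a b : exp_bounded (cR a b).
  have [B [B0 HB]] := mx_exp_bounded v a b; exists 1, B; split=> // k.
  rewrite /cR normrM ger0_norm ?invr_ge0 // mul1r mulrC ler_wpM2r ?invr_ge0 //.
  by rewrite -lecR; apply: le_trans (normc_ge_Re _) _.
have cIB a b : exp_bounded (cI a b).
  have [B [B0 HB]] := mx_exp_bounded v a b; exists 1, B; split=> // k.
  rewrite /cI normrM ger0_norm ?invr_ge0 // mul1r mulrC ler_wpM2r ?invr_ge0 //.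
  by rewrite -lecR; apply: le_trans (normc_ge_Im _) _.
have E t : expm (t%:C%C *: v) = \matrix_(a, b)
    (limn (pseries (cR a b) t) +i* limn (pseries (cI a b) t))%C.
  apply: cvg_lim; first exact: mx_hausdorff.
  have EE k a b : ((k`!%:R)^-1 *: (t%:C%C *: v) ^+ k : 'M[R[i]]_n) a b =
      (cR a b k * t ^+ k)%:C%C + 'i%C * (cI a b k * t ^+ k)%:C%C.
    rewrite mx_exprZ !mxE -(rmorph_nat (real_complex R)) -fmorphV -rmorphXn /=.
    rewrite /cR /cI; case: ((v ^+ k) a b) => x y; simpc.
    by congr (_ +i* _)%C => /=; ring.
  apply: cvg_mx_ReIm => a b.
  - rewrite mxE /=; suff -> : (fun k => Re (series
        (fun k0 => (k0`!%:R)^-1 *: (t%:C%C *: v) ^+ k0) k a b)) = pseries (cR a b) t.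
      by apply: exp_bounded_cvg.
    apply/funext => k; rewrite /pseries !seriesEnat summxE raddf_sum /=.
    by apply: eq_bigr => l _; rewrite EE; simpc.
  - rewrite mxE /=; suff -> : (fun k => Im (series
        (fun k0 => (k0`!%:R)^-1 *: (t%:C%C *: v) ^+ k0) k a b)) = pseries (cI a b) t.
      by apply: exp_bounded_cvg.
    apply/funext => k; rewrite /pseries !seriesEnat summxE raddf_sum /=.
    by apply: eq_bigr => l _; rewrite EE; simpc.
have ER : (fun t : R => Re (expm (t%:C%C *: v) i j)) = fun t => limn (pseries (cR i j) t).
  by apply/funext => t; rewrite E mxE.
have EI : (fun t : R => Im (expm (t%:C%C *: v) i j)) = fun t => limn (pseries (cI i j) t).
  by apply/funext => t; rewrite E mxE.
have f0 : (0`!%:R)^-1 = 1 :> R by rewrite fact0 invr1.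
have f1 : (1`!%:R)^-1 = 1 :> R by rewrite factS fact0 invr1.
split.
- by rewrite E mxE /= pseries_at0 /cR f0 mul1r expr0.
- by rewrite E mxE /= pseries_at0 /cI f0 mul1r expr0.
- rewrite ER; have -> : Re (v i j) = cR i j 1%N by rewrite /cR f1 mul1r expr1.
  exact: is_derive_exp_bounded.
- rewrite EI; have -> : Im (v i j) = cI i j 1%N by rewrite /cI f1 mul1r expr1.
  exact: is_derive_exp_bounded.
Qed.
End Exponential.

(** * Matrix coefficients and their derivatives *)

Section Derivative.
Context {R : realType}.
Local Notation Re := complex.Re.
Local Notation Im := complex.Im.
Local Notation C := (R[i]).

(** Differentiation of a complex function of a real variable goes by real and
    imaginary parts, since the complex numbers are here a normed module over
    themselves and not over the reals. *)
Definition cderive (f : R -> C) (df : C) : Prop :=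
  is_derive (0 : R) 1 (fun t => Re (f t)) (Re df) /\
  is_derive (0 : R) 1 (fun t => Im (f t)) (Im df).

Lemma cderive_cst (z : C) : cderive (fun=> z) 0.
Proof. by split; apply: is_derive_cst. Qed.

Lemma cderiveD f g df dg : cderive f df -> cderive g dg ->
  cderive (fun t => f t + g t) (df + dg).
Proof.
move=> [fR fI] [gR gI]; split.
- have -> : (fun t => Re (f t + g t)) = (fun t => Re (f t)) + (fun t => Re (g t)).
    by apply/funext => t; rewrite raddfD.
  by rewrite raddfD; exact: is_deriveD.
- have -> : (fun t => Im (f t + g t)) = (fun t => Im (f t)) + (fun t => Im (g t)).
    by apply/funext => t; rewrite raddfD.
  by rewrite raddfD; exact: is_deriveD.
Qed.

Lemma cderive_sum (I : finType) (f : I -> R -> C) df :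
  (forall i, cderive (f i) (df i)) ->
  cderive (fun t => \sum_i f i t) (\sum_i df i).
Proof.
move=> fdf; have -> : (fun t => \sum_i f i t) = \sum_i f i.
  by apply/funext => t; rewrite fct_sumE.
elim/big_ind2: _ => [|g1 g2 d1 d2 H1 H2|i _]; first exact: cderive_cst.
  exact: cderiveD.
exact: fdf.
Qed.

Lemma Re_mul (x y : C) : Re (x * y) = Re x * Re y - Im x * Im y.
Proof. by case: x y => ? ? []. Qed.

Lemma Im_mul (x y : C) : Im (x * y) = Re x * Im y + Im x * Re y.
Proof. by case: x y => ? ? []. Qed.

Lemma cderiveM f g df dg : cderive f df -> cderive g dg ->
  cderive (fun t => f t * g t) (f 0 * dg + df * g 0).
Proof.
move=> [fR fI] [gR gI]; split.
- have -> : (fun t => Re (f t * g t)) =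
      (fun t => Re (f t)) * (fun t => Re (g t)) - (fun t => Im (f t)) * (fun t => Im (g t)).
    by apply/funext => t; rewrite Re_mul !fctE.
  apply: is_derive_eq (is_deriveB (is_deriveM fR gR) (is_deriveM fI gI)) _.
  rewrite /GRing.scale /=.
  by case: (f 0) (g 0) df dg {fR fI gR gI} => [a b] [c d] [a' b'] [c' d'] /=; ring.
- have -> : (fun t => Im (f t * g t)) =
      (fun t => Re (f t)) * (fun t => Im (g t)) + (fun t => Im (f t)) * (fun t => Re (g t)).
    by apply/funext => t; rewrite Im_mul !fctE.
  apply: is_derive_eq (is_deriveD (is_deriveM fR gI) (is_deriveM fI gR)) _.
  rewrite /GRing.scale /=.
  by case: (f 0) (g 0) df dg {fR fI gR gI} => [a b] [c d] [a' b'] [c' d'] /=; ring.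
Qed.

Lemma cderive_conj f df : cderive f df ->
  cderive (fun t => Num.conj (f t)) (Num.conj df).
Proof.
move=> [fR fI]; split.
- have -> : (fun t => Re (Num.conj (f t))) = (fun t => Re (f t)).
    by apply/funext => t; case: (f t).
  by have -> : Re (Num.conj df) = Re df by case: df {fR fI}.
- have -> : (fun t => Im (Num.conj (f t))) = - (fun t => Im (f t)).
    by apply/funext => t; rewrite /GRing.opp /=; case: (f t).
  have -> : Im (Num.conj df) = - Im df by case: df {fR fI}.
  exact: is_deriveN.
Qed.

Definition mderive m n (E : R -> 'M[C]_(m, n)) (dE : 'M[C]_(m, n)) : Prop :=
  forall i j, cderive (fun t => E t i j) (dE i j).

Lemma mderive_cst m n (A : 'M[C]_(m, n)) : mderive (fun=> A) 0.
Proof. by move=> i j; rewrite mxE; exact: cderive_cst. Qed.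

Lemma mderiveM m n p (E : R -> 'M[C]_(m, n)) (F : R -> 'M[C]_(n, p)) dE dF :
  mderive E dE -> mderive F dF ->
  mderive (fun t => E t *m F t) (E 0 *m dF + dE *m F 0).
Proof.
move=> HE HF i j; rewrite !mxE -big_split /=.
have -> : (fun t => (E t *m F t) i j) = (fun t => \sum_k E t i k * F t k j).
  by apply/funext => t; rewrite mxE.
by apply: cderive_sum => k; exact: cderiveM.
Qed.

Lemma mderive_ctrmx m n (E : R -> 'M[C]_(m, n)) dE :
  mderive E dE -> mderive (fun t => (E t)^t*) (dE^t*).
Proof.
move=> HE i j; rewrite !mxE.
have -> : (fun t => (E t)^t* i j) = (fun t => Num.conj (E t j i)).
  by apply/funext => t; rewrite !mxE.
exact: cderive_conj.
Qed.

Lemma mderive_trace n (E : R -> 'M[C]_n) dE :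
  mderive E dE -> cderive (fun t => \tr (E t)) (\tr dE).
Proof. by move=> HE; apply: cderive_sum => i. Qed.

Lemma expm_scale0 n (v : 'M[C]_n) : expm ((0 : R)%:C%C *: v) = 1%:M.
Proof.
apply/matrixP => i j; have [eR eI _ _] := expm_entry v i j.
by apply/eqP; rewrite eq_complex eR eI !eqxx.
Qed.

Lemma mderive_expm n (v : 'M[C]_n) :
  mderive (fun t : R => expm (t%:C%C *: v)) v.
Proof. by move=> i j; have [] := expm_entry v i j. Qed.

(** A matrix coefficient of the conjugation [A |-> x^* A x]. *)
Definition coef n (A B : 'M[C]_n) (x : 'M[C]_n) : R :=
  Re (\tr (B *m (x^t* *m A *m x))).

(** The product rule at the identity moves [v] from the group element into a
    bracket with [B]. Matrix coefficients are thus stable under derivation,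
    which makes every tensor field below polynomial in the group element. *)
Lemma is_derive_coef n (A B g v : 'M[C]_n) : su v ->
  is_derive (0 : R) 1 (fun t : R => coef A B (g *m expm (t%:C%C *: v)))
    (coef A (bracket v B) g).
Proof.
move=> [vH _]; have Ev := mderive_expm v.
have gE := mderiveM (mderive_cst g) Ev.
have := mderive_trace (mderiveM (mderive_cst B)
  (mderiveM (mderiveM (mderive_ctrmx gE) (mderive_cst A)) gE)) => -[HR _].
apply: is_derive_eq HR _; rewrite /coef; congr Re.
rewrite !expm_scale0 !(mul0mx, mulmx0, mulmx1, addr0, add0r).
rewrite trmx_mul map_mxM vH mulmxDr addrC mxtraceD.
set T := g^t*; rewrite /bracket mulmxBl raddfB /= !mulNmx mulmxN raddfN /=.
have E1 : B *m (T *m A *m (g *m v)) = B *m (T *m A *m g) *m v by rewrite !mulmxA.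
have E2 : B *m (v *m T *m A *m g) = B *m v *m (T *m A *m g) by rewrite !mulmxA.
rewrite E2 E1.
have E3 : \tr (B *m (T *m A *m g) *m v) = \tr (v *m B *m (T *m A *m g)).
  by rewrite mxtrace_mulC mulmxA.
rewrite E3.
exact: addrC.
Qed.
End Derivative.

Section Continuity.
Context {R : realType}.
Local Notation Re := complex.Re.
Local Notation Im := complex.Im.
Local Notation C := (R[i]).

Definition ccont n (f : 'M[C]_n -> C) : Prop :=
  continuous (fun x => Re (f x)) /\ continuous (fun x => Im (f x)).

Lemma ccont_entry n (i j : 'I_n) : ccont (fun x => x i j).
Proof.
have entry_ball (x : 'M[C]_n) (e : R) : 0 < e ->
    \forall y \near (x : 'M[C]_n), `|x i j - (y : 'M[C]_n) i j| < e%:C%C.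
  move=> e0; have e0C : 0 < e%:C%C by rewrite ltcR.
  apply: filterS (nbhsx_ballx x _ e0C) => y [_ /(_ i j)].
  by rewrite -ball_normE.
split=> x; apply/(@cvgrPdist_lt _ _ _ _ (nbhs_filter (x : 'M[C]_n))) => e e0.
- apply: (@filterS _ _ (nbhs_filter x) _ _ _ (entry_ball x e e0)) => y.
  rewrite -ltcR -raddfB.
  by apply: le_lt_trans; exact: normc_ge_Re.
- apply: (@filterS _ _ (nbhs_filter x) _ _ _ (entry_ball x e e0)) => y.
  rewrite -ltcR -raddfB.
  by apply: le_lt_trans; exact: normc_ge_Im.
Qed.

Lemma ccont_cst n (z : C) : ccont (fun _ : 'M[C]_n => z).
Proof. by split; apply: cst_continuous. Qed.

Lemma ccontD n (f g : 'M[C]_n -> C) : ccont f -> ccont g ->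
  ccont (fun x => f x + g x).
Proof.
move=> [fR fI] [gR gI]; split.
- have -> : (fun x => Re (f x + g x)) = (fun x => Re (f x)) + (fun x => Re (g x)).
    by apply/funext => x; rewrite raddfD.
  by move=> x; apply: continuousD; [exact: fR | exact: gR].
- have -> : (fun x => Im (f x + g x)) = (fun x => Im (f x)) + (fun x => Im (g x)).
    by apply/funext => x; rewrite raddfD.
  by move=> x; apply: continuousD; [exact: fI | exact: gI].
Qed.

Lemma ccontM n (f g : 'M[C]_n -> C) : ccont f -> ccont g ->
  ccont (fun x => f x * g x).
Proof.
move=> [fR fI] [gR gI]; split.
- have -> : (fun x => Re (f x * g x)) =
      (fun x => Re (f x)) * (fun x => Re (g x)) - (fun x => Im (f x)) * (fun x => Im (g x)).
    by apply/funext => x; rewrite Re_mul.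
  move=> x; apply: continuousB; apply: continuousM.
  - exact: fR.
  - exact: gR.
  - exact: fI.
  - exact: gI.
- have -> : (fun x => Im (f x * g x)) =
      (fun x => Re (f x)) * (fun x => Im (g x)) + (fun x => Im (f x)) * (fun x => Re (g x)).
    by apply/funext => x; rewrite Im_mul.
  move=> x; apply: continuousD; apply: continuousM.
  - exact: fR.
  - exact: gI.
  - exact: fI.
  - exact: gR.
Qed.

Lemma ccont_conj n (f : 'M[C]_n -> C) : ccont f ->
  ccont (fun x => Num.conj (f x)).
Proof.
move=> [fR fI]; split.
- have -> : (fun x => Re (Num.conj (f x))) = (fun x => Re (f x)).
    by apply/funext => t; case: (f t).
  exact: fR.
- have -> : (fun x => Im (Num.conj (f x))) = - (fun x => Im (f x)).
    by apply/funext => t; rewrite /GRing.opp /=; case: (f t).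
  by move=> x; apply: continuousN; exact: fI.
Qed.

Lemma ccont_sum n (I : finType) (f : I -> 'M[C]_n -> C) :
  (forall i, ccont (f i)) -> ccont (fun x => \sum_i f i x).
Proof.
move=> fc; have -> : (fun x => \sum_i f i x) = \sum_i f i.
  by apply/funext => t; rewrite fct_sumE.
elim/big_ind: _ => [|f1 f2 H1 H2|i _]; first exact: ccont_cst.
  exact: ccontD.
exact: fc.
Qed.

Lemma ccont_prod n (I : finType) (f : I -> 'M[C]_n -> C) :
  (forall i, ccont (f i)) -> ccont (fun x => \prod_i f i x).
Proof.
move=> fc; elim: (index_enum I) => [|i s IH].
  by under eq_fun do rewrite big_nil; exact: ccont_cst.
by under eq_fun do rewrite big_cons; exact: ccontM.
Qed.

Lemma ccont_mulmx n m k l (f : 'M[C]_n -> 'M[C]_(m, k)) (g : 'M[C]_n -> 'M[C]_(k, l)) :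
    (forall i j, ccont (fun x => f x i j)) -> (forall i j, ccont (fun x => g x i j)) ->
  forall i j, ccont (fun x => (f x *m g x) i j).
Proof.
move=> fc gc i j; under eq_fun do rewrite mxE.
by apply: ccont_sum => a; exact: ccontM.
Qed.

Lemma ccont_ctrmx n m k (f : 'M[C]_n -> 'M[C]_(m, k)) :
  (forall i j, ccont (fun x => f x i j)) -> forall i j, ccont (fun x => (f x)^t* i j).
Proof. by move=> fc i j; under eq_fun do rewrite !mxE; exact: ccont_conj. Qed.

Lemma ccont_det n : ccont (fun x : 'M[C]_n => \det x).
Proof.
apply: ccont_sum => s; apply: ccontM; first exact: ccont_cst.
by apply: ccont_prod => i; exact: ccont_entry.
Qed.

Lemma continuous_coef n (A B : 'M[C]_n) : continuous (coef A B).
Proof.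
suff [] : ccont (fun x => \tr (B *m (x^t* *m A *m x))) by [].
apply: ccont_sum => i; apply: ccont_mulmx => a b; first exact: ccont_cst.
apply: ccont_mulmx => c d; last exact: ccont_entry.
apply: ccont_mulmx => e f; last exact: ccont_cst.
by apply: ccont_ctrmx => g h; exact: ccont_entry.
Qed.

Lemma coefZ n (A B x : 'M[C]_n) (c : R) : coef A (c%:C%C *: B) x = c * coef A B x.
Proof.
rewrite /coef -scalemxAl mxtraceZ; move: (\tr _) => z.
by case: z => a b; simpc.
Qed.

Lemma lderivable_coef n (A B g v : 'M[C]_n) : su v -> lderivable (coef A B) g v.
Proof. by move=> vsu; have [] := is_derive_coef A B g vsu. Qed.

Lemma lderive_coef n (A B v : 'M[C]_n) : su v ->
  (fun g => lderive (coef A B) g v) = coef A (bracket v B).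
Proof.
move=> vsu; apply/funext => g; rewrite /lderive derive1E.
by have H := is_derive_coef A B g vsu; rewrite derive_val.
Qed.

(** Iterated derivatives are again matrix coefficients, so smoothness reduces
    to continuity. *)
Lemma smooth_coef n (A B : 'M[C]_n) : smooth_on_SU (coef A B).
Proof.
move=> s sP; have [B' ->] : exists B', lderive_iter s (coef A B) = coef A B'.
  elim: s sP => [|v s IH] sP; first by exists B.
  have [B' E] := IH (fun w ws => sP w (mem_behead (s := v :: s) ws)).
  exists (bracket v B'); rewrite /= -/(lderive_iter s _) E lderive_coef //.
  by apply: sP; rewrite mem_head.
split; first by apply: continuous_subspaceT => x; exact: continuous_coef.
by move=> g v _ vsu; exact: lderivable_coef.
Qed.
End Continuity.

(** * Killing fields of the Grassmannian *)

Lemma tr_delta_mul (K : pzRingType) m k (S : 'M[K]_(m, k)) i j :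
  \tr (delta_mx j i *m S) = S i j.
Proof.
rewrite /mxtrace (eq_bigr (fun l => (l == j)%:R * S i l)) => [|l _].
  rewrite (bigD1 j) //= eqxx mul1r big1 ?addr0 // => l lj.
  by rewrite (negPf lj) mul0r.
rewrite mxE (bigD1 i) //= mxE eqxx andbT big1 ?addr0 // => o oi.
by rewrite mxE (negPf oi) andbF mul0r.
Qed.

Lemma tr_mul_delta2 (K : comPzRingType) m k (A : 'M[K]_m) (a a' : K)
    (i i' : 'I_m) (j j' : 'I_k) :
  \tr (A *m (a *: delta_mx i j) *m (a' *: delta_mx j' i'))
  = a * a' * (A i' i * (j == j')%:R).
Proof.
rewrite -!scalemxAr -scalemxAl !mxtraceZ -mulmxA mul_delta_mx_cond mulrA [a * a']mulrC.
case: eqP => _; rewrite ?mulr1n ?mulr0n ?mulmx0 ?mxtrace0 !(mulr0, mulr1) //.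
by rewrite mxtrace_mulC tr_delta_mul.
Qed.

Lemma tr_delta2_mul (K : comPzRingType) m k (B : 'M[K]_k) (a a' : K)
    (i i' : 'I_m) (j j' : 'I_k) :
  \tr ((a *: delta_mx i j) *m B *m (a' *: delta_mx j' i'))
  = a * a' * ((i == i')%:R * B j j').
Proof.
rewrite -mulmxA mxtrace_mulC tr_mul_delta2 [a' * a]mulrC [i' == i]eq_sym.
by rewrite [B j j' * _]mulrC.
Qed.

Lemma block_diag_mul (K : pzRingType) p q (a a' : 'M[K]_p) (d d' : 'M[K]_q) S1 S2 S3 S4 :
  block_mx a 0 0 d *m block_mx S1 S2 S3 S4 *m block_mx a' 0 0 d'
  = block_mx (a *m S1 *m a') (a *m S2 *m d') (d *m S3 *m a') (d *m S4 *m d').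
Proof. by rewrite !mulmx_block !(mul0mx, mulmx0, addr0, add0r). Qed.

Section KillingField.
Context {R : realType} {p q : nat}.
Local Notation Re := complex.Re.
Local Notation Im := complex.Im.
Local Notation C := (R[i]).
Local Notation n := (p + q)%N.
Local Notation M := 'M[C]_n.

Lemma ctrmxM m k l (A : 'M[C]_(m, k)) (B : 'M[C]_(k, l)) :
  (A *m B)^t* = B^t* *m A^t*.
Proof. by rewrite trmx_mul map_mxM. Qed.

Lemma ctrmxK m k (A : 'M[C]_(m, k)) : (A^t*)^t* = A.
Proof. by apply/matrixP => i j; rewrite !mxE; exact: conjCK. Qed.

Definition offdiag (S : M) : M := block_mx 0 (ursubmx S) (dlsubmx S) 0.

Lemma tr_mul_block (S T : M) :
  \tr (S *m T) = \tr (ulsubmx S *m ulsubmx T) + \tr (ursubmx S *m dlsubmx T)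
    + (\tr (dlsubmx S *m ursubmx T) + \tr (drsubmx S *m drsubmx T)).
Proof.
rewrite -{1}[S]submxK -{1}[T]submxK mulmx_block mxtrace_block !mxtraceD.
by rewrite !addrA.
Qed.

(** The projection to [m] is self-adjoint for the trace form, so it can be
    moved from the factor that depends on the group element to the constant
    one. *)
Lemma tr_offdiag (S T : M) : \tr (offdiag S *m T) = \tr (S *m offdiag T).
Proof.
rewrite !tr_mul_block /offdiag !block_mxKul !block_mxKur !block_mxKdl !block_mxKdr.
by rewrite !mulmx0 !mul0mx.
Qed.

Lemma trace_offdiag (S : M) : \tr (offdiag S) = 0.
Proof. by rewrite mxtrace_block !mxtrace0 addr0. Qed.

Lemma offdiag_mspace (S : M) : mspace S -> offdiag S = S.
Proof. by case=> _ S1 S2; rewrite -[RHS]submxK S1 S2. Qed.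

Lemma metricE (X Y : M) : \tr X = 0 ->
  metric X Y = - (2 * n%:R) * Re (\tr (X *m Y)).
Proof. by move=> X0; rewrite /metric killing_formE // mulNr. Qed.

(** The infinitesimal action of a skew-hermitian [A] on [M], extended by the
    same formula to all matrices [x]. *)
Definition killing_of (A : M) (x : M) : M := offdiag (x^t* *m A *m x).

Lemma flat_killing_of (A : M) (w : 'I_1 -> M) :
  (fun x => flat (killing_of A) x w)
  = coef A ((- (2 * n%:R))%:C%C *: offdiag (w ord0)).
Proof.
apply/funext => x; rewrite coefZ /flat metricE ?trace_offdiag //.
by rewrite /killing_of tr_offdiag mxtrace_mulC.
Qed.

Lemma lderive_flat (A g v : M) (w : 'I_1 -> M) : su v ->
  lderive (fun x => flat (killing_of A) x w) g v
  = - (2 * n%:R) * coef A (bracket v (offdiag (w ord0))) g.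
Proof.
move=> vsu; rewrite flat_killing_of -coefZ -bracketZr.
exact: (congr1 (fun f => f g) (lderive_coef A _ vsu)).
Qed.

Lemma bracketC (X Y : M) : bracket X Y = - bracket Y X.
Proof. by rewrite /bracket opprB. Qed.

Lemma coefN (A B x : M) : coef A (- B) x = - coef A B x.
Proof. by rewrite /coef mulNmx !raddfN. Qed.

(** The two derivatives in the exterior derivative contribute the same
    bracket, which turns the factor [2 n] of the Killing form into [4 n]. *)
Lemma ext_d_flat (A g : M) (w : 'I_2 -> M) : mspace (w ord0) -> mspace (w ord_max) ->
  ext_d (flat (killing_of A)) g w
  = - (4 * n%:R) * coef A (bracket (w ord0) (w ord_max)) g.
Proof.
move=> m0 m1.
have mw i : mspace (w i).
  by case: (unliftP ord0 i) => [j ->|-> //]; rewrite ord1 (_ : lift _ _ = ord_max) //; apply/val_inj.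
have l0 : lift ord0 (ord0 : 'I_1) = ord_max :> 'I_2 by apply/val_inj.
have l1 : lift ord_max (ord0 : 'I_1) = ord0 :> 'I_2 by apply/val_inj.
rewrite /ext_d (eq_bigr (fun i : 'I_2 => (-1) ^+ i *
    (- (2 * n%:R) * coef A (bracket (w i) (offdiag (w (lift i ord0)))) g))); last first.
  move=> i _; congr (_ * _).
  by rewrite (lderive_flat A g (fun j => w (lift i j))) //; case: (mw i).
rewrite big_ord_recl big_ord1 l0 l1 !offdiag_mspace //.
rewrite [bracket (w ord_max) _]bracketC coefN /= expr0 expr1.
ring.
Qed.

Definition skew k (A : 'M[C]_k) := A^t* = - A.

Lemma skew_conj (A x : M) : skew A -> skew (x^t* *m A *m x).
Proof.
move=> As; rewrite /skew !ctrmxM As ctrmxK mulmxA mulmxN mulNmx.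
by [].
Qed.

Lemma mspace_offdiag (S : M) : skew S -> mspace (offdiag S).
Proof.
move=> Ss; split; rewrite /offdiag ?block_mxKul ?block_mxKdr //.
split; last exact: trace_offdiag.
rewrite tr_block_mx map_block_mx opp_block_mx !trmx0 !map_mx0 !oppr0.
rewrite trmx_dlsub trmx_ursub map_ursubmx map_dlsubmx Ss.
by congr block_mx; apply/matrixP => i j; rewrite !mxE.
Qed.

(** Entries are traces, so the entries of a Killing field are matrix
    coefficients. *)
Lemma offdiag_entry (S : M) i j :
  offdiag S i j = \tr (offdiag (delta_mx j i) *m S).
Proof. by rewrite tr_offdiag tr_delta_mul. Qed.

Lemma smooth_killing_of (A : M) : skew A -> smooth_vector_field (killing_of A).
Proof.
move=> As; split.
- by move=> g _; apply/mspace_offdiag/skew_conj.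
- move=> g k _ [[kU _] kur kdl].
  have kE : k = block_mx (ulsubmx k) 0 0 (drsubmx k) by rewrite -[LHS]submxK kur kdl.
  rewrite /killing_of invmx_unitary // ctrmxM.
  have -> : k^t* *m g^t* *m A *m (g *m k) = k^t* *m (g^t* *m A *m g) *m k.
    by rewrite !mulmxA.
  move: (g^t* *m A *m g) => S; rewrite kE.
  rewrite tr_block_mx map_block_mx !trmx0 !map_mx0 /offdiag -{1 2}[S]submxK.
  rewrite !block_diag_mul block_mxKur block_mxKdl.
  by rewrite !mulmx0 !mul0mx.
- move=> i j.
  have -> : (fun g => Re (killing_of A g i j)) = coef A (offdiag (delta_mx j i)).
    by apply/funext => g; rewrite /killing_of offdiag_entry.
  have -> : (fun g => Im (killing_of A g i j)) =
      coef A (- 'i%C *: offdiag (delta_mx j i)).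
    apply/funext => g; rewrite /killing_of offdiag_entry /coef -scalemxAl mxtraceZ.
    by case: (\tr _) => a b /=; ring.
  by split; exact: smooth_coef.
Qed.

(** The Killing equation holds because the derivative of the one-form at [g] is
    [g(ad A_g Y, Z)] for [A_g = g^* A g], which is skew in [Y] and [Z]. *)
Lemma killing_field_killing_of (A : M) : skew A -> killing_field (killing_of A).
Proof.
move=> As; split; first exact: smooth_killing_of.
move=> g Y Z _ mY mZ; have [[suY _ _] [suZ _ _]] := (mY, mZ).
rewrite [X in X + _](lderive_flat A g (fun=> Z) suY).
rewrite [X in _ + X](lderive_flat A g (fun=> Y) suZ).
by rewrite !offdiag_mspace // [bracket Z Y]bracketC coefN mulrN subrr.
Qed.
End KillingField.

(** * Two-forms of isotropy elements on the frame *)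

Section FiniteSums.
Variables (T : Type).

(** Defined by matching, so that entries at concrete positions compute. *)
Definition fcons k (t : T) (f : 'I_k -> T) : 'I_k.+1 -> T :=
  fun i => let: Ordinal m lt := i in
    (if m is m'.+1 return (m < k.+1)%N -> T then fun lt => f (Ordinal (lt : (m' < k)%N))
     else fun=> t) lt.

Definition fnil : 'I_0 -> T := fun i => match notF (ltn_ord i) with end.

Lemma fcons0 k t (f : 'I_k -> T) : fcons t f ord0 = t.
Proof. by []. Qed.

Lemma fcons_lift k t (f : 'I_k -> T) i : fcons t f (lift ord0 i) = f i.
Proof. by case: i => m lt; congr f; apply/val_inj. Qed.
End FiniteSums.

Lemma fcons_map (T U : Type) k (g : T -> U) t (f : 'I_k -> T) :
  (fun i => g (fcons t f i)) = fcons (g t) (fun i => g (f i)).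
Proof. by apply/funext => -[[|m] lt]. Qed.

Lemma sum_ffun0 (I : finType) (V : nmodType) (F : ('I_0 -> I) -> V) :
  \sum_(s : {ffun 'I_0 -> I}) F s = F (@fnil I).
Proof.
rewrite (eq_bigr (fun=> F (@fnil I))) => [|s _].
  by rewrite sumr_const card_ffun card_ord expn0 mulr1n.
by congr F; apply/funext => -[].
Qed.

Lemma sum_ffun_cons (I : finType) (V : nmodType) k (F : ('I_k.+1 -> I) -> V) :
  \sum_(s : {ffun 'I_k.+1 -> I}) F s
  = \sum_(t : I) \sum_(s : {ffun 'I_k -> I}) F (fcons t s).
Proof.
rewrite pair_big /=.
pose h (ts : I * {ffun 'I_k -> I}) : {ffun 'I_k.+1 -> I} := finfun (fcons ts.1 ts.2).
pose h' (s : {ffun 'I_k.+1 -> I}) := (s ord0, [ffun i => s (lift ord0 i)]).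
rewrite (reindex h) /=.
  by apply: eq_bigr => ts _; congr F; apply/funext => i; rewrite ffunE.
exists h' => [[t s] _|s _]; rewrite /h /h' /=.
  by congr (_, _); [rewrite ffunE | apply/ffunP => i; rewrite !ffunE fcons_lift].
apply/ffunP => i; rewrite ffunE; case: (unliftP ord0 i) => [j ->|->].
  by rewrite fcons_lift ffunE.
by rewrite fcons0.
Qed.

Lemma block_offdiag_comm (K : pzRingType) p q (u w : 'M[K]_(p, q)) (u' w' : 'M[K]_(q, p)) :
  block_mx 0 u u' 0 *m block_mx 0 w w' 0 - block_mx 0 w w' 0 *m block_mx 0 u u' 0
  = block_mx (u *m w' - w *m u') 0 0 (u' *m w - w' *m u).
Proof.
rewrite !mulmx_block !mul0mx !mulmx0 !addr0 !add0r.
by rewrite opp_block_mx add_block_mx !subr0.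
Qed.

Lemma block_skew_comm (K : pzRingType) p q (u w : 'M[K]_(p, q)) (u' w' : 'M[K]_(q, p)) :
  block_mx 0 u (- u') 0 *m block_mx 0 w (- w') 0
    - block_mx 0 w (- w') 0 *m block_mx 0 u (- u') 0
  = block_mx (w *m u' - u *m w') 0 0 (w' *m u - u' *m w).
Proof.
rewrite block_offdiag_comm !mulmxN !mulNmx !opprK.
by rewrite [- (u *m w') + _]addrC [- (u' *m w) + _]addrC.
Qed.

Section Frame.
Context {R : realType} {p q : nat}.
Local Notation Re := complex.Re.
Local Notation C := (R[i]).
Local Notation n := (p + q)%N.
Local Notation M := 'M[C]_n.

Definition vec2 T (x y : T) : 'I_2 -> T := fcons x (fcons y (@fnil T)).
Definition vec3 T (x y z : T) : 'I_3 -> T := fcons x (vec2 y z).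

Lemma form_ip2 (a b : @form R p q 2) :
  form_ip a b = 2^-1 * \sum_(s : mbasis_index p q) \sum_(t : mbasis_index p q)
    a (vec2 (mbasis s) (mbasis t)) * b (vec2 (mbasis s) (mbasis t)).
Proof.
rewrite /form_ip; congr (_ * _).
pose F (s : 'I_2 -> mbasis_index p q) : R :=
  a (fun i => mbasis (s i)) * b (fun i => mbasis (s i)).
rewrite (sum_ffun_cons F); apply: eq_bigr => s _.
rewrite (sum_ffun_cons (fun f => F (fcons s f))); apply: eq_bigr => t _.
rewrite (sum_ffun0 (fun f => F (fcons s (fcons t f)))) /F !fcons_map.
by have -> : (fun i : 'I_0 => mbasis (@fnil (mbasis_index p q) i) : M) = @fnil M by apply/funext => -[].
Qed.

(** The identification of the complex matrices of size [p] by [q] with [m]. *)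
Definition offm (u : 'M[C]_(p, q)) : M := block_mx 0 u (- u^t*) 0.

(** The phase of the real frame vector with boolean label [b]. *)
Definition phase (b : bool) : C := if b then 'i%C else 1.

Definition mbasis_scale : R := (2 * Num.sqrt n%:R)^-1.

Lemma mbasisE b i j :
  mbasis ((b, i), j) = offm ((mbasis_scale%:C%C * phase b) *: delta_mx i j) :> M.
Proof.
rewrite /offm /mbasis scale_block_mx !scaler0 scalerA; congr block_mx.
rewrite scalerA -/mbasis_scale -[if b then _ else _]/(phase b).
have sJ : Num.conj mbasis_scale%:C%C = mbasis_scale%:C%C :> C by exact: conjc_real.
apply/matrixP => k l; rewrite !mxE !rmorphM rmorph_nat /= sJ.
by rewrite andbC mulrN mulNr.
Qed.

Lemma bracket_offm (u w : 'M[C]_(p, q)) :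
  bracket (offm u) (offm w) =
  block_mx (w *m u^t* - u *m w^t*) 0 0 (w^t* *m u - u^t* *m w).
Proof.
exact: block_skew_comm.
Qed.

Lemma Re_conj (z : C) : Re (Num.conj z) = Re z.
Proof. by case: z. Qed.

Lemma tr_ctrmx k (A : 'M[C]_k) : \tr (A^t*) = Num.conj (\tr A).
Proof. by rewrite /mxtrace rmorph_sum; apply: eq_bigr => i _; rewrite !mxE. Qed.
End Frame.

Section FrameValues.
Context {R : realType} {p q : nat}.
Local Notation Re := complex.Re.
Local Notation C := (R[i]).
Local Notation n := (p + q)%N.
Local Notation M := 'M[C]_n.
Local Notation scale := (@mbasis_scale R p q).
Local Notation phase := (@phase R).

Lemma Re_tr_bracket (F : M) (u w : 'M[C]_(p, q)) : skew F ->
  Re (\tr (F *m bracket (offm u) (offm w)))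
  = - 2 * Re (\tr (ulsubmx F *m u *m w^t*) - \tr (u *m drsubmx F *m w^t*)).
Proof.
move=> Fs; have F1 : (ulsubmx F)^t* = - ulsubmx F.
  by rewrite trmx_ulsub map_ulsubmx Fs; apply/matrixP => i j; rewrite !mxE.
have F2 : (drsubmx F)^t* = - drsubmx F.
  by rewrite trmx_drsub map_drsubmx Fs; apply/matrixP => i j; rewrite !mxE.
rewrite bracket_offm tr_mul_block !block_mxKul !block_mxKur !block_mxKdl !block_mxKdr.
rewrite !mulmx0 !mxtrace0 addr0 add0r !mulmxBr !mxtraceD !raddfN /=.
have E1 : \tr (ulsubmx F *m (w *m u^t*)) = - Num.conj (\tr (ulsubmx F *m u *m w^t*)).
  rewrite -tr_ctrmx !ctrmxM ctrmxK F1 !mulmxN raddfN /= opprK.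
  by rewrite [LHS]mxtrace_mulC mulmxA.
have E2 : \tr (drsubmx F *m (u^t* *m w)) = - Num.conj (\tr (u *m drsubmx F *m w^t*)).
  rewrite -tr_ctrmx !ctrmxM ctrmxK F2 !mulNmx mulmxN raddfN /= opprK.
  by rewrite [in LHS]mulmxA [LHS]mxtrace_mulC.
have E3 : \tr (drsubmx F *m (w^t* *m u)) = \tr (u *m drsubmx F *m w^t*).
  by rewrite [in LHS]mulmxA [LHS]mxtrace_mulC mulmxA.
rewrite E1 E2 E3 [\tr (ulsubmx F *m (u *m _))]mxtrace_mulC -mxtrace_mulC mulmxA.
move: (\tr (ulsubmx F *m u *m _)) (\tr (u *m _ *m _)) => [a b] [c d] /=.
ring.
Qed.

Lemma endo_form_bracket (F : M) (w : 'I_2 -> M) :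
  endo_form (bracket F) w = - (2 * n%:R) * Re (\tr (F *m bracket (w ord0) (w ord_max))).
Proof.
rewrite /endo_form metricE; last by rewrite /bracket raddfB /= mxtrace_mulC subrr.
congr (_ * Re _); rewrite /bracket mulmxBl mulmxBr !raddfB /=.
by congr (_ - _); [rewrite mulmxA | rewrite -mulmxA mxtrace_mulC mulmxA].
Qed.

(** Matrix of the action of the diagonal blocks of [F] on the matrix units. *)
Definition iso_mx (F : M) (s t : 'I_p * 'I_q) : C :=
  ulsubmx F t.1 s.1 * (s.2 == t.2)%:R - (s.1 == t.1)%:R * drsubmx F s.2 t.2.

Definition cidx (s : mbasis_index p q) : 'I_p * 'I_q := (s.1.2, s.2).

Lemma scale_sqr : (0 < n)%N -> 4 * n%:R * (scale * scale) = 1.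
Proof.
move=> n0; have N0 : (0 : R) < n%:R by rewrite ltr0n.
have sN : Num.sqrt n%:R * Num.sqrt n%:R = n%:R :> R.
  by rewrite -expr2 sqr_sqrtr ?ltW.
have s0 : Num.sqrt n%:R != 0 :> R by rewrite gt_eqF // sqrtr_gt0.
rewrite /mbasis_scale; move: (Num.sqrt _) sN s0 => s sN s0; rewrite -sN.
by field.
Qed.

(** The form of [ad F] is invariant under the complex structure, hence
    determined by a complex matrix indexed by matrix units; the normalization
    of the frame absorbs the factor of the Killing form. *)
Lemma frame_bracket (F : M) (s t : mbasis_index p q) : skew F ->
  - (2 * n%:R) * Re (\tr (F *m bracket (mbasis s) (mbasis t)))
  = Re (phase s.1.1 * Num.conj (phase t.1.1) * iso_mx F (cidx s) (cidx t)).
Proof.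
case: s t => [[b i] j] [[b' i'] j'] Fs; rewrite !mbasisE Re_tr_bracket //=.
have n0 : (0 < n)%N by rewrite addn_gt0 (leq_ltn_trans _ (ltn_ord i)).
set a := _ * phase b; set a' := _ * phase b'.
have -> : (a' *: delta_mx i' j')^t* = Num.conj a' *: delta_mx j' i'.
  by apply/matrixP => k l; rewrite !mxE rmorphM rmorph_nat andbC.
rewrite tr_mul_delta2 tr_delta2_mul /iso_mx /cidx /=.
have aE : a * Num.conj a' = (scale * scale)%:C%C * (phase b * Num.conj (phase b')).
  have sJ : Num.conj scale%:C%C = scale%:C%C :> C by exact: conjc_real.
  by rewrite /a /a' rmorphM /= sJ rmorphM /= mulrACA.
rewrite aE -mulrBr.
have Re_scale (r : R) (z y : C) : Re (r%:C%C * z * y) = r * Re (z * y).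
  by rewrite -mulrA; case: (z * y) => x x'; simpc.
rewrite Re_scale; set x := Re _.
transitivity (4 * n%:R * (scale * scale) * x); last by rewrite scale_sqr // mul1r.
move: scale x => r y; ring.
Qed.
End FrameValues.

(** * Projections to the two parallel subbundles *)

Lemma sum_delta (K : pzSemiRingType) (I : finType) (j : I) (F : I -> K) :
  \sum_k (j == k)%:R * F k = F j.
Proof.
rewrite (bigD1 j) //= eqxx mul1r big1 ?addr0 // => k kj.
by rewrite eq_sym (negPf kj) mul0r.
Qed.

Section Projection.
Context {R : realType} {p q : nat}.
Local Notation Re := complex.Re.
Local Notation C := (R[i]).
Local Notation n := (p + q)%N.
Local Notation M := 'M[C]_n.
Local Notation phase := (@phase R).
Local Notation form2 := (@form R p q 2).

Lemma sum_mbasis (V : nmodType) (F : mbasis_index p q -> V) :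
  \sum_s F s = \sum_(a : 'I_p * 'I_q) \sum_(b : bool) F ((b, a.1), a.2).
Proof.
rewrite pair_big /=.
pose h (x : 'I_p * 'I_q * bool) : mbasis_index p q := ((x.2, x.1.1), x.1.2).
rewrite (reindex h) //=.
exists (fun s : mbasis_index p q => ((s.1.2, s.2), s.1.1)).
  by move=> [[i j] b].
by move=> [[b i] j].
Qed.

Lemma sum_phase2 (A B : C) :
  \sum_(b : bool) \sum_(b' : bool)
    Re (phase b * Num.conj (phase b') * A) * Re (phase b * Num.conj (phase b') * B)
  = 2 * Re (A * Num.conj B).
Proof. by rewrite !big_bool; case: A B => [x y] [z t] /=; ring. Qed.

(** Each pair of matrix units carries four pairs of frame vectors; these add
    up to twice a hermitian product and cancel the factor [1/2!]. *)
Lemma form_ip_iso (a b : form2) (F G : M) : skew F -> skew G ->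
    (forall s t, a (vec2 (mbasis s) (mbasis t))
       = - (2 * n%:R) * Re (\tr (F *m bracket (mbasis s) (mbasis t)))) ->
    (forall s t, b (vec2 (mbasis s) (mbasis t))
       = - (2 * n%:R) * Re (\tr (G *m bracket (mbasis s) (mbasis t)))) ->
  form_ip a b = Re (\sum_(s : 'I_p * 'I_q) \sum_(t : 'I_p * 'I_q)
    iso_mx F s t * Num.conj (iso_mx G s t)).
Proof.
move=> Fs Gs aE bE; rewrite form_ip2.
under eq_bigr => s _ do under eq_bigr => t _ do
  rewrite aE bE (frame_bracket _ _ Fs) (frame_bracket _ _ Gs).
rewrite sum_mbasis raddf_sum mulr_sumr; apply: eq_bigr => s _ /=.
under eq_bigr => b1 _ do rewrite sum_mbasis.
rewrite exchange_big raddf_sum mulr_sumr; apply: eq_bigr => t _ /=.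
rewrite (sum_phase2 (iso_mx F (s.1, s.2) (t.1, t.2)) (iso_mx G (s.1, s.2) (t.1, t.2))).
by rewrite mulKf ?pnatr_eq0.
Qed.

Lemma sum_iso_p (F : M) (B : 'M[C]_p) : \tr B = 0 ->
  \sum_(s : 'I_p * 'I_q) \sum_(t : 'I_p * 'I_q)
    iso_mx F s t * Num.conj (iso_mx (block_mx B 0 0 0) s t)
  = q%:R * \sum_i \sum_i' ulsubmx F i' i * Num.conj (B i' i).
Proof.
move=> B0; transitivity (\sum_i \sum_(j : 'I_q) \sum_i'
    (ulsubmx F i' i - (i == i')%:R * drsubmx F j j) * Num.conj (B i' i)).
  rewrite [RHS]pair_big /=; apply: eq_bigr => -[i j] _ /=.
  rewrite -(pair_big xpredT xpredT (fun i' j' => iso_mx F (i, j) (i', j') *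
    Num.conj (iso_mx (block_mx B 0 0 0) (i, j) (i', j')))) /=.
  apply: eq_bigr => i' _.
  transitivity (\sum_j' (j == j')%:R * ((ulsubmx F i' i * (j == j')%:R
     - (i == i')%:R * drsubmx F j j') * Num.conj (B i' i))); last first.
    by rewrite sum_delta eqxx mulr1.
  apply: eq_bigr => j' _.
  have -> : iso_mx (block_mx B 0 0 0) (i, j) (i', j') = B i' i * (j == j')%:R.
    by rewrite /iso_mx block_mxKul block_mxKdr /= [X in _ - _ * X]mxE mulr0 subr0.
  by rewrite rmorphM rmorph_nat /iso_mx /=; ring.
transitivity (\sum_i \sum_(j : 'I_q) \sum_i' ulsubmx F i' i * Num.conj (B i' i)
   - \sum_(i : 'I_p) \sum_(j : 'I_q) drsubmx F j j * Num.conj (B i i)).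
  rewrite -sumrB; apply: eq_bigr => i _; rewrite -sumrB; apply: eq_bigr => j _.
  rewrite -(sum_delta i (fun i' => drsubmx F j j * Num.conj (B i' i))) -sumrB.
  by apply: eq_bigr => i' _; ring.
(* this is where [B] being trace-free enters *)
have -> : \sum_(i : 'I_p) \sum_(j : 'I_q) drsubmx F j j * Num.conj (B i i) = 0.
  under eq_bigr => i _ do rewrite -mulr_suml.
  by rewrite -mulr_sumr -rmorph_sum /= -/(mxtrace B) B0 rmorph0 mulr0.
rewrite subr0 mulr_sumr; apply: eq_bigr => i _.
by rewrite sumr_const card_ord -[LHS]mulr_natl.
Qed.

Lemma sum_iso_q (F : M) (B : 'M[C]_q) : \tr B = 0 ->
  \sum_(s : 'I_p * 'I_q) \sum_(t : 'I_p * 'I_q)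
    iso_mx F s t * Num.conj (iso_mx (block_mx 0 0 0 B) s t)
  = p%:R * \sum_j \sum_j' drsubmx F j j' * Num.conj (B j j').
Proof.
move=> B0; transitivity (\sum_(i : 'I_p) \sum_(j : 'I_q) \sum_j'
    (drsubmx F j j' - (j == j')%:R * ulsubmx F i i) * Num.conj (B j j')).
  rewrite [RHS]pair_big /=; apply: eq_bigr => -[i j] _ /=.
  rewrite -(pair_big xpredT xpredT (fun i' j' => iso_mx F (i, j) (i', j') *
    Num.conj (iso_mx (block_mx 0 0 0 B) (i, j) (i', j')))) /= exchange_big /=.
  apply: eq_bigr => j' _.
  transitivity (\sum_i' (i == i')%:R * (((i == i')%:R * drsubmx F j j'
     - ulsubmx F i' i * (j == j')%:R) * Num.conj (B j j'))); last first.
    by rewrite sum_delta eqxx mul1r [ulsubmx F i i * _]mulrC.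
  apply: eq_bigr => i' _.
  have -> : iso_mx (block_mx 0 0 0 B) (i, j) (i', j') = - ((i == i')%:R * B j j').
    by rewrite /iso_mx block_mxKul block_mxKdr /= [X in X * _ - _]mxE mul0r sub0r.
  by rewrite rmorphN rmorphM rmorph_nat /iso_mx /=; ring.
transitivity (\sum_(i : 'I_p) \sum_(j : 'I_q) \sum_j' drsubmx F j j' * Num.conj (B j j')
   - \sum_(i : 'I_p) \sum_(j : 'I_q) ulsubmx F i i * Num.conj (B j j)).
  rewrite -sumrB; apply: eq_bigr => i _; rewrite -sumrB; apply: eq_bigr => j _.
  rewrite -(sum_delta j (fun j' => ulsubmx F i i * Num.conj (B j j'))) -sumrB.
  by apply: eq_bigr => j' _; ring.
have -> : \sum_(i : 'I_p) \sum_(j : 'I_q) ulsubmx F i i * Num.conj (B j j) = 0.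
  under eq_bigr => i _ do rewrite -mulr_sumr.
  by rewrite -mulr_suml -rmorph_sum /= -/(mxtrace B) B0 rmorph0 mulr0.
by rewrite subr0 sumr_const card_ord -[LHS]mulr_natl.
Qed.
End Projection.

Section OrthogonalProjection.
Context {R : realType} {p q : nat}.
Local Notation Re := complex.Re.
Local Notation Im := complex.Im.
Local Notation C := (R[i]).
Local Notation n := (p + q)%N.
Local Notation M := 'M[C]_n.
Local Notation form2 := (@form R p q 2).

(** Inner products see forms only through their values on the frame, and there
    the forms at stake come from elements of [u(n)]. *)
Definition on_frame (a : form2) (F : M) := forall s t : mbasis_index p q,
  a (vec2 (mbasis s) (mbasis t)) = - (2 * n%:R) * Re (\tr (F *m bracket (mbasis s) (mbasis t))).

Lemma on_frame_endo (F : M) : on_frame (endo_form (bracket F)) F.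
Proof. by move=> s t; rewrite endo_form_bracket. Qed.

Lemma on_frameB (a b : form2) (F G : M) : on_frame a F -> on_frame b G ->
  on_frame (fun v => a v - b v) (F - G).
Proof.
move=> aF bG s t; rewrite aF bG; set X := bracket _ _.
have -> : \tr ((F - G) *m X) = \tr (F *m X) - \tr (G *m X).
  by rewrite mulmxBl raddfB.
by case: (\tr (F *m X)) (\tr (G *m X)) => [x y] [x' y'] /=; rewrite mulrBr.
Qed.

Definition tracefree k (T : 'M[C]_k) : 'M[C]_k := T - (\tr T / k%:R)%:M.

Lemma skewB k (A B : 'M[C]_k) : skew A -> skew B -> skew (A - B).
Proof.
move=> As Bs; rewrite /skew linearB /= map_mxB As Bs opprB opprK addrC.
by [].
Qed.

Lemma skew_block_p (B : 'M[C]_p) : skew B -> skew (block_mx B 0 0 0 : M).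
Proof.
move=> Bs; rewrite /skew tr_block_mx map_block_mx opp_block_mx Bs.
by rewrite !trmx0 !map_mx0 !oppr0.
Qed.

Lemma skew_block_q (B : 'M[C]_q) : skew B -> skew (block_mx 0 0 0 B : M).
Proof.
move=> Bs; rewrite /skew tr_block_mx map_block_mx opp_block_mx Bs.
by rewrite !trmx0 !map_mx0 !oppr0.
Qed.

Lemma tracefree_tr k (T : 'M[C]_k) : (0 < k)%N -> \tr (tracefree T) = 0.
Proof.
move=> k0; rewrite /tracefree raddfB /= mxtrace_scalar -[X in _ - X]mulr_natr.
by rewrite divfK ?subrr // pnatr_eq0 -lt0n.
Qed.

Lemma skew_tracefree k (T : 'M[C]_k) : skew T -> skew (tracefree T).
Proof.
move=> Ts; apply: skewB => //; have trT : Num.conj (\tr T) = - \tr T.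
  by rewrite -tr_ctrmx Ts raddfN.
apply/matrixP => i j; rewrite !mxE rmorphMn rmorphM fmorphV rmorph_nat /= trT.
by rewrite mulNr mulNrn eq_sym.
Qed.

Lemma su_tracefree k (T : 'M[C]_k) : (0 < k)%N -> skew T -> su (tracefree T).
Proof. by move=> k0 Ts; split; [exact: skew_tracefree | exact: tracefree_tr]. Qed.

Lemma sum_tracefree k (T B : 'M[C]_k) : \tr B = 0 ->
  \sum_i \sum_j (T - tracefree T) j i * Num.conj (B j i) = 0.
Proof.
move=> B0; rewrite /tracefree opprB addrCA subrr addr0.
transitivity (\sum_i (\tr T / k%:R) * Num.conj (B i i)).
  apply: eq_bigr => i _; rewrite -(sum_delta i (fun j => (\tr T / k%:R) * Num.conj (B j i))).
  by apply: eq_bigr => j _; rewrite mxE mulrA mulr_natl eq_sym.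
by rewrite -mulr_sumr -rmorph_sum /= -/(mxtrace B) B0 rmorph0 mulr0.
Qed.

Lemma Re_sum_sqr_eq0 k (D : 'M[C]_k) :
  Re (\sum_i \sum_j D j i * Num.conj (D j i)) = 0 -> D = 0.
Proof.
have sqr (z : C) : Re (z * Num.conj z) = Re z ^+ 2 + Im z ^+ 2.
  by case: z => x y /=; ring.
have pos (z : C) : 0 <= Re (z * Num.conj z).
  by rewrite sqr addr_ge0 ?sqr_ge0.
rewrite raddf_sum => /eqP; rewrite psumr_eq0 => [/allP H|i _]; last first.
  by rewrite raddf_sum; apply: sumr_ge0 => j _; exact: pos.
apply/matrixP => j i; rewrite mxE.
have := H i (mem_index_enum _); rewrite raddf_sum psumr_eq0 => [/allP H'|k' _]; last exact: pos.
have := H' j (mem_index_enum _); rewrite /= sqr paddr_eq0 ?sqr_ge0 //.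
by rewrite !sqrf_eq0; case: (D j i) => x y /= /andP [/eqP -> /eqP ->].
Qed.

Lemma form_ip_Ep (a : form2) (F : M) (B : 'M[C]_p) : skew F -> on_frame a F -> su B ->
  form_ip a (endo_form (bracket (block_mx B 0 0 0)))
  = q%:R * Re (\sum_i \sum_j ulsubmx F j i * Num.conj (B j i)).
Proof.
move=> Fs aF [Bs B0].
rewrite (form_ip_iso Fs (skew_block_p Bs) aF (on_frame_endo _)) sum_iso_p //.
by rewrite -(rmorph_nat (real_complex R)); move: (\sum_i _) => -[x y] /=; rewrite mul0r subr0.
Qed.

Lemma form_ip_Em (a : form2) (F : M) (B : 'M[C]_q) : skew F -> on_frame a F -> su B ->
  form_ip a (endo_form (bracket (block_mx 0 0 0 B)))
  = p%:R * Re (\sum_i \sum_j drsubmx F j i * Num.conj (B j i)).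
Proof.
move=> Fs aF [Bs B0].
rewrite (form_ip_iso Fs (skew_block_q Bs) aF (on_frame_endo _)) sum_iso_q // exchange_big /=.
by rewrite -(rmorph_nat (real_complex R)); move: (\sum_i _) => -[x y] /=; rewrite mul0r subr0.
Qed.

(** Pairing with [su(p)] only sees the upper block of [F] up to scalars, which
    identifies the projection; it is unique because the difference of two
    candidates would be orthogonal to itself. *)
Lemma ortho_proj_Ep (a : form2) (F : M) : (0 < p)%N -> (0 < q)%N ->
    skew F -> on_frame a F ->
  ortho_proj fiber_Ep a = endo_form (bracket (block_mx (tracefree (ulsubmx F)) 0 0 0)).
Proof.
move=> p0 q0 Fs aF.
have ulFs : skew (ulsubmx F).
  by rewrite /skew trmx_ulsub map_ulsubmx Fs; apply/matrixP => i j; rewrite !mxE.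
have suF := su_tracefree p0 ulFs.
have orth (B D : 'M[C]_p) : su B -> su D ->
    form_ip (fun v => a v - endo_form (bracket (block_mx B 0 0 0)) v)
      (endo_form (bracket (block_mx D 0 0 0)))
    = q%:R * Re (\sum_i \sum_j (ulsubmx F - B) j i * Num.conj (D j i)).
  move=> suB suD.
  rewrite (form_ip_Ep (skewB Fs (skew_block_p suB.1)) (on_frameB aF (on_frame_endo _)) suD).
  congr (_ * Re _); apply: eq_bigr => i _; apply: eq_bigr => j _.
  by rewrite -[F in LHS]submxK opp_block_mx add_block_mx block_mxKul.
apply: xget_unique.
  split; first by exists (tracefree (ulsubmx F)).
  by move=> _ [D suD <-]; rewrite orth // sum_tracefree ?mulr0 //; case: suD.
move=> b [[B suB <-] Borth]; suff -> : B = tracefree (ulsubmx F) by [].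
set T := tracefree _ in suF *; have suD : su (T - B).
  split; first exact: skewB suF.1 suB.1.
  by rewrite raddfB /= suF.2 suB.2 subrr.
apply/esym/eqP; rewrite -subr_eq0; apply/eqP/Re_sum_sqr_eq0.
have qn0 : q%:R != 0 :> R by rewrite pnatr_eq0 -lt0n.
have := Borth _ (ex_intro2 _ _ _ suD erefl); rewrite orth // => /eqP.
rewrite mulf_eq0 (negPf qn0) /= => /eqP E.
have := sum_tracefree (ulsubmx F) suD.2; rewrite -/T => E'.
transitivity (Re (\sum_i \sum_j (ulsubmx F - B) j i * Num.conj ((T - B) j i)
  - \sum_i \sum_j (ulsubmx F - T) j i * Num.conj ((T - B) j i))); last first.
  by rewrite E' subr0.
congr Re; rewrite -sumrB; apply: eq_bigr => i _; rewrite -sumrB.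
by apply: eq_bigr => j _; rewrite !mxE; ring.
Qed.

Lemma ortho_proj_Em (a : form2) (F : M) : (0 < p)%N -> (0 < q)%N ->
    skew F -> on_frame a F ->
  ortho_proj fiber_Em a = endo_form (bracket (block_mx 0 0 0 (tracefree (drsubmx F)))).
Proof.
move=> p0 q0 Fs aF.
have drFs : skew (drsubmx F).
  by rewrite /skew trmx_drsub map_drsubmx Fs; apply/matrixP => i j; rewrite !mxE.
have suF := su_tracefree q0 drFs.
have orth (B D : 'M[C]_q) : su B -> su D ->
    form_ip (fun v => a v - endo_form (bracket (block_mx 0 0 0 B)) v)
      (endo_form (bracket (block_mx 0 0 0 D)))
    = p%:R * Re (\sum_i \sum_j (drsubmx F - B) j i * Num.conj (D j i)).
  move=> suB suD.
  rewrite (form_ip_Em (skewB Fs (skew_block_q suB.1)) (on_frameB aF (on_frame_endo _)) suD).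
  congr (_ * Re _); apply: eq_bigr => i _; apply: eq_bigr => j _.
  by rewrite -[F in LHS]submxK opp_block_mx add_block_mx block_mxKdr.
apply: xget_unique.
  split; first by exists (tracefree (drsubmx F)).
  by move=> _ [D suD <-]; rewrite orth // sum_tracefree ?mulr0 //; case: suD.
move=> b [[B suB <-] Borth]; suff -> : B = tracefree (drsubmx F) by [].
set T := tracefree _ in suF *; have suD : su (T - B).
  split; first exact: skewB suF.1 suB.1.
  by rewrite raddfB /= suF.2 suB.2 subrr.
apply/esym/eqP; rewrite -subr_eq0; apply/eqP/Re_sum_sqr_eq0.
have pn0 : p%:R != 0 :> R by rewrite pnatr_eq0 -lt0n.
have := Borth _ (ex_intro2 _ _ _ suD erefl); rewrite orth // => /eqP.
rewrite mulf_eq0 (negPf pn0) /= => /eqP E.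
have := sum_tracefree (drsubmx F) suD.2; rewrite -/T => E'.
transitivity (Re (\sum_i \sum_j (drsubmx F - B) j i * Num.conj ((T - B) j i)
  - \sum_i \sum_j (drsubmx F - T) j i * Num.conj ((T - B) j i))); last first.
  by rewrite E' subr0.
congr Re; rewrite -sumrB; apply: eq_bigr => i _; rewrite -sumrB.
by apply: eq_bigr => j _; rewrite !mxE; ring.
Qed.
End OrthogonalProjection.

(** * The deformation of a Killing field *)

Lemma tr_mul_diag (K : pzRingType) p q (a : 'M[K]_p) (d : 'M[K]_q) (T : 'M[K]_(p + q)) :
  \tr (block_mx a 0 0 d *m T) = \tr (a *m ulsubmx T) + \tr (d *m drsubmx T).
Proof.
rewrite -{1}[T]submxK mulmx_block mxtrace_block !mul0mx addr0 add0r.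
by [].
Qed.

Lemma ulsubmxZ (K : pzRingType) p q (a : K) (T : 'M[K]_(p + q)) :
  ulsubmx (a *: T) = a *: ulsubmx T.
Proof. by apply/matrixP => i j; rewrite !mxE. Qed.

Lemma drsubmxZ (K : pzRingType) p q (a : K) (T : 'M[K]_(p + q)) :
  drsubmx (a *: T) = a *: drsubmx T.
Proof. by apply/matrixP => i j; rewrite !mxE. Qed.

Section Deformation.
Context {R : realType} {p q : nat}.
Local Notation Re := complex.Re.
Local Notation C := (R[i]).
Local Notation n := (p + q)%N.
Local Notation M := 'M[C]_n.

(** [alpha] and [beta] are the coefficients of the two projections in [e_X]. *)
Definition alpha : R := (q%:R ^+ 2 - 1) / q%:R.
Definition beta : R := (p%:R ^+ 2 - 1) / p%:R.

(** The endomorphism of [u(n)] that sends [g^* A g] to the element of the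
    isotropy algebra acting as [e_X] at [g]; the factor [2] is the one in
    [ext_d_flat]. *)
Definition twist (T : M) : M :=
  block_mx ((2 * alpha)%:C%C *: tracefree (ulsubmx T)) 0 0
    ((- (2 * beta))%:C%C *: tracefree (drsubmx T)).

Lemma tr_tracefree k (S T : 'M[C]_k) :
  \tr (tracefree S *m T) = \tr (S *m tracefree T).
Proof.
rewrite /tracefree mulmxBl mulmxBr !raddfB /= mul_scalar_mx mul_mx_scalar !mxtraceZ.
by congr (_ - _); rewrite mulrAC [RHS]mulrAC; congr (_ / _); rewrite mulrC.
Qed.

Lemma tr_twist (S T : M) : \tr (twist S *m T) = \tr (S *m twist T).
Proof.
have -> : \tr (S *m twist T) = \tr (twist T *m S) by rewrite mxtrace_mulC.
rewrite /twist (tr_mul_diag _ _ T) (tr_mul_diag _ _ S).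
have trZl k (a : C) (P Q : 'M[C]_k) : \tr (a *: P *m Q) = a * \tr (P *m Q).
  by rewrite -scalemxAl mxtraceZ.
have trZ k (a : C) (P Q : 'M[C]_k) : \tr (a *: tracefree P *m Q) = \tr (a *: tracefree Q *m P).
  by rewrite trZl trZl tr_tracefree mxtrace_mulC.
exact: congr2 (trZ _ _ _ _) (trZ _ _ _ _).
Qed.

Lemma tracefreeZ k (a : C) (T : 'M[C]_k) : tracefree (a *: T) = a *: tracefree T.
Proof. by rewrite /tracefree scalerBr mxtraceZ scale_scalar_mx mulrA. Qed.

Lemma twistN (T : M) : twist (- T) = - twist T.
Proof.
rewrite -[- T]scaleN1r /twist ulsubmxZ drsubmxZ 2!tracefreeZ 2!scaleN1r 2!scalerN.
by rewrite opp_block_mx 2!oppr0.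
Qed.

Lemma endo_form_block (F1 : 'M[C]_p) (F2 : 'M[C]_q) (a b : R) (v : 'I_2 -> M) :
  a * endo_form (bracket (block_mx F1 0 0 0)) v - b * endo_form (bracket (block_mx 0 0 0 F2)) v
  = endo_form (bracket (block_mx (a%:C%C *: F1) 0 0 ((- b)%:C%C *: F2))) v.
Proof.
set W := bracket (v ord0) (v ord_max).
have E G : endo_form (bracket G) v = - (2 * n%:R) * Re (\tr (G *m W)).
  exact: endo_form_bracket.
have E1 : \tr (block_mx F1 0 0 0 *m W) = \tr (F1 *m ulsubmx W).
  by rewrite tr_mul_diag mul0mx mxtrace0 addr0.
have E2 : \tr (block_mx 0 0 0 F2 *m W) = \tr (F2 *m drsubmx W).
  by rewrite tr_mul_diag mul0mx mxtrace0 add0r.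
have E3 : \tr (block_mx (a%:C%C *: F1) 0 0 ((- b)%:C%C *: F2) *m W)
    = a%:C%C * \tr (F1 *m ulsubmx W) + (- b)%:C%C * \tr (F2 *m drsubmx W).
  rewrite tr_mul_diag; congr (_ + _); first by rewrite -scalemxAl mxtraceZ.
  by rewrite -scalemxAl mxtraceZ.
transitivity (a * (- (2 * n%:R) * Re (\tr (F1 *m ulsubmx W)))
   - b * (- (2 * n%:R) * Re (\tr (F2 *m drsubmx W)))).
  congr (_ * _ - _ * _).
  - by apply: etrans (E _) _; rewrite E1.
  - by apply: etrans (E _) _; rewrite E2.
apply/esym; apply: etrans (E _) _; rewrite E3.
by case: (\tr (F1 *m _)) (\tr (F2 *m _)) => [x y] [x' y'] /=; ring.
Qed.

Lemma e_field_killing (A g : M) : (0 < p)%N -> (0 < q)%N -> skew A ->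
  e_field (killing_of A) g = endo_form (bracket (twist (g^t* *m A *m g))).
Proof.
move=> p0 q0 As; apply/funext => v.
have Ss := skew_conj g As; set S := g^t* *m A *m g in Ss *.
have S2s : skew (2%:R%:C%C *: S).
  rewrite /skew linearZ map_mxZ /= Ss scalerN; congr (- (_ *: _)).
  exact: conjc_real.
have dX : on_frame (ext_d (flat (killing_of A)) g) (2%:R%:C%C *: S).
  move=> s t; rewrite ext_d_flat; try exact: mbasis_mspace.
  rewrite /coef -scalemxAl mxtraceZ mxtrace_mulC -/S.
  by case: (\tr _) => x y /=; ring.
rewrite /e_field (ortho_proj_Ep p0 q0 S2s dX) (ortho_proj_Em p0 q0 S2s dX).
rewrite ulsubmxZ drsubmxZ 2!tracefreeZ endo_form_block 2!scalerA -2!rmorphM /twist.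
by rewrite -/alpha -/beta mulNr ![_ * 2]mulrC.
Qed.

(** As [twist] is self-adjoint, it can be moved to the constant factor; this
    exhibits [e_X] as a matrix coefficient, which is differentiated by
    [lderive_coef]. *)
Lemma e_field_coef (A : M) (w : 'I_2 -> M) : (0 < p)%N -> (0 < q)%N -> skew A ->
  (fun g => e_field (killing_of A) g w)
  = coef A ((- (2 * n%:R))%:C%C *: twist (bracket (w ord0) (w ord_max))).
Proof.
move=> p0 q0 As; apply/funext => g.
rewrite e_field_killing // endo_form_bracket coefZ /coef tr_twist.
by rewrite mxtrace_mulC.
Qed.

(** The derivative of [e_X (y, z)] along [x]. *)
Definition torsion (A g x y z : M) : R :=
  - (2 * n%:R) * coef A (bracket x (twist (bracket y z))) g.

(** The three derivatives are the cyclic ones because [torsion] is skew in its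
    last two arguments. *)
Lemma ext_d_e_field (A g x y z : M) : (0 < p)%N -> (0 < q)%N -> skew A ->
    su x -> su y -> su z ->
  ext_d (e_field (killing_of A)) g (vec3 x y z)
  = torsion A g x y z + torsion A g y z x + torsion A g z x y.
Proof.
move=> p0 q0 As sx sy sz.
have D (w : 'I_2 -> M) (v : M) : su v ->
    lderive (fun h => e_field (killing_of A) h w) g v
    = torsion A g v (w ord0) (w ord_max).
  move=> sv; rewrite e_field_coef // /torsion -coefZ -bracketZr.
  exact: (congr1 (fun f => f g) (lderive_coef A _ sv)).
have torsionC (a b c : M) : torsion A g a b c = - torsion A g a c b.
  rewrite /torsion [bracket b c]bracketC twistN.
  have -> : bracket a (- twist (bracket c b)) = - bracket a (twist (bracket c b)).
    by rewrite /bracket mulmxN mulNmx opprB opprK addrC.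
  by rewrite coefN mulrN.
have sw i : su (vec3 x y z i) by case: i => [[|[|[|//]]] lt].
rewrite /ext_d (eq_bigr (fun i : 'I_3 => (-1) ^+ i * torsion A g (vec3 x y z i)
    (vec3 x y z (lift i ord0)) (vec3 x y z (lift i ord_max)))); last first.
  by move=> i _; congr (_ * _); exact: D (sw i).
rewrite 3!big_ord_recl big_ord0.
have -> : torsion A g y z x = - torsion A g y x z by exact: torsionC.
move: (torsion A g) => t.
transitivity ((-1) ^+ 0 * t x y z + ((-1) ^+ 1 * t y x z + ((-1) ^+ 2 * t z x y + 0))).
  by [].
ring.
Qed.
End Deformation.

(** * The exterior derivative of the deformation *)

Lemma block_offdiag_diag_comm (K : pzRingType) p q (u : 'M[K]_(p, q)) (u' : 'M[K]_(q, p)) a d :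
  block_mx 0 u u' 0 *m block_mx a 0 0 d - block_mx a 0 0 d *m block_mx 0 u u' 0
  = block_mx 0 (u *m d - a *m u) (u' *m a - d *m u') 0.
Proof.
rewrite !mulmx_block !mul0mx !mulmx0 !addr0 !add0r.
by rewrite opp_block_mx add_block_mx !subr0.
Qed.

Lemma tr_mul_offdiag (K : pzRingType) p q (u : 'M[K]_(p, q)) (u' : 'M[K]_(q, p)) S1 S2 S3 S4 :
  \tr (block_mx 0 u u' 0 *m block_mx S1 S2 S3 S4) = \tr (u *m S3) + \tr (u' *m S2).
Proof. by rewrite mulmx_block mxtrace_block !mul0mx addr0 add0r. Qed.

Lemma tr_torsion (K : comPzRingType) p q (u1 u2 u3 : 'M[K]_(p, q)) (u2' u3' W : 'M[K]_(q, p))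
    (a b tp tq : K) :
  \tr ((u1 *m ((- b) *: (u3' *m u2 - u2' *m u3 - tq%:M))
       - (a *: (u3 *m u2' - u2 *m u3' - tp%:M)) *m u1) *m W)
  = b * (\tr (u1 *m u2' *m u3 *m W) - \tr (u1 *m u3' *m u2 *m W))
    + a * (\tr (u2 *m u3' *m u1 *m W) - \tr (u3 *m u2' *m u1 *m W))
    + (a * tp + b * tq) * \tr (u1 *m W).
Proof.
rewrite mulmxBl -scalemxAr -!scalemxAl !mulmxBr !mulmxBl mul_mx_scalar mul_scalar_mx.
rewrite -!scalemxAl !mulmxA !(raddfB, mxtraceZ) /= !mxtraceZ.
ring.
Qed.

Lemma tr_delta3 (K : comPzRingType) p q (W : 'M[K]_(q, p)) (a1 a2 a3 : K)
    (i1 i2 i3 : 'I_p) (j1 j2 j3 : 'I_q) :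
  \tr ((a1 *: delta_mx i1 j1) *m (a2 *: delta_mx j2 i2) *m (a3 *: delta_mx i3 j3) *m W)
  = a1 * a2 * a3 * ((j1 == j2)%:R * (i2 == i3)%:R * W j3 i1).
Proof.
rewrite -!(scalemxAl, scalemxAr) !mxtraceZ mul_delta_mx_cond.
case: eqP => _; last by rewrite mulr0n !mul0mx mxtrace0 !(mul0r, mulr0).
rewrite mulr1n mul_delta_mx_cond; case: eqP => _; last first.
  by rewrite mulr0n mul0mx mxtrace0 !(mul0r, mulr0).
by rewrite mulr1n tr_delta_mul !mulr1n; ring.
Qed.

Section Torsion.
Context {R : realType} {p q : nat}.
Local Notation Im := complex.Im.
Local Notation C := (R[i]).
Local Notation n := (p + q)%N.
Local Notation M := 'M[C]_n.
Local Notation alpha := (@alpha R q).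
Local Notation beta := (@beta R p).

(** The Killing fields of these rank-one elements of [u(n)] suffice. *)
Definition herm k (v : 'cV[C]_k) : 'M[C]_k := 'i%C *: (v *m v^t*).

Lemma skew_herm k (v : 'cV[C]_k) : skew (herm v).
Proof.
rewrite /skew /herm linearZ map_mxZ /= ctrmxM ctrmxK -scaleNr; congr (_ *: _).
by rewrite /=; congr (_ +i* _)%C; rewrite oppr0.
Qed.

(** Conjugation by [g] replaces [v] by [g^* v], so pointwise everything
    depends only on the two blocks of [g^* v]. *)
Lemma conj_herm k (v : 'cV[C]_k) (g : 'M[C]_k) :
  g^t* *m herm v *m g = herm (g^t* *m v).
Proof. by rewrite /herm -scalemxAr -scalemxAl ctrmxM ctrmxK !mulmxA. Qed.

Lemma herm_block (u : 'cV[C]_n) :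
  herm u = block_mx (herm (usubmx u)) ('i%C *: (usubmx u *m (dsubmx u)^t*))
    ('i%C *: (dsubmx u *m (usubmx u)^t*)) (herm (dsubmx u)).
Proof.
rewrite /herm -{1 2}[u]vsubmxK tr_col_mx map_row_mx mul_col_row scale_block_mx.
by [].
Qed.

Lemma skewZ k (r : R) (A : 'M[C]_k) : skew A -> skew (r%:C%C *: A).
Proof.
move=> As; rewrite /skew linearZ map_mxZ /= As scalerN; congr (- (_ *: _)).
exact: conjc_real.
Qed.

(** The scalar left over by the two trace corrections in [twist]. *)
Definition kappa : R := alpha / p%:R - beta / q%:R.

(** Only the off-diagonal block [W] of [herm (g^* v)] contributes, as the
    bracket of [m] with the isotropy algebra lies in [m]. The two off-diagonal
    blocks give conjugate contributions, whence the imaginary part. *)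
Lemma torsion_offm (v : 'cV[C]_n) (g : M) (u1 u2 u3 : 'M[C]_(p, q)) :
  let W := dsubmx (g^t* *m v) *m (usubmx (g^t* *m v))^t* in
  torsion (herm v) g (offm u1) (offm u2) (offm u3)
  = 8 * n%:R * Im (beta%:C%C * (\tr (u1 *m u2^t* *m u3 *m W) - \tr (u1 *m u3^t* *m u2 *m W))
      + alpha%:C%C * (\tr (u2 *m u3^t* *m u1 *m W) - \tr (u3 *m u2^t* *m u1 *m W))
      + kappa%:C%C * (\tr (u3 *m u2^t*) - \tr (u2 *m u3^t*)) * \tr (u1 *m W)).
Proof.
move=> W0; rewrite {}/W0 /torsion /coef conj_herm; set u := g^t* *m v; set W := dsubmx u *m (usubmx u)^t*.
rewrite bracket_offm /twist block_mxKul block_mxKdr.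
set T1 := _ *: tracefree _; set T2 := _ *: tracefree _.
have T1s : skew T1.
  apply/skewZ/skew_tracefree; rewrite /skew linearB /= map_mxB !ctrmxM !ctrmxK.
  by rewrite opprB.
have T2s : skew T2.
  apply/skewZ/skew_tracefree; rewrite /skew linearB /= map_mxB !ctrmxM !ctrmxK.
  by rewrite opprB.
rewrite /bracket /offm block_offdiag_diag_comm herm_block tr_mul_offdiag.
set P := u1 *m T2 - T1 *m u1.
have -> : - u1^t* *m T1 - T2 *m - u1^t* = - P^t*.
  rewrite /P linearB /= map_mxB !ctrmxM T1s T2s mulmxN mulmxN !mulNmx !opprK.
  by rewrite opprD opprK addrC.
have -> : \tr (P *m ('i%C *: (dsubmx u *m (usubmx u)^t*))) = 'i%C * \tr (P *m W).
  by rewrite -scalemxAr mxtraceZ.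
have -> : \tr (- P^t* *m ('i%C *: (usubmx u *m (dsubmx u)^t*)))
    = - ('i%C * Num.conj (\tr (P *m W))).
  have -> : usubmx u *m (dsubmx u)^t* = W^t* by rewrite ctrmxM ctrmxK.
  by rewrite mulNmx raddfN /= -scalemxAr mxtraceZ -ctrmxM tr_ctrmx mxtrace_mulC.
have -> : \tr (P *m W) = 2 * (beta%:C%C * (\tr (u1 *m u2^t* *m u3 *m W) - \tr (u1 *m u3^t* *m u2 *m W))
      + alpha%:C%C * (\tr (u2 *m u3^t* *m u1 *m W) - \tr (u3 *m u2^t* *m u1 *m W))
      + kappa%:C%C * (\tr (u3 *m u2^t*) - \tr (u2 *m u3^t*)) * \tr (u1 *m W)).
  have t23 : \tr (u3^t* *m u2 - u2^t* *m u3) = - (\tr (u3 *m u2^t*) - \tr (u2 *m u3^t*)).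
    rewrite raddfB /= opprB; congr (_ - _); exact: mxtrace_mulC.
  have t32 : \tr (u3 *m u2^t* - u2 *m u3^t*) = \tr (u3 *m u2^t*) - \tr (u2 *m u3^t*).
    by rewrite raddfB.
  rewrite /P /T1 /T2 /tracefree t23 t32 rmorphN tr_torsion /kappa rmorphB !rmorphM !fmorphV.
  rewrite !rmorph_nat /=; move: (\tr (u3 *m _) - _).
  move: (\tr (u1 *m u2^t* *m u3 *m W)) (\tr (u1 *m u3^t* *m u2 *m W)).
  move: (\tr (u2 *m u3^t* *m u1 *m W)) (\tr (u3 *m u2^t* *m u1 *m W)).
  move: (\tr (u1 *m W)) alpha%:C%C beta%:C%C (p%:R : C)^-1 (q%:R : C)^-1.
  by move=> x1 x2 x3 x4 x5 x6 x7 x8 x9 x10; ring.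
move: (_ + _ * \tr (u1 *m W)) => c.
by case: c => x y /=; ring.
Qed.
End Torsion.

Section TorsionFrame.
Context {R : realType} {p q : nat}.
Local Notation Im := complex.Im.
Local Notation C := (R[i]).
Local Notation n := (p + q)%N.
Local Notation M := 'M[C]_n.
Local Notation alpha := (@alpha R q).
Local Notation beta := (@beta R p).
Local Notation scale := (@mbasis_scale R p q).
Local Notation phase := (@phase R).
Local Notation kappa := (@kappa R p q).
Local Notation cpair := ('I_p * 'I_q)%type.

(** The components of [(u, v, w) |-> tr (u v^* w W)] on matrix units, where
    [W = z x^*]. *)
Definition quad (x : 'I_p -> C) (z : 'I_q -> C) (s t r : cpair) : C :=
  (s.2 == t.2)%:R * (t.1 == r.1)%:R * (z r.2 * Num.conj (x s.1)).

(** The component of type (2,1) of [d e_X], up to a constant: linear in the first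
    and last arguments, antilinear in the middle one. *)
Definition dtens (x : 'I_p -> C) (z : 'I_q -> C) (s t r : cpair) : C :=
  (alpha + beta)%:C%C * (quad x z s t r - quad x z r t s)
  + kappa%:C%C * ((r == t)%:R * (z s.2 * Num.conj (x s.1))
                  - (s == t)%:R * (z r.2 * Num.conj (x r.1))).

(** A real three-form whose component of type (2,1) is a multiple of [K]. *)
Definition cyc3 (K : cpair -> cpair -> cpair -> C) (s t r : mbasis_index p q) : R :=
  Im (phase s.1.1 * Num.conj (phase t.1.1) * phase r.1.1 * K (cidx s) (cidx t) (cidx r)
    + phase t.1.1 * Num.conj (phase r.1.1) * phase s.1.1 * K (cidx t) (cidx r) (cidx s)
    + phase r.1.1 * Num.conj (phase s.1.1) * phase t.1.1 * K (cidx r) (cidx s) (cidx t)).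

Lemma tr_delta_pair (K : comPzRingType) (a a' : K) (i i' : 'I_p) (j j' : 'I_q) :
  \tr ((a *: delta_mx i j) *m (a' *: delta_mx j' i'))
  = a * a' * ((i == i')%:R * (j == j')%:R).
Proof. by rewrite -[_ *: delta_mx i j]mulmx1 tr_delta2_mul mxE. Qed.

Lemma ctrmx_delta (a : C) (i : 'I_p) (j : 'I_q) :
  (a *: delta_mx i j)^t* = Num.conj a *: delta_mx j i.
Proof. by apply/matrixP => k l; rewrite !mxE rmorphM rmorph_nat andbC. Qed.

Lemma torsion_frame (v : 'cV[C]_n) (g : M) (s t r : mbasis_index p q) :
  let x i := usubmx (g^t* *m v) i 0 in let z j := dsubmx (g^t* *m v) j 0 in
  let Q := quad x z in
  let d (s t : cpair) : C := (s == t)%:R in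
  torsion (herm v) g (mbasis s) (mbasis t) (mbasis r) = 2 * scale * Im (
    beta%:C%C * (phase s.1.1 * Num.conj (phase t.1.1) * phase r.1.1 * Q (cidx s) (cidx t) (cidx r)
               - phase s.1.1 * Num.conj (phase r.1.1) * phase t.1.1 * Q (cidx s) (cidx r) (cidx t))
  + alpha%:C%C * (phase t.1.1 * Num.conj (phase r.1.1) * phase s.1.1 * Q (cidx t) (cidx r) (cidx s)
               - phase r.1.1 * Num.conj (phase t.1.1) * phase s.1.1 * Q (cidx r) (cidx t) (cidx s))
  + kappa%:C%C * (phase r.1.1 * Num.conj (phase t.1.1) * d (cidx r) (cidx t)
               - phase t.1.1 * Num.conj (phase r.1.1) * d (cidx t) (cidx r))
      * (phase s.1.1 * (z (cidx s).2 * Num.conj (x (cidx s).1)))).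
Proof.
case: s t r => [[b1 i1] j1] [[b2 i2] j2] [[b3 i3] j3] x z Q d.
rewrite !mbasisE torsion_offm /cidx /=; set u := g^t* *m v; set W := dsubmx u *m _.
have WE j i : W j i = z j * Num.conj (x i).
  by rewrite /W mxE big_ord1; congr (_ * _); rewrite [LHS]mxE [in LHS]mxE.
have n0 : (0 < n)%N by rewrite addn_gt0 (leq_ltn_trans _ (ltn_ord i1)).
pose c3 (e e' e'' : C) : C := (scale%:C%C * e) * (scale%:C%C * Num.conj e') * (scale%:C%C * e'').
pose c2 (e e' : C) : C := (scale%:C%C * e) * (scale%:C%C * Num.conj e').
have cJ (e : C) : Num.conj (scale%:C%C * e) = scale%:C%C * Num.conj e.
  by rewrite rmorphM; congr (_ * _); exact: conjc_real.
have tr3 (e e' e'' : C) (i i' i'' : 'I_p) (j j' j'' : 'I_q) :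
    \tr ((scale%:C%C * e) *: delta_mx i j *m (Num.conj (scale%:C%C * e') *: delta_mx j' i')
      *m ((scale%:C%C * e'') *: delta_mx i'' j'') *m W)
    = c3 e e' e'' * ((j == j')%:R * (i' == i'')%:R * (z j'' * Num.conj (x i))).
  by rewrite cJ tr_delta3 WE.
have tr2 (e e' : C) (i i' : 'I_p) (j j' : 'I_q) :
    \tr ((scale%:C%C * e) *: delta_mx i j *m (Num.conj (scale%:C%C * e') *: delta_mx j' i'))
    = c2 e e' * ((i == i')%:R * (j == j')%:R).
  by rewrite cJ tr_delta_pair.
have tr1 (e : C) (i : 'I_p) (j : 'I_q) :
    \tr ((scale%:C%C * e) *: delta_mx i j *m W) = scale%:C%C * e * (z j * Num.conj (x i)).
  by rewrite -scalemxAl mxtraceZ tr_delta_mul WE.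
have sc3 (c : C) : 8 * n%:R * Im (scale%:C%C * scale%:C%C * scale%:C%C * c) = 2 * scale * Im c.
  transitivity (2 * scale * (4 * n%:R * (scale * scale)) * Im c); last first.
    by rewrite scale_sqr // mulr1.
  by case: c => a b; simpc => /=; ring.
rewrite -sc3; congr (_ * Im _); rewrite !ctrmx_delta.
transitivity (beta%:C%C * (
      c3 (phase b1) (phase b2) (phase b3) * ((j1 == j2)%:R * (i2 == i3)%:R * (z j3 * Num.conj (x i1)))
    - c3 (phase b1) (phase b3) (phase b2) * ((j1 == j3)%:R * (i3 == i2)%:R * (z j2 * Num.conj (x i1))))
  + alpha%:C%C * (
      c3 (phase b2) (phase b3) (phase b1) * ((j2 == j3)%:R * (i3 == i1)%:R * (z j1 * Num.conj (x i2)))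
    - c3 (phase b3) (phase b2) (phase b1) * ((j3 == j2)%:R * (i2 == i1)%:R * (z j1 * Num.conj (x i3))))
  + kappa%:C%C * (c2 (phase b3) (phase b2) * ((i3 == i2)%:R * (j3 == j2)%:R)
    - c2 (phase b2) (phase b3) * ((i2 == i3)%:R * (j2 == j3)%:R))
    * (scale%:C%C * phase b1 * (z j1 * Num.conj (x i1)))).
  by congr (_ * (_ - _) + _ * (_ - _) + _ * (_ - _) * _);
    [exact: tr3 | exact: tr3 | exact: tr3 | exact: tr3 | exact: tr2 | exact: tr2 | exact: tr1].
rewrite /Q /quad /d /c3 /c2 /= !xpair_eqE -!mulnb !natrM.
move: beta%:C%C alpha%:C%C kappa%:C%C scale%:C%C => k1 k2 k3 k4.
move: (phase b1) (phase b2) (phase b3) => e1 e2 e3.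
move: (Num.conj e1) (Num.conj e2) (Num.conj e3) => f1 f2 f3.
move: (z j1) (z j2) (z j3) (Num.conj (x i1)) (Num.conj (x i2)) (Num.conj (x i3)).
move=> z1 z2 z3 x1 x2 x3.
move: ((i3 == i2)%:R : C) ((i2 == i3)%:R : C) ((j3 == j2)%:R : C) ((j2 == j3)%:R : C).
move: ((j1 == j2)%:R : C) ((j1 == j3)%:R : C) ((i3 == i1)%:R : C) ((i2 == i1)%:R : C).
move=> d1 d2 d3 d4 d5 d6 d7 d8; ring.
Qed.

Lemma ext_d_frame (v : 'cV[C]_n) (g : M) (s t r : mbasis_index p q) :
    (0 < p)%N -> (0 < q)%N ->
  let x i := usubmx (g^t* *m v) i 0 in let z j := dsubmx (g^t* *m v) j 0 in
  ext_d (e_field (killing_of (herm v))) g (vec3 (mbasis s) (mbasis t) (mbasis r))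
  = 2 * scale * cyc3 (dtens x z) s t r.
Proof.
move=> p0 q0 x z.
have su_mbasis a : su (mbasis a : M) by have [] := @mbasis_mspace R p q a.
rewrite ext_d_e_field //; last exact: skew_herm.
rewrite !(torsion_frame v g) -2!mulrDr -2!raddfD /cyc3; congr (_ * Im _).
rewrite -/x -/z /dtens.
move: (phase s.1.1) (phase t.1.1) (phase r.1.1) => e1 e2 e3.
move: (Num.conj e1) (Num.conj e2) (Num.conj e3) => f1 f2 f3.
have -> : (alpha + beta)%:C%C = alpha%:C%C + beta%:C%C by rewrite rmorphD.
rewrite [cidx r == cidx t]eq_sym [cidx t == cidx s]eq_sym [cidx s == cidx r]eq_sym.
move: (cidx s) (cidx t) (cidx r) => a1 a2 a3.
move: kappa%:C%C alpha%:C%C beta%:C%C (quad x z) => k1 k2 k3 Q.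
move: ((a1 == a2)%:R : C) ((a2 == a3)%:R : C) ((a3 == a1)%:R : C) => d1 d2 d3.
move: (Q a1 a2 a3) (Q a1 a3 a2) (Q a2 a1 a3) (Q a2 a3 a1) (Q a3 a1 a2) (Q a3 a2 a1).
rewrite -/(x a1.1) -/(x a2.1) -/(x a3.1) -/(z a1.2) -/(z a2.2) -/(z a3.2).
move: (z a1.2 * _) (z a2.2 * _) (z a3.2 * _) => b1 b2 b3 Q1 Q2 Q3 Q4 Q5 Q6.
ring.
Qed.
End TorsionFrame.

(** * Forms on the frame in complex notation *)

Section EFrame.
Context {R : realType} {p q : nat}.
Local Notation Re := complex.Re.
Local Notation C := (R[i]).
Local Notation n := (p + q)%N.
Local Notation M := 'M[C]_n.
Local Notation alpha := (@alpha R q).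
Local Notation beta := (@beta R p).
Local Notation scale := (@mbasis_scale R p q).
Local Notation phase := (@phase R).
Local Notation cpair := ('I_p * 'I_q)%type.

(** A sesquilinear form [H] on [m] with its complex structure, as a real
    bilinear form on the frame. *)
Definition sesq (H : cpair -> cpair -> C) (s t : mbasis_index p q) : R :=
  Re (phase s.1.1 * Num.conj (phase t.1.1) * H (cidx s) (cidx t)).

Definition nrm2 k (x : 'I_k -> C) : C := \sum_i x i * Num.conj (x i).

(** [e_X = i h] for this hermitian form [h]. *)
Definition htens (x : 'I_p -> C) (z : 'I_q -> C) (s t : cpair) : C :=
  (2 * alpha)%:C%C * (x t.1 * Num.conj (x s.1) - (s.1 == t.1)%:R * (nrm2 x / p%:R))
    * (s.2 == t.2)%:R
  + (2 * beta)%:C%C * (s.1 == t.1)%:R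
    * (z s.2 * Num.conj (z t.2) - (s.2 == t.2)%:R * (nrm2 z / q%:R)).

Lemma herm_entry k (v : 'cV[C]_k) i j : herm v i j = 'i%C * (v i 0 * Num.conj (v j 0)).
Proof. by rewrite mxE mxE big_ord1 [X in _ * (_ * X)]mxE [X in _ * (_ * Num.conj X)]mxE. Qed.

Lemma tr_herm k (v : 'cV[C]_k) : \tr (herm v) = 'i%C * nrm2 (fun i => v i 0).
Proof. by rewrite /mxtrace mulr_sumr; apply: eq_bigr => i _; rewrite herm_entry. Qed.

Lemma e_field_frame (v : 'cV[C]_n) (g : M) (s t : mbasis_index p q) :
    (0 < p)%N -> (0 < q)%N ->
  let x i := usubmx (g^t* *m v) i 0 in let z j := dsubmx (g^t* *m v) j 0 in
  e_field (killing_of (herm v)) g (vec2 (mbasis s) (mbasis t))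
  = sesq (fun s t => 'i%C * htens x z s t) s t.
Proof.
move=> p0 q0 x z; rewrite e_field_killing //; last exact: skew_herm.
rewrite conj_herm; set u := g^t* *m v.
rewrite on_frame_endo.
have ts : skew (twist (herm u) : M).
  have us : skew (herm u) by exact: skew_herm.
  rewrite /skew tr_block_mx map_block_mx !trmx0 !map_mx0 opp_block_mx !oppr0.
  rewrite herm_block block_mxKul block_mxKdr.
  by congr block_mx; apply/skewZ/skew_tracefree/skew_herm.
rewrite (frame_bracket _ _ ts) /sesq; congr (Re (_ * _)).
rewrite /iso_mx /twist block_mxKul block_mxKdr herm_block block_mxKul block_mxKdr.
move: (cidx s) (cidx t) => [i j] [i' j'] /=.
have tfE k (w : 'cV[C]_k) a b : tracefree (herm w) a b
   = 'i%C * (w a 0 * Num.conj (w b 0) - (a == b)%:R * (nrm2 (fun i => w i 0) / k%:R)).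
  have sub_scalar (A : 'M[C]_k) (c : C) : (A - c%:M) a b = A a b - c * (a == b)%:R.
    by rewrite !mxE mulr_natr.
  rewrite /tracefree tr_herm sub_scalar herm_entry.
  move: (_ * Num.conj _) (nrm2 _) (k%:R : C)^-1 ((a == b)%:R : C) => c1 c2 c3 c4.
  ring.
have scE k (c : C) (A : 'M[C]_k) a b : (c *: A) a b = c * A a b by rewrite mxE.
rewrite 2!scE 2!tfE /htens /= [i' == i]eq_sym rmorphN /=.
rewrite -/(x i) -/(x i') -/(z j) -/(z j') -/(nrm2 x) -/(nrm2 z).
move: (2 * alpha)%:C%C (2 * beta)%:C%C => k1 k2.
move: (nrm2 _ / _) (nrm2 _ / _) (x i' * _) (z j * _) => c1 c2 c3 c4.
move: ((i == i')%:R : C) ((j == j')%:R : C) => d1 d2.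
ring.
Qed.

Lemma Re_tr_offm (u w : 'M[C]_(p, q)) :
  Re (\tr (offm u *m offm w)) = - 2 * Re (\tr (u *m w^t*)).
Proof.
rewrite /offm tr_mul_offdiag mulmxN mulNmx 2!raddfN /=.
have -> : \tr (u^t* *m w) = Num.conj (\tr (u *m w^t*)).
  by rewrite -tr_ctrmx ctrmxM ctrmxK mxtrace_mulC.
by case: (\tr _) => a b /=; ring.
Qed.

Lemma cplx_str_offm (u : 'M[C]_(p, q)) : cplx_str (offm u) = offm ('i%C *: u).
Proof.
rewrite /cplx_str /offm block_mxKur block_mxKdl; congr block_mx.
have iJ : Num.conj ('i%C : C) = - 'i%C by rewrite /=; congr (_ +i* _)%C; rewrite oppr0.
apply/matrixP => i j; rewrite !mxE rmorphM /= iJ.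
by rewrite mulrN.
Qed.

Lemma omega_frame (g : M) (s t : mbasis_index p q) :
  omega g (vec2 (mbasis s) (mbasis t))
  = sesq (fun s t => 'i%C * (s == t)%:R) s t :> R.
Proof.
have -> : omega g (vec2 (mbasis s) (mbasis t)) = metric (cplx_str (mbasis s)) (mbasis t) by [].
case: s t => [[b i] j] [[b' i'] j'].
rewrite !mbasisE cplx_str_offm metricE; last first.
  by rewrite mxtrace_block !mxtrace0 addr0.
rewrite Re_tr_offm scalerA ctrmx_delta tr_delta_pair /sesq /cidx /= xpair_eqE -mulnb natrM.
have -> : Num.conj (scale%:C%C * phase b') = scale%:C%C * Num.conj (phase b').
  by rewrite rmorphM; congr (_ * _); exact: conjc_real.
have n0 : (0 < n)%N by rewrite addn_gt0 (leq_ltn_trans _ (ltn_ord i)).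
move: ((i == i')%:R * _) => d.
transitivity (4 * n%:R * (scale * scale) * Re (phase b * Num.conj (phase b') * ('i%C * d))).
  have -> : 'i%C * (scale%:C%C * phase b) * (scale%:C%C * Num.conj (phase b')) * d
      = scale%:C%C * scale%:C%C * (phase b * Num.conj (phase b') * ('i%C * d)).
    by ring.
  by move: (phase b * _ * _) => -[a c]; simpc => /=; ring.
by rewrite scale_sqr // mul1r.
Qed.
End EFrame.

(** * Inner products of wedge products *)

(** A permutation is the image of the first index together with a permutation
    of the rest; applied repeatedly, this leaves the sum over shuffles in a
    wedge product. *)
Lemma sum_perm_lift (V : nmodType) k (F : 'S_k.+1 -> V) :
  \sum_(s : 'S_k.+1) F s = \sum_(i < k.+1) \sum_(t : 'S_k) F (lift_perm ord0 i t).
Proof.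
rewrite pair_big /= (reindex (fun it : 'I_k.+1 * 'S_k => lift_perm ord0 it.1 it.2)) //.
apply/onW_bij/inj_card_bij; last by rewrite card_prod card_ord !card_Sn factS.
move=> [i t] [i' t'] /permP E /=.
have Ei : i = i' by have := E ord0; rewrite /= !lift_perm_id.
rewrite -Ei in E *; congr (_, _); apply/permP => a.
by have := E (lift ord0 a); rewrite /= !lift_perm_lift => /lift_inj.
Qed.

Lemma sum_perm0 (V : nmodType) (F : 'S_0 -> V) : \sum_(s : 'S_0) F s = F 1%g.
Proof.
rewrite (eq_bigr (fun=> F 1%g)) => [|s _].
  by rewrite sumr_const card_Sn fact0 mulr1n.
by congr F; apply/permP => -[].
Qed.

Lemma sign_lift_perm (K : pzRingType) k (i : 'I_k.+1) (t : 'S_k) :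
  (-1) ^+ lift_perm ord0 i t = (-1) ^+ i * (-1) ^+ t :> K.
Proof. by rewrite odd_lift_perm /= signr_addb signr_odd. Qed.

Lemma sum_sign_perm2 (K : pzRingType) (F : 'I_2 -> 'I_2 -> K) :
  \sum_(t : 'S_2) (-1) ^+ t * F (t ord0) (t ord_max) = F ord0 ord_max - F ord_max ord0.
Proof.
rewrite sum_perm_lift.
transitivity (\sum_(i < 2) (-1) ^+ i * F i (lift i ord0)).
  apply: eq_bigr => i _; rewrite sum_perm_lift big_ord1 sum_perm0.
  rewrite !sign_lift_perm odd_perm1 !mulr1 lift_perm_id.
  have -> : ord_max = lift ord0 ord0 :> 'I_2 by apply/val_inj.
  by rewrite lift_perm_lift lift_perm_id.
rewrite !big_ord_recl big_ord0 addr0 /= expr0 mul1r expr1 mulN1r.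
by congr (F _ _ - F _ _); apply/val_inj.
Qed.

Local Notation o30 := (@Ordinal 3 0 isT).
Local Notation o31 := (@Ordinal 3 1 isT).
Local Notation o32 := (@Ordinal 3 2 isT).

Lemma sum_sign_perm3 (K : comPzRingType) (F : 'I_3 -> 'I_3 -> 'I_3 -> K) :
  \sum_(t : 'S_3) (-1) ^+ t * F (t o30) (t o31) (t o32)
  = F o30 o31 o32 - F o30 o32 o31 - F o31 o30 o32 + F o31 o32 o30
    + F o32 o30 o31 - F o32 o31 o30.
Proof.
rewrite sum_perm_lift.
transitivity (\sum_(i < 3) (-1) ^+ i * (F i (lift i ord0) (lift i ord_max)
    - F i (lift i ord_max) (lift i ord0))).
  apply: eq_bigr => i _.
  rewrite -(sum_sign_perm2 (fun a b => F i (lift i a) (lift i b))) mulr_sumr.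
  apply: eq_bigr => t _; rewrite sign_lift_perm mulrA.
  have -> : o30 = ord0 by apply/val_inj.
  have -> : o31 = lift ord0 ord0 by apply/val_inj.
  have -> : o32 = lift ord0 ord_max by apply/val_inj.
  by rewrite lift_perm_id !lift_perm_lift.
rewrite !big_ord_recl big_ord0 addr0 /= expr0 mul1r expr1 mulN1r.
have -> : (-1) ^+ bump 0 1 = 1 :> K by rewrite /bump /= expr2 mulN1r opprK.
transitivity (F o30 o31 o32 - F o30 o32 o31 + (- (F o31 o30 o32 - F o31 o32 o30)
    + 1 * (F o32 o30 o31 - F o32 o31 o30))); last by ring.
by congr (F _ _ _ - F _ _ _ + (- (F _ _ _ - F _ _ _) + _ * (F _ _ _ - F _ _ _)));
  apply/val_inj.
Qed.

Section Wedge.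
Context {R : realType} {p q : nat}.
Local Notation M := 'M[R[i]]_(p + q).
Local Notation T := (mbasis_index p q).
Local Notation form k := (@form R p q k).

Lemma wedge_perm P Q (a : form P) (b : form Q) (v : 'I_(P + Q) -> M) (t : 'S_(P + Q)) :
  wedge a b (fun i => v (t i)) = (-1) ^+ t * wedge a b v.
Proof.
rewrite /wedge mulrCA; congr (_ * _).
rewrite [in RHS](reindex_inj (mulIg t)) /= mulr_sumr; apply: eq_bigr => s _.
have -> : (fun i => v ((s * t)%g (lshift Q i))) = fun i => v (t (s (lshift Q i))).
  by apply/funext => i; rewrite permM.
have -> : (fun i => v ((s * t)%g (rshift P i))) = fun i => v (t (s (rshift P i))).
  by apply/funext => i; rewrite permM.
by rewrite odd_permM signr_addb [_ * (-1) ^+ t]mulrC -!mulrA signrMK.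
Qed.

(** Every term of the antisymmetrization contributes the same to the inner
    product with a wedge product. *)
Lemma form_ip_wedge P Q (a : form P) (b : form Q) (c : form (P + Q))
    (cJ : forall (v : 'I_(P + Q) -> M) (t : 'S_(P + Q)),
      c (fun i => v (t i)) = (-1) ^+ t * c v) :
  form_ip (wedge a b) c = (P`! * Q`!)%:R^-1 * \sum_(f : {ffun 'I_(P + Q) -> T})
    a (fun i => mbasis (f (lshift Q i))) * b (fun j => mbasis (f (rshift P j)))
      * c (fun i => mbasis (f i)).
Proof.
rewrite /form_ip /wedge; set S := (X in _ = _ * X).
transitivity (((P + Q)`!)%:R^-1 * ((P`! * Q`!)%:R^-1 * \sum_(s : 'S_(P + Q)) S)).
  congr (_ * _); rewrite (eq_bigr (fun f : {ffun 'I_(P + Q) -> T} =>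
      \sum_(s : 'S_(P + Q)) (P`! * Q`!)%:R^-1 * ((-1) ^+ s
        * a (fun i => mbasis (f (s (lshift Q i)))) * b (fun j => mbasis (f (s (rshift P j))))
        * c (fun i => mbasis (f i))))) => [|f _]; last first.
    by rewrite -mulrA mulr_suml mulr_sumr.
  rewrite exchange_big mulr_sumr /=; apply: eq_bigr => s _; rewrite -mulr_sumr; congr (_ * _).
  have inj : injective (fun f : {ffun 'I_(P + Q) -> T} => [ffun i => f ((s^-1)%g i)]).
    move=> f f' /ffunP E; apply/ffunP => i; have := E (s i).
    by rewrite !ffunE permK.
  rewrite (reindex_inj inj) /=; apply: eq_bigr => f _.
  have -> : (fun i => mbasis ([ffun i => f ((s^-1)%g i)] (s (lshift Q i))) : M)
     = fun i => mbasis (f (lshift Q i)).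
    by apply/funext => i; rewrite ffunE permK.
  have -> : (fun i => mbasis ([ffun i => f ((s^-1)%g i)] (s (rshift P i))) : M)
     = fun i => mbasis (f (rshift P i)).
    by apply/funext => i; rewrite ffunE permK.
  have -> : (fun i => mbasis ([ffun i => f ((s^-1)%g i)] i) : M)
     = fun i => mbasis (f ((s^-1)%g i)).
    by apply/funext => i; rewrite ffunE.
  rewrite (cJ (fun i => mbasis (f i))) odd_permV.
  have signK (e : bool) (x y z : R) : (-1) ^+ e * x * y * ((-1) ^+ e * z) = x * y * z.
    by case: e; rewrite ?expr1 ?expr0; ring.
  exact: signK.
rewrite sumr_const card_Sn -[S *+ _]mulr_natl mulrCA [X in _ * X]mulrA mulVf ?mul1r //.
Qed.

(** The sums over the shuffles for the wedge product of a two-form with a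
    two-form and with a three-form. *)
Definition wedge22_at (A B : T -> T -> R) (s0 s1 s2 s3 : T) : R :=
  A s0 s1 * B s2 s3 - A s0 s2 * B s1 s3 + A s0 s3 * B s1 s2
  + A s1 s2 * B s0 s3 - A s1 s3 * B s0 s2 + A s2 s3 * B s0 s1.

Definition wedge23_at (A : T -> T -> R) (F : T -> T -> T -> R) (s0 s1 s2 s3 s4 : T) : R :=
  A s0 s1 * F s2 s3 s4 - A s0 s2 * F s1 s3 s4 + A s0 s3 * F s1 s2 s4
  - A s0 s4 * F s1 s2 s3 + A s1 s2 * F s0 s3 s4 - A s1 s3 * F s0 s2 s4
  + A s1 s4 * F s0 s2 s3 + A s2 s3 * F s0 s1 s4 - A s2 s4 * F s0 s1 s3
  + A s3 s4 * F s0 s1 s2.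

Lemma wedge2_expand Q (a : form 2) (b : form Q) (v : 'I_Q.+2 -> M) :
  wedge a b v = (2 * Q`!)%:R^-1 * \sum_(i < Q.+2) \sum_(j < Q.+1)
    (-1) ^+ i * ((-1) ^+ j * (a (vec2 (v i) (v (lift i j)))
      * \sum_(t : 'S_Q) (-1) ^+ t * b (fun k => v (lift i (lift j (t k)))))).
Proof.
rewrite /wedge; congr (_ * _).
rewrite (@sum_perm_lift _ Q.+1); apply: eq_bigr => i _.
rewrite (@sum_perm_lift _ Q); apply: eq_bigr => j _.
rewrite !mulr_sumr; apply: eq_bigr => t _; rewrite !sign_lift_perm.
have -> : (fun k : 'I_2 => v (lift_perm ord0 i (lift_perm ord0 j t) (lshift Q k)))
    = vec2 (v i) (v (lift i j)).
  apply/funext => -[[|[|//]] lt].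
    have -> : lshift Q (Ordinal lt) = ord0 :> 'I_Q.+2 by apply/val_inj.
    by rewrite lift_perm_id.
  have -> : lshift Q (Ordinal lt) = lift ord0 ord0 :> 'I_Q.+2 by apply/val_inj.
  by rewrite lift_perm_lift lift_perm_id.
have -> : (fun k : 'I_Q => v (lift_perm ord0 i (lift_perm ord0 j t) (rshift 2 k)))
    = fun k => v (lift i (lift j (t k))).
  apply/funext => k.
  have -> : rshift 2 k = lift ord0 (lift ord0 k) :> 'I_Q.+2 by apply/val_inj.
  by rewrite !lift_perm_lift.
have key (e1 e2 e3 x y : R) : e1 * (e2 * e3) * x * y = e1 * (e2 * (x * (e3 * y))).
  by ring.
exact: key.
Qed.
End Wedge.

Section WedgeFrame.
Context {R : realType} {p q : nat}.
Local Notation T := (mbasis_index p q).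
Local Notation form k := (@form R p q k).
Local Notation fnilT := (@fnil T).

Variables (A : T -> T -> R) (a : form 2).
Hypothesis aE : forall s t, a (vec2 (mbasis s) (mbasis t)) = A s t.
Hypothesis AC : forall s t, A s t = - A t s.

Lemma form2_frame (f : 'I_2 -> T) :
  a (fun i => mbasis (f i)) = A (f ord0) (f ord_max).
Proof.
rewrite -aE; congr a; apply/funext => -[[|[|//]] lt].
  by congr (mbasis (f _)); apply/val_inj.
by congr (mbasis (f _)); apply/val_inj.
Qed.

Section Two.
Variables (B : T -> T -> R) (b : form 2).
Hypothesis bE : forall s t, b (vec2 (mbasis s) (mbasis t)) = B s t.
Hypothesis BC : forall s t, B s t = - B t s.

Lemma sum_two (f : 'I_2 -> T) :
  \sum_(t : 'S_2) (-1) ^+ t * b (fun k => mbasis (f (t k))) = 2 * B (f ord0) (f ord_max).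
Proof.
rewrite (eq_bigr (fun t : 'S_2 => (-1) ^+ t * B (f (t ord0)) (f (t ord_max)))).
  rewrite (sum_sign_perm2 (fun i j => B (f i) (f j))) [B (f ord_max) _]BC.
  ring.
move=> t _; rewrite -bE; congr (_ * b _); apply/funext => -[[|[|//]] lt].
  by congr (mbasis (f (t _))); apply/val_inj.
by congr (mbasis (f (t _))); apply/val_inj.
Qed.

Lemma wedge22_frame s0 s1 s2 s3 :
  wedge a b (fun k => mbasis (fcons s0 (fcons s1 (fcons s2 (fcons s3 fnilT))) k))
  = wedge22_at A B s0 s1 s2 s3.
Proof.
set f := fcons s0 _; rewrite wedge2_expand.
rewrite (eq_bigr (fun i : 'I_4 => \sum_(j < 3) (-1) ^+ i * ((-1) ^+ j * (A (f i) (f (lift i j))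
    * (2 * B (f (lift i (lift j ord0))) (f (lift i (lift j ord_max)))))))); last first.
  move=> i _; apply: eq_bigr => j _.
  by rewrite (sum_two (fun k => f (lift i (lift j k)))) aE.
rewrite !big_ord_recl !big_ord0 /f /wedge22_at.
(* [lift] and [fcons] compute at concrete positions *)
transitivity (4%:R^-1 *
(((-1) ^+ 0 * ((-1) ^+ 0 * (A s0 s1 * (2 * B s2 s3))) + ((-1) ^+ 0 * ((-1) ^+ 1 * (A s0 s2
* (2 * B s1 s3))) + ((-1) ^+ 0 * ((-1) ^+ 2 * (A s0 s3 * (2 * B s1 s2))) + 0))) + (((-1)
^+ 1 * ((-1) ^+ 0 * (A s1 s0 * (2 * B s2 s3))) + ((-1) ^+ 1 * ((-1) ^+ 1 * (A s1 s2 * (2 *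
B s0 s3))) + ((-1) ^+ 1 * ((-1) ^+ 2 * (A s1 s3 * (2 * B s0 s2))) + 0))) + (((-1) ^+ 2 *
((-1) ^+ 0 * (A s2 s0 * (2 * B s1 s3))) + ((-1) ^+ 2 * ((-1) ^+ 1 * (A s2 s1 * (2 * B s0
s3))) + ((-1) ^+ 2 * ((-1) ^+ 2 * (A s2 s3 * (2 * B s0 s1))) + 0))) + (((-1) ^+ 3 * ((-1)
^+ 0 * (A s3 s0 * (2 * B s1 s2))) + ((-1) ^+ 3 * ((-1) ^+ 1 * (A s3 s1 * (2 * B s0 s2))) +
((-1) ^+ 3 * ((-1) ^+ 2 * (A s3 s2 * (2 * B s0 s1))) + 0))) + 0))))).
  by [].
rewrite (AC s1 s0) (AC s2 s0) (AC s2 s1) (AC s3 s0) (AC s3 s1) (AC s3 s2).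
have n4 : (4%:R : R) != 0 by rewrite pnatr_eq0.
by field.
Qed.
End Two.

Section Three.
Variables (F : T -> T -> T -> R) (b : form 3).
Hypothesis bE : forall s t r, b (vec3 (mbasis s) (mbasis t) (mbasis r)) = F s t r.
Hypothesis FC1 : forall s t r, F s t r = - F t s r.
Hypothesis FC2 : forall s t r, F s t r = - F s r t.

Lemma form3_frame (f : 'I_3 -> T) :
  b (fun i => mbasis (f i)) = F (f o30) (f o31) (f o32).
Proof.
rewrite -bE; congr b; apply/funext => -[[|[|[|//]]] lt].
- by congr (mbasis (f _)); apply/val_inj.
- by congr (mbasis (f _)); apply/val_inj.
- by congr (mbasis (f _)); apply/val_inj.
Qed.

Lemma sum_three (f : 'I_3 -> T) :
  \sum_(t : 'S_3) (-1) ^+ t * b (fun k => mbasis (f (t k)))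
  = 6 * F (f o30) (f o31) (f o32).
Proof.
rewrite (eq_bigr (fun t : 'S_3 => (-1) ^+ t * F (f (t o30)) (f (t o31)) (f (t o32)))).
  rewrite (sum_sign_perm3 (fun i j k => F (f i) (f j) (f k))).
  move: (f o30) (f o31) (f o32) => x y z.
  have -> : F z y x = - F x y z by rewrite FC1 FC2 FC1 !opprK.
  have -> : F z x y = F x y z by rewrite FC1 FC2 opprK.
  have -> : F y z x = F x y z by rewrite FC2 FC1 opprK.
  rewrite (FC1 y x z) (FC2 x z y).
  ring.
by move=> t _; rewrite -(form3_frame (fun k => f (t k))).
Qed.

Lemma wedge23_frame s0 s1 s2 s3 s4 :
  wedge a b (fun k => mbasis (fcons s0 (fcons s1 (fcons s2 (fcons s3 (fcons s4 fnilT)))) k))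
  = wedge23_at A F s0 s1 s2 s3 s4.
Proof.
set f := fcons s0 _; rewrite wedge2_expand.
rewrite (eq_bigr (fun i : 'I_5 => \sum_(j < 4) (-1) ^+ i * ((-1) ^+ j * (A (f i) (f (lift i j))
    * (6 * F (f (lift i (lift j o30))) (f (lift i (lift j o31))) (f (lift i (lift j o32)))))))); last first.
  move=> i _; apply: eq_bigr => j _.
  by rewrite (sum_three (fun k => f (lift i (lift j k)))) aE.
rewrite !big_ord_recl !big_ord0 /f /wedge23_at.
(* [lift] and [fcons] compute at concrete positions *)
transitivity (12%:R^-1 *
(((-1) ^+ 0 * ((-1) ^+ 0 * (A s0 s1 * (6 * F s2 s3 s4))) + ((-1) ^+ 0 * ((-1) ^+ 1 * (A s0
s2 * (6 * F s1 s3 s4))) + ((-1) ^+ 0 * ((-1) ^+ 2 * (A s0 s3 * (6 * F s1 s2 s4))) + ((-1)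
^+ 0 * ((-1) ^+ 3 * (A s0 s4 * (6 * F s1 s2 s3))) + 0)))) + (((-1) ^+ 1 * ((-1) ^+ 0 * (A
s1 s0 * (6 * F s2 s3 s4))) + ((-1) ^+ 1 * ((-1) ^+ 1 * (A s1 s2 * (6 * F s0 s3 s4))) +
((-1) ^+ 1 * ((-1) ^+ 2 * (A s1 s3 * (6 * F s0 s2 s4))) + ((-1) ^+ 1 * ((-1) ^+ 3 * (A s1
s4 * (6 * F s0 s2 s3))) + 0)))) + (((-1) ^+ 2 * ((-1) ^+ 0 * (A s2 s0 * (6 * F s1 s3 s4)))
+ ((-1) ^+ 2 * ((-1) ^+ 1 * (A s2 s1 * (6 * F s0 s3 s4))) + ((-1) ^+ 2 * ((-1) ^+ 2 * (A
s2 s3 * (6 * F s0 s1 s4))) + ((-1) ^+ 2 * ((-1) ^+ 3 * (A s2 s4 * (6 * F s0 s1 s3))) +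
0)))) + (((-1) ^+ 3 * ((-1) ^+ 0 * (A s3 s0 * (6 * F s1 s2 s4))) + ((-1) ^+ 3 * ((-1) ^+ 1
* (A s3 s1 * (6 * F s0 s2 s4))) + ((-1) ^+ 3 * ((-1) ^+ 2 * (A s3 s2 * (6 * F s0 s1 s4)))
+ ((-1) ^+ 3 * ((-1) ^+ 3 * (A s3 s4 * (6 * F s0 s1 s2))) + 0)))) + (((-1) ^+ 4 * ((-1) ^+
0 * (A s4 s0 * (6 * F s1 s2 s3))) + ((-1) ^+ 4 * ((-1) ^+ 1 * (A s4 s1 * (6 * F s0 s2
s3))) + ((-1) ^+ 4 * ((-1) ^+ 2 * (A s4 s2 * (6 * F s0 s1 s3))) + ((-1) ^+ 4 * ((-1) ^+ 3
* (A s4 s3 * (6 * F s0 s1 s2))) + 0)))) + 0)))))).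
  by [].
rewrite (AC s1 s0) (AC s2 s0) (AC s2 s1) (AC s3 s0) (AC s3 s1) (AC s3 s2).
rewrite (AC s4 s0) (AC s4 s1) (AC s4 s2) (AC s4 s3).
by field.
Qed.
End Three.
End WedgeFrame.

Section ContractWedge.
Context {R : realType} {p q : nat}.
Local Notation T := (mbasis_index p q).
Local Notation form k := (@form R p q k).
Local Notation fnilT := (@fnil T).

Lemma sum_ffun4 (V : nmodType) (G : ('I_4 -> T) -> V) :
  \sum_(f : {ffun 'I_4 -> T}) G f
  = \sum_s0 \sum_s1 \sum_s2 \sum_s3 G (fcons s0 (fcons s1 (fcons s2 (fcons s3 fnilT)))).
Proof.
rewrite sum_ffun_cons; apply: eq_bigr => s0 _.
rewrite (sum_ffun_cons (fun f => G (fcons s0 f))); apply: eq_bigr => s1 _.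
rewrite (sum_ffun_cons (fun f => G (fcons s0 (fcons s1 f)))); apply: eq_bigr => s2 _.
rewrite (sum_ffun_cons (fun f => G (fcons s0 (fcons s1 (fcons s2 f))))).
apply: eq_bigr => s3 _.
exact: (sum_ffun0 (fun f => G (fcons s0 (fcons s1 (fcons s2 (fcons s3 f)))))).
Qed.

Lemma sum_ffun5 (V : nmodType) (G : ('I_5 -> T) -> V) :
  \sum_(f : {ffun 'I_5 -> T}) G f
  = \sum_s0 \sum_s1 \sum_s2 \sum_s3 \sum_s4
      G (fcons s0 (fcons s1 (fcons s2 (fcons s3 (fcons s4 fnilT))))).
Proof.
rewrite sum_ffun_cons; apply: eq_bigr => s0 _.
rewrite (sum_ffun_cons (fun f => G (fcons s0 f))); apply: eq_bigr => s1 _.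
rewrite (sum_ffun_cons (fun f => G (fcons s0 (fcons s1 f)))); apply: eq_bigr => s2 _.
rewrite (sum_ffun_cons (fun f => G (fcons s0 (fcons s1 (fcons s2 f))))).
apply: eq_bigr => s3 _.
rewrite (sum_ffun_cons (fun f => G (fcons s0 (fcons s1 (fcons s2 (fcons s3 f)))))).
apply: eq_bigr => s4 _.
exact: (sum_ffun0 (fun f => G (fcons s0 (fcons s1 (fcons s2 (fcons s3 (fcons s4 f))))))).
Qed.

(** Of the six shuffles of [a ^ w], the two that keep the arguments of the
    factors of [a ^ a] together produce the vanishing product of [a] and [w];
    the other four agree by skewness. *)
Lemma form_ip_wedge22 (a w : form 2) (A W : T -> T -> R) :
    (forall s t, a (vec2 (mbasis s) (mbasis t)) = A s t) ->
    (forall s t, w (vec2 (mbasis s) (mbasis t)) = W s t) ->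
    (forall s t, A s t = - A t s) -> (forall s t, W s t = - W t s) ->
    \sum_s \sum_t A s t * W s t = 0 ->
  form_ip (wedge a a) (wedge a w)
  = - \sum_s0 \sum_s1 \sum_s2 \sum_s3 A s0 s1 * A s2 s3 * A s0 s2 * W s1 s3.
Proof.
move=> aE wE AC WC AW.
rewrite (form_ip_wedge _ _ (fun v t => wedge_perm a w v t)).
pose G (f : 'I_4 -> T) : R := a (fun i => mbasis (f (lshift 2 i))) *
  a (fun j => mbasis (f (rshift 2 j))) * wedge a w (fun i => mbasis (f i)).
rewrite (sum_ffun4 G).
have GE s0 s1 s2 s3 : G (fcons s0 (fcons s1 (fcons s2 (fcons s3 fnilT))))
    = A s0 s1 * A s2 s3 * wedge22_at A W s0 s1 s2 s3.
  rewrite /G (wedge22_frame aE AC wE WC); congr (_ * _ * _).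
    exact: (form2_frame aE (fun i => fcons s0 (fcons s1 (fcons s2 (fcons s3 fnilT))) (lshift 2 i))).
  exact: (form2_frame aE (fun i => fcons s0 (fcons s1 (fcons s2 (fcons s3 fnilT))) (rshift 2 i))).
pose S (H : T -> T -> T -> T -> R) := \sum_s0 \sum_s1 \sum_s2 \sum_s3 H s0 s1 s2 s3.
have SD H K : S (fun s0 s1 s2 s3 => H s0 s1 s2 s3 + K s0 s1 s2 s3) = S H + S K.
  by rewrite /S -big_split; apply: eq_bigr => s0 _; rewrite -big_split; apply: eq_bigr => s1 _;
     rewrite -big_split; apply: eq_bigr => s2 _; rewrite -big_split; apply: eq_bigr.
have SN H : S (fun s0 s1 s2 s3 => - H s0 s1 s2 s3) = - S H.
  by rewrite /S -sumrN; apply: eq_bigr => s0 _; rewrite -sumrN; apply: eq_bigr => s1 _;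
     rewrite -sumrN; apply: eq_bigr => s2 _; rewrite -sumrN; apply: eq_bigr.
have eqS H K : (forall s0 s1 s2 s3, H s0 s1 s2 s3 = K s0 s1 s2 s3) -> S H = S K.
  by move=> HK; apply: eq_bigr => s0 _; apply: eq_bigr => s1 _; apply: eq_bigr => s2 _;
     apply: eq_bigr => s3 _.
have S01 H : S H = S (fun s0 s1 s2 s3 => H s1 s0 s2 s3) by exact: exchange_big.
have S23 H : S H = S (fun s0 s1 s2 s3 => H s0 s1 s3 s2).
  by apply: eq_bigr => s0 _; apply: eq_bigr => s1 _; exact: exchange_big.
pose H0 s0 s1 s2 s3 := A s0 s1 * A s2 s3 * A s0 s2 * W s1 s3.
have Z1 : S (fun s0 s1 s2 s3 => A s0 s1 * A s2 s3 * (A s0 s1 * W s2 s3)) = 0.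
  transitivity (\sum_s0 \sum_s1 A s0 s1 * A s0 s1 * \sum_s2 \sum_s3 A s2 s3 * W s2 s3).
    apply: eq_bigr => s0 _; apply: eq_bigr => s1 _; rewrite mulr_sumr.
    by apply: eq_bigr => s2 _; rewrite mulr_sumr; apply: eq_bigr => s3 _; ring.
  by rewrite AW big1 // => s0 _; rewrite big1 // => s1 _; rewrite mulr0.
have Z2 : S (fun s0 s1 s2 s3 => A s0 s1 * A s2 s3 * (A s2 s3 * W s0 s1)) = 0.
  transitivity (\sum_s0 \sum_s1 A s0 s1 * W s0 s1 * \sum_s2 \sum_s3 A s2 s3 * A s2 s3).
    apply: eq_bigr => s0 _; apply: eq_bigr => s1 _; rewrite mulr_sumr.
    by apply: eq_bigr => s2 _; rewrite mulr_sumr; apply: eq_bigr => s3 _; ring.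
  under eq_bigr => s0 _ do rewrite -mulr_suml.
  by rewrite -mulr_suml AW mul0r.
have Y1 : S (fun s0 s1 s2 s3 => - (A s0 s1 * A s2 s3 * (A s0 s2 * W s1 s3))) = - S H0.
  by rewrite SN; congr (- _); apply: eqS => *; rewrite /H0; ring.
have Y2 : S (fun s0 s1 s2 s3 => A s0 s1 * A s2 s3 * (A s0 s3 * W s1 s2)) = - S H0.
  by rewrite S23 -SN; apply: eqS => s0 s1 s2 s3; rewrite /H0 (AC s3 s2); ring.
have Y3 : S (fun s0 s1 s2 s3 => A s0 s1 * A s2 s3 * (A s1 s2 * W s0 s3)) = - S H0.
  by rewrite S01 -SN; apply: eqS => s0 s1 s2 s3; rewrite /H0 (AC s1 s0); ring.
have Y4 : S (fun s0 s1 s2 s3 => - (A s0 s1 * A s2 s3 * (A s1 s3 * W s0 s2))) = - S H0.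
  rewrite S01 S23 -SN; apply: eqS => s0 s1 s2 s3.
  by rewrite /H0 (AC s1 s0) (AC s3 s2); ring.
transitivity (4%:R^-1 * S (fun s0 s1 s2 s3 => A s0 s1 * A s2 s3 * wedge22_at A W s0 s1 s2 s3)).
  by congr (_ * _); apply: eqS => *; exact: GE.
rewrite (@eqS _ (fun s0 s1 s2 s3 => A s0 s1 * A s2 s3 * (A s0 s1 * W s2 s3)
   + - (A s0 s1 * A s2 s3 * (A s0 s2 * W s1 s3)) + A s0 s1 * A s2 s3 * (A s0 s3 * W s1 s2)
   + A s0 s1 * A s2 s3 * (A s1 s2 * W s0 s3) + - (A s0 s1 * A s2 s3 * (A s1 s3 * W s0 s2))
   + A s0 s1 * A s2 s3 * (A s2 s3 * W s0 s1))); last first.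
  by move=> *; rewrite /wedge22_at; ring.
rewrite !SD Z1 Y1 Y2 Y3 Y4 Z2 -/(S H0).
have n4 : (4%:R : R) != 0 by rewrite pnatr_eq0.
by field.
Qed.

(** Of the ten shuffles of [a ^ b], the one that gives both arguments of [w]
    to [a] vanishes as [a] is orthogonal to [w], and the three that give both
    of them to [b] vanish as [b] has no contraction by [w]; the other six
    agree by skewness. *)
Lemma form_ip_wedge23 (a w : form 2) (b : form 3) (A W : T -> T -> R) (F : T -> T -> T -> R) :
    (forall s t, a (vec2 (mbasis s) (mbasis t)) = A s t) ->
    (forall s t, w (vec2 (mbasis s) (mbasis t)) = W s t) ->
    (forall s t r, b (vec3 (mbasis s) (mbasis t) (mbasis r)) = F s t r) ->
    (forall s t, A s t = - A t s) -> (forall s t, W s t = - W t s) ->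
    (forall s t r, F s t r = - F t s r) -> (forall s t r, F s t r = - F s r t) ->
    \sum_s \sum_t W s t * A s t = 0 -> (forall r, \sum_s \sum_t W s t * F s t r = 0) ->
  form_ip (wedge w b) (wedge a b)
  = - 2^-1 * \sum_s1 \sum_s2 (\sum_s0 W s0 s1 * A s0 s2)
      * \sum_s3 \sum_s4 F s1 s3 s4 * F s2 s3 s4.
Proof.
move=> aE wE bE AC WC FC1 FC2 WA WF.
rewrite (form_ip_wedge _ _ (fun v t => wedge_perm a b v t)).
pose G (f : 'I_5 -> T) : R := w (fun i => mbasis (f (lshift 3 i))) *
  b (fun j => mbasis (f (rshift 2 j))) * wedge a b (fun i => mbasis (f i)).
rewrite (sum_ffun5 G).
have GE s0 s1 s2 s3 s4 : G (fcons s0 (fcons s1 (fcons s2 (fcons s3 (fcons s4 fnilT)))))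
    = W s0 s1 * F s2 s3 s4 * wedge23_at A F s0 s1 s2 s3 s4.
  rewrite /G (wedge23_frame aE AC bE FC1 FC2); congr (_ * _ * _).
    exact: (form2_frame wE (fun i =>
      fcons s0 (fcons s1 (fcons s2 (fcons s3 (fcons s4 fnilT)))) (lshift 3 i))).
  exact: (form3_frame bE (fun i =>
    fcons s0 (fcons s1 (fcons s2 (fcons s3 (fcons s4 fnilT)))) (rshift 2 i))).
pose S (H : T -> T -> T -> T -> T -> R) :=
  \sum_s0 \sum_s1 \sum_s2 \sum_s3 \sum_s4 H s0 s1 s2 s3 s4.
have eqS H K : (forall s0 s1 s2 s3 s4, H s0 s1 s2 s3 s4 = K s0 s1 s2 s3 s4) -> S H = S K.
  by move=> HK; apply: eq_bigr => s0 _; apply: eq_bigr => s1 _; apply: eq_bigr => s2 _;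
     apply: eq_bigr => s3 _; apply: eq_bigr => s4 _.
have SD H K : S (fun s0 s1 s2 s3 s4 => H s0 s1 s2 s3 s4 + K s0 s1 s2 s3 s4) = S H + S K.
  by rewrite /S -big_split; apply: eq_bigr => s0 _; rewrite -big_split; apply: eq_bigr => s1 _;
     rewrite -big_split; apply: eq_bigr => s2 _; rewrite -big_split; apply: eq_bigr => s3 _;
     rewrite -big_split; apply: eq_bigr.
have SN H : S (fun s0 s1 s2 s3 s4 => - H s0 s1 s2 s3 s4) = - S H.
  by rewrite /S -sumrN; apply: eq_bigr => s0 _; rewrite -sumrN; apply: eq_bigr => s1 _;
     rewrite -sumrN; apply: eq_bigr => s2 _; rewrite -sumrN; apply: eq_bigr => s3 _;
     rewrite -sumrN; apply: eq_bigr.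
have S01 H : S H = S (fun s0 s1 s2 s3 s4 => H s1 s0 s2 s3 s4) by exact: exchange_big.
have S23 H : S H = S (fun s0 s1 s2 s3 s4 => H s0 s1 s3 s2 s4).
  by apply: eq_bigr => s0 _; apply: eq_bigr => s1 _; exact: exchange_big.
have S34 H : S H = S (fun s0 s1 s2 s3 s4 => H s0 s1 s2 s4 s3).
  by apply: eq_bigr => s0 _; apply: eq_bigr => s1 _; apply: eq_bigr => s2 _; exact: exchange_big.
pose V s0 s1 s2 s3 s4 := W s0 s1 * F s2 s3 s4 * (A s0 s2 * F s1 s3 s4).
have Z01 : S (fun s0 s1 s2 s3 s4 => W s0 s1 * F s2 s3 s4 * (A s0 s1 * F s2 s3 s4)) = 0.
  transitivity ((\sum_s0 \sum_s1 W s0 s1 * A s0 s1)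
      * \sum_s2 \sum_s3 \sum_s4 F s2 s3 s4 * F s2 s3 s4).
    rewrite mulr_suml; apply: eq_bigr => s0 _; rewrite mulr_suml; apply: eq_bigr => s1 _.
    rewrite mulr_sumr; apply: eq_bigr => s2 _; rewrite mulr_sumr; apply: eq_bigr => s3 _.
    by rewrite mulr_sumr; apply: eq_bigr => s4 _; ring.
  by rewrite WA mul0r.
have Z23 : S (fun s0 s1 s2 s3 s4 => W s0 s1 * F s2 s3 s4 * (A s2 s3 * F s0 s1 s4)) = 0.
  transitivity (\sum_s2 \sum_s3 \sum_s4 F s2 s3 s4 * A s2 s3
      * \sum_s0 \sum_s1 W s0 s1 * F s0 s1 s4); last first.
    by rewrite big1 // => s2 _; rewrite big1 // => s3 _; rewrite big1 // => s4 _;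
       rewrite WF mulr0.
  transitivity (\sum_s0 \sum_s2 \sum_s3 \sum_s4 \sum_s1
      W s0 s1 * F s2 s3 s4 * (A s2 s3 * F s0 s1 s4)).
    apply: eq_bigr => s0 _; rewrite exchange_big; apply: eq_bigr => s2 _ /=.
    rewrite exchange_big; apply: eq_bigr => s3 _ /=; exact: exchange_big.
  rewrite exchange_big; apply: eq_bigr => s2 _ /=.
  rewrite exchange_big; apply: eq_bigr => s3 _ /=.
  rewrite exchange_big; apply: eq_bigr => s4 _ /=.
  rewrite mulr_sumr; apply: eq_bigr => s0 _; rewrite mulr_sumr.
  by apply: eq_bigr => s1 _; ring.
have Z24 : S (fun s0 s1 s2 s3 s4 => - (W s0 s1 * F s2 s3 s4 * (A s2 s4 * F s0 s1 s3))) = 0.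
  rewrite S34 -Z23; apply: eqS => s0 s1 s2 s3 s4.
  by rewrite (FC2 s2 s4 s3); ring.
have Z34 : S (fun s0 s1 s2 s3 s4 => W s0 s1 * F s2 s3 s4 * (A s3 s4 * F s0 s1 s2)) = 0.
  rewrite -Z24 S23; apply: eqS => s0 s1 s2 s3 s4.
  by rewrite (FC1 s3 s2 s4); ring.
have Y02 : S (fun s0 s1 s2 s3 s4 => - (W s0 s1 * F s2 s3 s4 * (A s0 s2 * F s1 s3 s4))) = - S V.
  exact: SN.
have Y03 : S (fun s0 s1 s2 s3 s4 => W s0 s1 * F s2 s3 s4 * (A s0 s3 * F s1 s2 s4)) = - S V.
  rewrite S23 -SN; apply: eqS => s0 s1 s2 s3 s4.
  by rewrite /V (FC1 s3 s2 s4); ring.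
have Y04 : S (fun s0 s1 s2 s3 s4 => - (W s0 s1 * F s2 s3 s4 * (A s0 s4 * F s1 s2 s3))) = - S V.
  rewrite S34 -Y03; apply: eqS => s0 s1 s2 s3 s4.
  by rewrite (FC2 s2 s4 s3); ring.
have Y12 : S (fun s0 s1 s2 s3 s4 => W s0 s1 * F s2 s3 s4 * (A s1 s2 * F s0 s3 s4)) = - S V.
  rewrite S01 -SN; apply: eqS => s0 s1 s2 s3 s4.
  by rewrite /V (WC s1 s0); ring.
have Y13 : S (fun s0 s1 s2 s3 s4 => - (W s0 s1 * F s2 s3 s4 * (A s1 s3 * F s0 s2 s4))) = - S V.
  rewrite S01 -Y03; apply: eqS => s0 s1 s2 s3 s4.
  by rewrite (WC s1 s0); ring.
have Y14 : S (fun s0 s1 s2 s3 s4 => W s0 s1 * F s2 s3 s4 * (A s1 s4 * F s0 s2 s3)) = - S V.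
  rewrite S01 -Y04; apply: eqS => s0 s1 s2 s3 s4.
  by rewrite (WC s1 s0); ring.
transitivity (12%:R^-1 * S (fun s0 s1 s2 s3 s4 =>
    W s0 s1 * F s2 s3 s4 * wedge23_at A F s0 s1 s2 s3 s4)).
  by congr (_ * _); apply: eqS => *; exact: GE.
rewrite (@eqS _ (fun s0 s1 s2 s3 s4 =>
     W s0 s1 * F s2 s3 s4 * (A s0 s1 * F s2 s3 s4)
   + - (W s0 s1 * F s2 s3 s4 * (A s0 s2 * F s1 s3 s4))
   + W s0 s1 * F s2 s3 s4 * (A s0 s3 * F s1 s2 s4)
   + - (W s0 s1 * F s2 s3 s4 * (A s0 s4 * F s1 s2 s3))
   + W s0 s1 * F s2 s3 s4 * (A s1 s2 * F s0 s3 s4)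
   + - (W s0 s1 * F s2 s3 s4 * (A s1 s3 * F s0 s2 s4))
   + W s0 s1 * F s2 s3 s4 * (A s1 s4 * F s0 s2 s3)
   + W s0 s1 * F s2 s3 s4 * (A s2 s3 * F s0 s1 s4)
   + - (W s0 s1 * F s2 s3 s4 * (A s2 s4 * F s0 s1 s3))
   + W s0 s1 * F s2 s3 s4 * (A s3 s4 * F s0 s1 s2))); last first.
  by move=> *; rewrite /wedge23_at; ring.
rewrite !SD Z01 Y02 Y03 Y04 Y12 Y13 Y14 Z23 Z24 Z34.
have -> : S V = \sum_s1 \sum_s2 (\sum_s0 W s0 s1 * A s0 s2)
      * \sum_s3 \sum_s4 F s1 s3 s4 * F s2 s3 s4.
  rewrite /S exchange_big; apply: eq_bigr => s1 _ /=.
  rewrite exchange_big; apply: eq_bigr => s2 _ /=.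
  rewrite mulr_suml; apply: eq_bigr => s0 _; rewrite mulr_sumr; apply: eq_bigr => s3 _.
  by rewrite mulr_sumr; apply: eq_bigr => s4 _; rewrite /V; ring.
by field.
Qed.
End ContractWedge.

(** * From real to complex contractions *)

Section Complexify.
Context {R : realType} {p q : nat}.
Local Notation Re := complex.Re.
Local Notation Im := complex.Im.
Local Notation C := (R[i]).
Local Notation phase := (@phase R).
Local Notation cpair := ('I_p * 'I_q)%type.
Local Notation T := (mbasis_index p q).
Implicit Types (H K : cpair -> cpair -> C) (L : cpair -> cpair -> cpair -> C).

(** The real frame consists of unit vectors and their multiples by [i], so
    summing over the two phases turns composition of real bilinear forms into
    a product of complex matrices. *)
Lemma sesq_mul H K (s r : T) :
  \sum_t sesq H s t * sesq K t r
  = sesq (fun a c => \sum_b H a b * K b c) s r.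
Proof.
rewrite sum_mbasis /sesq mulr_sumr raddf_sum; apply: eq_bigr => a _ /=.
rewrite big_bool /cidx -surjective_pairing /=.
move: (H _ _) (K _ _) (phase s.1.1) (Num.conj (phase r.1.1)) => [x y] [z t] [e f] [e' f'].
by rewrite /=; ring.
Qed.

Lemma sesq_ip H K :
  \sum_(s : T) \sum_t sesq H s t * sesq K s t
  = 2 * Re (\sum_a \sum_b H a b * Num.conj (K a b)) :> R.
Proof.
rewrite sum_mbasis raddf_sum mulr_sumr; apply: eq_bigr => a _ /=.
under eq_bigr => b _ do rewrite sum_mbasis.
rewrite exchange_big raddf_sum mulr_sumr; apply: eq_bigr => c _ /=.
rewrite -(sum_phase2 (H a c) (K a c)); apply: eq_bigr => b _; apply: eq_bigr => b' _.
by rewrite /sesq /cidx -!surjective_pairing.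
Qed.

Definition antiherm H := forall a b, Num.conj (H a b) = - H b a.

Lemma sesqC H (s t : T) : antiherm H -> sesq H s t = - sesq H t s.
Proof.
move=> HA; rewrite /sesq -raddfN -mulrN -HA -[LHS]Re_conj !rmorphM /= conjCK.
by congr Re; rewrite [Num.conj _ * _]mulrC.
Qed.

Definition cskew L := forall a b c, L a b c = - L c b a.

Lemma cyc3C1 L s t r : cskew L -> cyc3 L s t r = - cyc3 L t s r :> R.
Proof.
move=> LA; rewrite /cyc3 -raddfN; congr Im.
rewrite (LA (cidx t) (cidx s)) (LA (cidx s) (cidx r)) (LA (cidx r) (cidx t)).
ring.
Qed.

Lemma cyc3C2 L s t r : cskew L -> cyc3 L s t r = - cyc3 L s r t :> R.
Proof.
move=> LA; rewrite /cyc3 -raddfN; congr Im.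
rewrite (LA (cidx s) (cidx r)) (LA (cidx r) (cidx t)) (LA (cidx t) (cidx s)).
ring.
Qed.

(** A Kaehler form only pairs arguments of opposite type, so contracting by it
    reduces to a contraction of the component of type (2,1). *)
Lemma cyc3_contract L (r : T) : cskew L -> (forall c, \sum_a L a a c = 0) ->
  \sum_s \sum_t sesq (fun a b => 'i%C * (a == b)%:R) s t * cyc3 L s t r = 0 :> R.
Proof.
move=> LA L0; transitivity (- 4 * Re (phase r.1.1 * \sum_a L a a (cidx r))); last first.
  by rewrite L0 mulr0 /= mulr0.
rewrite mulr_sumr raddf_sum mulr_sumr sum_mbasis; apply: eq_bigr => a _ /=.
under eq_bigr => b _ do rewrite sum_mbasis.
rewrite exchange_big (bigD1 a) //= [X in _ + X]big1 ?addr0 => [|c ca].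
  rewrite !big_bool /sesq /cyc3 /cidx -!surjective_pairing /= eqxx.
  rewrite (LA (r.1.2, r.2) a a).
  move: (L _ _ _) (L _ _ _) (phase r.1.1) => [x y] [z t] [e f].
  by rewrite /=; ring.
rewrite big1 // => b _; rewrite big1 // => b' _.
rewrite /sesq /cidx -!surjective_pairing eq_sym (negPf ca) !mulr0.
by rewrite mul0r.
Qed.

(** Summing over the phases kills the mixed products: a term of the first
    three-form only pairs with the term of the second whose free index sits in
    the same slot. *)
Lemma phase_sum4 (h k1 k2 k3 l1 l2 l3 : C) :
  \sum_(b1 : bool) \sum_(b2 : bool) \sum_(b3 : bool) \sum_(b4 : bool)
    Re (phase b1 * Num.conj (phase b2) * h)
    * Im (phase b1 * Num.conj (phase b3) * phase b4 * k1
        + phase b3 * Num.conj (phase b4) * phase b1 * k2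
        + phase b4 * Num.conj (phase b1) * phase b3 * k3)
    * Im (phase b2 * Num.conj (phase b3) * phase b4 * l1
        + phase b3 * Num.conj (phase b4) * phase b2 * l2
        + phase b4 * Num.conj (phase b2) * phase b3 * l3)
  = 4 * Re (Num.conj h * (k1 * Num.conj l1 + k2 * Num.conj l2) + h * (k3 * Num.conj l3)).
Proof.
rewrite !big_bool; case: h k1 k2 k3 l1 l2 l3 => [h h'] [a a'] [b b'] [c c'] [d d'] [e e'] [f f'].
by rewrite /=; ring.
Qed.
End Complexify.

Section Contraction.
Context {R : realType} {p q : nat}.
Local Notation Re := complex.Re.
Local Notation C := (R[i]).
Local Notation cpair := ('I_p * 'I_q)%type.
Local Notation T := (mbasis_index p q).
Implicit Types (H : cpair -> cpair -> C) (L : cpair -> cpair -> cpair -> C).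

Lemma sum_mbasis_out (V : nmodType) (B : finType) (F : B -> T -> V) :
  \sum_b \sum_s F b s = \sum_(a : cpair) \sum_(x : B * bool) F x.1 ((x.2, a.1), a.2).
Proof.
under eq_bigr => b _ do rewrite sum_mbasis.
by rewrite exchange_big; apply: eq_bigr => a _; rewrite pair_big.
Qed.

Lemma sum_mbasis4 (V : nmodType) (G : T -> T -> T -> T -> V) :
  \sum_s1 \sum_s2 \sum_s3 \sum_s4 G s1 s2 s3 s4
  = \sum_(a1 : cpair) \sum_(a2 : cpair) \sum_(a3 : cpair) \sum_(a4 : cpair)
    \sum_(b1 : bool) \sum_(b2 : bool) \sum_(b3 : bool) \sum_(b4 : bool)
     G ((b1, a1.1), a1.2) ((b2, a2.1), a2.2) ((b3, a3.1), a3.2) ((b4, a4.1), a4.2).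
Proof.
rewrite sum_mbasis; apply: eq_bigr => a1 _.
rewrite sum_mbasis_out; apply: eq_bigr => a2 _.
rewrite sum_mbasis_out; apply: eq_bigr => a3 _.
rewrite sum_mbasis_out; apply: eq_bigr => a4 _.
by rewrite !pair_big.
Qed.

Definition contr1 L a b := \sum_c \sum_d L a c d * Num.conj (L b c d).
Definition contr2 L a b := \sum_c \sum_d L c a d * Num.conj (L c b d).

(** The free index of a cyclic sum sits once in each slot. The two linear
    slots give the same contraction by skewness; the antilinear slot gives the
    other one, with [H] in place of its conjugate. *)
Lemma sesq_cyc3_contract H L : cskew L ->
  \sum_(s1 : T) \sum_s2 sesq H s1 s2 * \sum_s3 \sum_s4 cyc3 L s1 s3 s4 * cyc3 L s2 s3 s4
  = 4 * Re (\sum_a \sum_b (2 * (Num.conj (H a b) * contr1 L a b) + H a b * contr2 L a b)) :> R.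
Proof.
move=> LA.
transitivity (\sum_(s1 : T) \sum_(s2 : T) \sum_(s3 : T) \sum_(s4 : T)
    sesq H s1 s2 * cyc3 L s1 s3 s4 * cyc3 L s2 s3 s4).
  apply: eq_bigr => s1 _; apply: eq_bigr => s2 _; rewrite mulr_sumr.
  by apply: eq_bigr => s3 _; rewrite mulr_sumr; apply: eq_bigr => s4 _; rewrite mulrA.
rewrite sum_mbasis4.
transitivity (\sum_(a : cpair) \sum_(b : cpair) \sum_(c : cpair) \sum_(d : cpair)
   4 * Re (Num.conj (H a b) * (L a c d * Num.conj (L b c d) + L a d c * Num.conj (L b d c))
      + H a b * (L d a c * Num.conj (L d b c)))).
  apply: eq_bigr => a _; apply: eq_bigr => b _; apply: eq_bigr => c _; apply: eq_bigr => d _.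
  have -> : L a d c * Num.conj (L b d c) = L c d a * Num.conj (L c d b).
    by rewrite (LA a d c) (LA b d c) rmorphN mulrNN.
  rewrite -phase_sum4; apply: eq_bigr => b1 _; apply: eq_bigr => b2 _.
  apply: eq_bigr => b3 _; apply: eq_bigr => b4 _.
  by rewrite /sesq /cyc3 /cidx -!surjective_pairing.
rewrite raddf_sum mulr_sumr; apply: eq_bigr => a _; rewrite raddf_sum mulr_sumr.
apply: eq_bigr => b _ /=.
transitivity (4 * Re (\sum_c \sum_d (Num.conj (H a b) * (L a c d * Num.conj (L b c d))
    + Num.conj (H a b) * (L a d c * Num.conj (L b d c))
    + H a b * (L d a c * Num.conj (L d b c))))).
  rewrite raddf_sum mulr_sumr; apply: eq_bigr => c _; rewrite raddf_sum mulr_sumr.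
  by apply: eq_bigr => d _; rewrite mulrDr.
congr (_ * Re _).
under eq_bigr => c _ do rewrite !big_split /= -!mulr_sumr.
rewrite !big_split /= -!mulr_sumr /contr1 /contr2.
rewrite [X in _ + _ * X + _]exchange_big /= [X in _ + _ * X = _]exchange_big /=.
ring.
Qed.
End Contraction.

(** * Contractions of tensor products *)

Section TensorSums.
Context {R : realType}.
Local Notation C := (R[i]).

Lemma sum_tensor (I J : finType) (K : pzSemiRingType) (f : I -> I -> K) (g : J -> J -> K)
    (comm : forall a b : K, a * b = b * a) :
  \sum_(a : I * J) \sum_(b : I * J) f a.1 b.1 * g a.2 b.2
  = (\sum_a \sum_b f a b) * (\sum_a \sum_b g a b).
Proof.
rewrite -(pair_big xpredT xpredT (fun i j => \sum_(b : I * J) f i b.1 * g j b.2)) /=.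
rewrite mulr_suml; apply: eq_bigr => i _.
rewrite mulr_sumr; apply: eq_bigr => j _.
rewrite -(pair_big xpredT xpredT (fun i' j' => f i i' * g j j')) /=.
by rewrite mulr_suml; apply: eq_bigr => i' _; rewrite mulr_sumr.
Qed.

Definition pairing (I : finType) (f g : I -> I -> C) : C :=
  \sum_a \sum_b f a b * Num.conj (g a b).

Lemma pairing_tensor (I J : finType) (A k : C) (f1 f2 f1' f2' : I -> I -> C)
    (g1 g2 g1' g2' : J -> J -> C) : Num.conj A = A -> Num.conj k = k ->
  let L (f1 f2 : I -> I -> C) (g1 g2 : J -> J -> C) (c d : I * J) :=
    A * (f1 c.1 d.1 * g1 c.2 d.2 - f2 c.1 d.1 * g2 c.2 d.2)
    + k * (f1 c.1 d.1 * g2 c.2 d.2 - f2 c.1 d.1 * g1 c.2 d.2) in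
  let F11 := pairing f1 f1' in let F12 := pairing f1 f2' in
  let F21 := pairing f2 f1' in let F22 := pairing f2 f2' in
  let G11 := pairing g1 g1' in let G12 := pairing g1 g2' in
  let G21 := pairing g2 g1' in let G22 := pairing g2 g2' in
  \sum_c \sum_d L f1 f2 g1 g2 c d * Num.conj (L f1' f2' g1' g2' c d)
  = A ^+ 2 * (F11 * G11 - F12 * G12 - F21 * G21 + F22 * G22)
    + A * k * (F11 * G12 - F12 * G11 - F21 * G22 + F22 * G21)
    + A * k * (F11 * G21 - F12 * G22 - F21 * G11 + F22 * G12)
    + k ^+ 2 * (F11 * G22 - F12 * G21 - F21 * G12 + F22 * G11).
Proof.
move=> AJ kJ L F11 F12 F21 F22 G11 G12 G21 G22.
pose tens (f f' : I -> I -> C) (g g' : J -> J -> C) (c d : I * J) :=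
  (f c.1 d.1 * Num.conj (f' c.1 d.1)) * (g c.2 d.2 * Num.conj (g' c.2 d.2)).
have tensE f f' g g' : \sum_c \sum_d tens f f' g g' c d = pairing f f' * pairing g g'.
  exact: (sum_tensor (fun a b => f a b * Num.conj (f' a b))
    (fun a b => g a b * Num.conj (g' a b)) (@mulrC _)).
rewrite /F11 /F12 /F21 /F22 /G11 /G12 /G21 /G22 -!tensE.
pose S (H : I * J -> I * J -> C) := \sum_c \sum_d H c d.
have SD H K : S H + S K = S (fun c d => H c d + K c d).
  by rewrite /S -big_split; apply: eq_bigr => c _; rewrite -big_split.
have SN H : - S H = S (fun c d => - H c d).
  by rewrite /S -sumrN; apply: eq_bigr => c _; rewrite -sumrN.
have SM a H : a * S H = S (fun c d => a * H c d).
  by rewrite /S mulr_sumr; apply: eq_bigr => c _; rewrite mulr_sumr.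
rewrite -!/(S _) !(SN, SD, SM).
apply: eq_bigr => c _; apply: eq_bigr => d _; rewrite /L /tens.
rewrite !(rmorphD, rmorphN, rmorphM) /= AJ kJ.
move: (f1 _ _) (f2 _ _) (Num.conj (f1' _ _)) (Num.conj (f2' _ _)) => a1 a2 a3 a4.
move: (g1 _ _) (g2 _ _) (Num.conj (g1' _ _)) (Num.conj (g2' _ _)) => b1 b2 b3 b4.
ring.
Qed.

Section Vectors.
Variables (k : nat) (x : 'I_k -> C).
Let X := nrm2 x.

(** On each of the two factors of [m], the tensor of [d e_X] is built from
    these two. *)
Definition ten1 (a c d : 'I_k) : C := Num.conj (x a) * (c == d)%:R.
Definition ten2 (a c d : 'I_k) : C := Num.conj (x d) * (c == a)%:R.

Let nat_conj (b : bool) : Num.conj (b%:R : C) = b%:R.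
Proof. exact: rmorph_nat. Qed.

Lemma sum_deltar (j : 'I_k) (F : 'I_k -> C) : \sum_i F i * (i == j)%:R = F j.
Proof.
by rewrite -[RHS](sum_delta j); apply: eq_bigr => i _; rewrite mulrC eq_sym.
Qed.

Lemma pairing11 a b : pairing (ten1 a) (ten1 b) = k%:R * (Num.conj (x a) * x b).
Proof.
transitivity (\sum_(c < k) Num.conj (x a) * x b); last first.
  by rewrite sumr_const card_ord mulr_natl.
apply: eq_bigr => c _; rewrite -(sum_delta c (fun=> Num.conj (x a) * x b)).
apply: eq_bigr => d _; rewrite /ten1 rmorphM /= conjCK nat_conj.
by case: (c == d); rewrite ?(mulr1, mul1r, mulr0, mul0r).
Qed.

Lemma pairing12 a b : pairing (ten1 a) (ten2 b) = Num.conj (x a) * x b.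
Proof.
rewrite -(sum_deltar b (fun=> Num.conj (x a) * x b)); apply: eq_bigr => c _.
rewrite -(sum_delta c (fun=> _ * (c == b)%:R)); apply: eq_bigr => d _.
rewrite /ten1 /ten2 rmorphM /= conjCK nat_conj.
case: (c =P d) => [<-|_]; last by rewrite mulr0 !mul0r.
by case: (c =P b) => [->|_]; rewrite ?(mulr1, mul1r, mulr0, mul0r).
Qed.

Lemma pairingC (f g : 'I_k -> 'I_k -> C) : pairing g f = Num.conj (pairing f g).
Proof.
rewrite /pairing rmorph_sum; apply: eq_bigr => a _; rewrite rmorph_sum.
by apply: eq_bigr => b _; rewrite rmorphM /= conjCK mulrC.
Qed.

Lemma pairing21 a b : pairing (ten2 a) (ten1 b) = Num.conj (x a) * x b.
Proof. by rewrite pairingC pairing12 rmorphM /= conjCK mulrC. Qed.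

Lemma pairing22 a b : pairing (ten2 a) (ten2 b) = X * (a == b)%:R.
Proof.
transitivity (\sum_c X * (c == b)%:R * (c == a)%:R); last first.
  by rewrite (sum_deltar a (fun c => X * (c == b)%:R)).
apply: eq_bigr => c _; rewrite /X /nrm2 !mulr_suml; apply: eq_bigr => d _.
rewrite /ten2 rmorphM /= conjCK nat_conj.
by move: (x d) (Num.conj (x d)) ((c == a)%:R : C) ((c == b)%:R : C) => *; ring.
Qed.

(** Exchanging the first two arguments serves the contraction in the
    antilinear slot. *)
Lemma pairing11' a b : pairing (fun c => ten1 c a) (fun c => ten1 c b) = X * (a == b)%:R.
Proof.
rewrite mulr_suml; apply: eq_bigr => c _.
rewrite -(sum_delta a (fun d => x c * Num.conj (x c) * (d == b)%:R)); apply: eq_bigr => d _.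
rewrite /ten1 rmorphM /= conjCK nat_conj [b == d]eq_sym.
by move: (x c) (Num.conj (x c)) ((a == d)%:R : C) ((d == b)%:R : C) => *; ring.
Qed.

Lemma pairing12' a b : pairing (fun c => ten1 c a) (fun c => ten2 c b) = Num.conj (x b) * x a.
Proof.
rewrite -(sum_delta b (fun c => Num.conj (x c) * x a)); apply: eq_bigr => c _.
rewrite -(sum_delta a (fun d => _ * (Num.conj (x c) * x d))); apply: eq_bigr => d _.
rewrite /ten1 /ten2 rmorphM /= conjCK nat_conj.
by move: (x d) (Num.conj (x c)) ((a == d)%:R : C) ((b == c)%:R : C) => *; ring.
Qed.

Lemma pairing21' a b : pairing (fun c => ten2 c a) (fun c => ten1 c b) = Num.conj (x b) * x a.
Proof. by rewrite pairingC pairing12' rmorphM /= conjCK mulrC. Qed.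

Lemma pairing22' a b : pairing (fun c => ten2 c a) (fun c => ten2 c b) = X * (a == b)%:R.
Proof.
transitivity (\sum_c (a == c)%:R * (X * (c == b)%:R)).
  apply: eq_bigr => c _; rewrite /X /nrm2 !(mulr_suml, mulr_sumr); apply: eq_bigr => d _.
  rewrite /ten2 rmorphM /= conjCK nat_conj [b == c]eq_sym.
  by move: (x d) (Num.conj (x d)) ((a == c)%:R : C) ((c == b)%:R : C) => *; ring.
by rewrite (sum_delta a (fun c => X * (c == b)%:R)).
Qed.
End Vectors.
End TensorSums.

Section Evaluate.
Context {R : realType} {p q : nat}.
Local Notation C := (R[i]).
Local Notation cpair := ('I_p * 'I_q)%type.
Local Notation alpha := (@alpha R q).
Local Notation beta := (@beta R p).
Local Notation kappa := (@kappa R p q).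

Definition outer k (x : 'I_k -> C) (a b : 'I_k) : C := Num.conj (x a) * x b.
Definition delta k (a b : 'I_k) : C := (a == b)%:R.
Definition dot k (f g : 'I_k -> 'I_k -> C) : C := \sum_a \sum_b f a b * g a b.

Definition htensor (k1 k2 c c' : C) (f : 'I_p -> 'I_p -> C) (g : 'I_q -> 'I_q -> C)
    (a b : cpair) : C :=
  k1 * (f a.1 b.1 - c * delta a.1 b.1) * delta a.2 b.2
  + k2 * delta a.1 b.1 * (g a.2 b.2 - c' * delta a.2 b.2).

Definition ntensor (n1 n2 n3 n4 : C) (f : 'I_p -> 'I_p -> C) (g : 'I_q -> 'I_q -> C)
    (a b : cpair) : C :=
  n1 * f a.1 b.1 * delta a.2 b.2 + n2 * delta a.1 b.1 * g a.2 b.2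
  + n3 * f a.1 b.1 * g a.2 b.2 + n4 * delta a.1 b.1 * delta a.2 b.2.

Lemma dot_delta2 k : dot (@delta k) (@delta k) = k%:R.
Proof.
transitivity (\sum_(a < k) (1 : C)); last by rewrite sumr_const card_ord.
apply: eq_bigr => a _; rewrite -(sum_delta a (fun=> 1)).
by apply: eq_bigr => b _; rewrite /delta; case: eqP => _; rewrite !(mulr1, mulr0).
Qed.

(** Both factors of the first tensor are trace-free, so each of them only
    pairs with the terms of the second that are not scalar on that factor. *)
Lemma contract_tensor (k1 k2 c c' n1 n2 n3 n4 X Y : C)
    (f f' : 'I_p -> 'I_p -> C) (g g' : 'I_q -> 'I_q -> C) :
    dot f f' = X ^+ 2 -> dot f (@delta p) = X -> dot (@delta p) f' = X ->
    dot g g' = Y ^+ 2 -> dot g (@delta q) = Y -> dot (@delta q) g' = Y ->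
    c * p%:R = X -> c' * q%:R = Y ->
  \sum_a \sum_b htensor k1 k2 c c' f g a b * ntensor n1 n2 n3 n4 f' g' a b
  = k1 * (X ^+ 2 - c * X) * (n1 * q%:R + n3 * Y)
    + k2 * (Y ^+ 2 - c' * Y) * (n2 * p%:R + n3 * X).
Proof.
move=> ff fd df gg gd dg cX cY.
pose tens (h h' : 'I_p -> 'I_p -> C) (l l' : 'I_q -> 'I_q -> C) (a b : cpair) :=
  (h a.1 b.1 * h' a.1 b.1) * (l a.2 b.2 * l' a.2 b.2).
have tensE h h' l l' : \sum_a \sum_b tens h h' l l' a b = dot h h' * dot l l'.
  exact: (sum_tensor (fun a b => h a b * h' a b) (fun a b => l a b * l' a b) (@mulrC _)).
pose S (H : cpair -> cpair -> C) := \sum_a \sum_b H a b.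
have SD H K : S H + S K = S (fun a b => H a b + K a b).
  by rewrite /S -big_split; apply: eq_bigr => a _; rewrite -big_split.
have SM e H : e * S H = S (fun a b => e * H a b).
  by rewrite /S mulr_sumr; apply: eq_bigr => a _; rewrite mulr_sumr.
have dp := dot_delta2 p; have dq := dot_delta2 q.
set dP := @delta p in ff fd df dp *; set dQ := @delta q in gg gd dg dq *.
transitivity (
    k1 * n1 * (S (tens f f' dQ dQ) + (- c) * S (tens dP f' dQ dQ))
  + k1 * n2 * (S (tens f dP dQ g') + (- c) * S (tens dP dP dQ g'))
  + k1 * n3 * (S (tens f f' dQ g') + (- c) * S (tens dP f' dQ g'))
  + k1 * n4 * (S (tens f dP dQ dQ) + (- c) * S (tens dP dP dQ dQ))
  + k2 * n1 * (S (tens dP f' g dQ) + (- c') * S (tens dP f' dQ dQ))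
  + k2 * n2 * (S (tens dP dP g g') + (- c') * S (tens dP dP dQ g'))
  + k2 * n3 * (S (tens dP f' g g') + (- c') * S (tens dP f' dQ g'))
  + k2 * n4 * (S (tens dP dP g dQ) + (- c') * S (tens dP dP dQ dQ))).
  rewrite !(SM, SD); apply: eq_bigr => a _; apply: eq_bigr => b _.
  rewrite /htensor /ntensor /tens -/dP -/dQ.
  move: (f _ _) (f' _ _) (g _ _) (g' _ _) (dP _ _) (dQ _ _) => a1 a2 a3 a4 a5 a6.
  ring.
rewrite /S !tensE ff fd df gg gd dg dp dq -cX -cY.
ring.
Qed.

Lemma dot_outer k (x : 'I_k -> C) : dot (fun a b => outer x b a) (outer x) = nrm2 x ^+ 2.
Proof.
rewrite expr2 {1}/nrm2 mulr_suml; apply: eq_bigr => a _.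
rewrite /nrm2 mulr_sumr; apply: eq_bigr => b _; rewrite /outer.
by move: (x a) (x b) => s t; move: (Num.conj s) (Num.conj t) => *; ring.
Qed.

Lemma dotC k (f g : 'I_k -> 'I_k -> C) : dot f g = dot g f.
Proof. by apply: eq_bigr => a _; apply: eq_bigr => b _; rewrite mulrC. Qed.

Lemma dot_outer_delta k (x : 'I_k -> C) : dot (outer x) (@delta k) = nrm2 x.
Proof.
apply: eq_bigr => a _; rewrite -(sum_delta a (fun b => x a * Num.conj (x b))).
apply: eq_bigr => b _; rewrite /outer /delta.
by case: (a =P b) => [->|_]; rewrite ?(mulr1, mul1r, mulr0, mul0r) // mulrC.
Qed.

Lemma dot_outer_delta' k (x : 'I_k -> C) : dot (fun a b => outer x b a) (@delta k) = nrm2 x.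
Proof.
rewrite /dot exchange_big -[RHS]dot_outer_delta; apply: eq_bigr => a _.
by apply: eq_bigr => b _; rewrite /delta eq_sym.
Qed.

Section Data.
Variables (x : 'I_p -> C) (z : 'I_q -> C).
Hypotheses (p0 : (0 < p)%N) (q0 : (0 < q)%N).
Let y j := Num.conj (z j).
Let A : C := (alpha + beta)%:C%C.
Let K : C := kappa%:C%C.
Let X := nrm2 x.
Let Y := nrm2 z.

Let conj_real (r : R) : Num.conj (r%:C%C : C) = r%:C%C.
Proof. exact: conjc_real. Qed.

Let nrm2y : nrm2 y = Y.
Proof. by apply: eq_bigr => j _; rewrite /y conjCK mulrC. Qed.

Lemma dtens_ten s t r : dtens x z s t r
  = A * (ten1 x s.1 t.1 r.1 * ten2 y s.2 t.2 r.2 - ten2 x s.1 t.1 r.1 * ten1 y s.2 t.2 r.2)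
    + K * (ten1 x s.1 t.1 r.1 * ten1 y s.2 t.2 r.2 - ten2 x s.1 t.1 r.1 * ten2 y s.2 t.2 r.2).
Proof.
case: s t r => [s1 s2] [t1 t2] [r1 r2].
rewrite /dtens /quad /ten1 /ten2 /y /= !conjCK !xpair_eqE -!mulnb !natrM.
rewrite [r2 == t2]eq_sym [s2 == t2]eq_sym [r1 == t1]eq_sym [s1 == t1]eq_sym -/A -/K.
move: ((t1 == r1)%:R : C) ((t1 == s1)%:R : C) ((t2 == r2)%:R : C) ((t2 == s2)%:R : C).
by move: (z s2) (z r2) (Num.conj (x s1)) (Num.conj (x r1)) => *; ring.
Qed.

Lemma cskew_dtens : cskew (dtens x z).
Proof.
move=> s t r; rewrite /dtens [r == t]eq_sym [s == t]eq_sym.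
move: (quad _ _ _ _ _) (quad _ _ _ _ _) ((t == r)%:R : C) ((t == s)%:R : C) => *.
ring.
Qed.

(** This identity determines the ratio of [alpha] and [beta], that is, the two
    coefficients in the definition of [e_X] up to a common factor. *)
Lemma A_kappa : A * (q%:R - p%:R) = K * (p%:R * q%:R - 1).
Proof.
have key : (alpha + beta) * (q%:R - p%:R) = kappa * (p%:R * q%:R - 1) :> R.
  rewrite /kappa /alpha /beta.
  have pn0 : p%:R != 0 :> R by rewrite pnatr_eq0 -lt0n.
  have qn0 : q%:R != 0 :> R by rewrite pnatr_eq0 -lt0n.
  move: (p%:R : R) (q%:R : R) pn0 qn0 => a b a0 b0.
  by field; rewrite a0 b0.
have := congr1 (real_complex R) key.
rewrite [LHS]rmorphM [RHS]rmorphM rmorphB [X in _ = _ * X -> _]rmorphB rmorphM !rmorph_nat rmorph1.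
exact.
Qed.

(** The contraction of [d e_X] by the Kaehler form vanishes: [e_X] is
    divergence-free. *)
Lemma dtens_trace r : \sum_a dtens x z a a r = 0.
Proof.
pose b : C := z r.2 * Num.conj (x r.1).
have sumpair (F : 'I_p -> 'I_q -> C) : \sum_(a : cpair) F a.1 a.2 = \sum_i \sum_j F i j.
  by rewrite pair_big.
transitivity (A * (q%:R * b - p%:R * b) + K * (b - p%:R * q%:R * b)); last first.
  transitivity ((A * (q%:R - p%:R) + K * (1 - p%:R * q%:R)) * b); first by ring.
  by rewrite A_kappa; ring.
have E1 : \sum_a quad x z a a r = q%:R * b.
  rewrite (sumpair (fun i j => (j == j)%:R * (i == r.1)%:R * (z r.2 * Num.conj (x i)))).
  rewrite exchange_big (eq_bigr (fun=> b)) => [|j _].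
    by rewrite sumr_const card_ord mulr_natl.
  rewrite eqxx -[RHS](sum_delta r.1 (fun i => z r.2 * Num.conj (x i))).
  by apply: eq_bigr => i _; rewrite mul1r eq_sym.
have E2 : \sum_a quad x z r a a = p%:R * b.
  rewrite (sumpair (fun i j => (r.2 == j)%:R * (i == i)%:R * (z j * Num.conj (x r.1)))).
  rewrite (eq_bigr (fun=> b)) => [|i _].
    by rewrite sumr_const card_ord mulr_natl.
  rewrite eqxx -[RHS](sum_delta r.2 (fun j => z j * Num.conj (x r.1))).
  by apply: eq_bigr => j _; rewrite mulr1.
have E3 : \sum_(a : cpair) (r == a)%:R * (z a.2 * Num.conj (x a.1)) = b.
  exact: (sum_delta r (fun a : cpair => z a.2 * Num.conj (x a.1))).
have E4 : \sum_(a : cpair) (a == a)%:R * b = p%:R * q%:R * b.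
  rewrite (eq_bigr (fun=> b)) => [|a _]; last by rewrite eqxx mul1r.
  by rewrite sumr_const card_prod !card_ord -[LHS]mulr_natl natrM.
rewrite -E1 -E2 -{1}E3 -E4 -!sumrB !mulr_sumr -big_split; apply: eq_bigr => a _.
by [].
Qed.

Let k1 : C := (2 * alpha)%:C%C.
Let k2 : C := (2 * beta)%:C%C.
Let c : C := X / p%:R.
Let c' : C := Y / q%:R.

Lemma htens_htensor a b : htens x z a b = htensor k1 k2 c c' (outer x) (outer y) a b.
Proof.
rewrite /htens /htensor /outer /delta /y conjCK -/k1 -/k2 -/X -/Y -/c -/c'.
move: ((a.1 == b.1)%:R : C) ((a.2 == b.2)%:R : C) (Num.conj (x a.1)) (Num.conj (z b.2)) => *.
ring.
Qed.

Let nrm2_conj k (w : 'I_k -> C) : Num.conj (nrm2 w) = nrm2 w.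
Proof.
by rewrite /nrm2 rmorph_sum; apply: eq_bigr => i _; rewrite rmorphM /= conjCK mulrC.
Qed.

Let nat_conj k : Num.conj (k%:R : C) = k%:R.
Proof. exact: rmorph_nat. Qed.

Lemma conj_htens a b : Num.conj (htens x z a b)
  = htensor k1 k2 c c' (fun a b => outer x b a) (fun a b => outer y b a) a b.
Proof.
rewrite htens_htensor /htensor /outer /delta /c /c' /y !(rmorphD, rmorphN, rmorphM) /=.
rewrite !fmorphV /= !nat_conj !conjCK !nrm2_conj !conj_real -/k1 -/k2 -/X -/Y.
move: (x a.1) (Num.conj (x b.1)) (Num.conj (z a.2)) (z b.2) => ? ? ? ?.
by move: k1 k2 X Y ((a.1 == b.1)%:R : C) ((a.2 == b.2)%:R : C) => *; ring.
Qed.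

Lemma antiherm_ihtens : antiherm (fun a b => 'i%C * htens x z a b).
Proof.
move=> a b; rewrite rmorphM /= conj_htens htens_htensor /htensor /delta.
rewrite [b.1 == a.1]eq_sym [b.2 == a.2]eq_sym.
have -> : Num.conj ('i%C : C) = - 'i%C by rewrite /=; congr (_ +i* _)%C; rewrite oppr0.
by rewrite mulNr.
Qed.

Let cX : c * p%:R = X.
Proof. by rewrite /c divfK // pnatr_eq0 -lt0n. Qed.

Let cY : c' * q%:R = Y.
Proof. by rewrite /c' divfK // pnatr_eq0 -lt0n. Qed.

(** [e_X] is primitive because the blocks of [twist] are trace-free. *)
Lemma htens_trace : \sum_a htens x z a a = 0.
Proof.
transitivity (\sum_(a : cpair) (k1 * (x a.1 * Num.conj (x a.1) - c)
    + k2 * (z a.2 * Num.conj (z a.2) - c'))).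
  apply: eq_bigr => a _; rewrite /htens !eqxx !mulr1n -/k1 -/k2 -/X -/Y -/c -/c'.
  by move: (x a.1 * _) (z a.2 * _) => ? ?; ring.
have E1 : \sum_(a : cpair) (x a.1 * Num.conj (x a.1) - c) = 0.
  rewrite -(pair_big xpredT xpredT (fun i (j : 'I_q) => x i * Num.conj (x i) - c)) /=.
  rewrite exchange_big big1 // => j _.
  rewrite sumrB -/(nrm2 x) sumr_const card_ord -[c *+ _]mulr_natr cX.
  exact: subrr.
have E2 : \sum_(a : cpair) (z a.2 * Num.conj (z a.2) - c') = 0.
  rewrite -(pair_big xpredT xpredT (fun (i : 'I_p) j => z j * Num.conj (z j) - c')) /=.
  rewrite big1 // => i _.
  rewrite sumrB -/(nrm2 z) sumr_const card_ord -[c' *+ _]mulr_natr cY.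
  exact: subrr.
by rewrite big_split /= -!mulr_sumr E1 E2 !mulr0 addr0.
Qed.

Lemma contr1_dtens a b : contr1 (dtens x z) a b
  = ntensor (A ^+ 2 * p%:R * Y - 2 * A * K * Y) (A ^+ 2 * q%:R * X + 2 * A * K * X)
     (- 2 * A ^+ 2 + 2 * A * K * (p%:R - q%:R) + K ^+ 2 * (p%:R * q%:R - 2))
     (K ^+ 2 * X * Y) (outer x) (outer y) a b.
Proof.
rewrite /contr1; under eq_bigr => s _ do under eq_bigr => t _ do rewrite !dtens_ten.
rewrite (pairing_tensor (ten1 x a.1) (ten2 x a.1) (ten1 x b.1) (ten2 x b.1)
  (ten2 y a.2) (ten1 y a.2) (ten2 y b.2) (ten1 y b.2) (conj_real _) (conj_real _)).
rewrite !pairing11 !pairing12 !pairing21 !pairing22 nrm2y -/X -/(outer x _ _) -/(outer y _ _).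
rewrite /ntensor /delta -/A -/K.
move: (outer x _ _) (outer y _ _) ((_ == _)%:R : C) ((_ == _)%:R : C) (p%:R : C) (q%:R : C).
by move: A K X Y => *; ring.
Qed.

Lemma contr2_dtens a b : contr2 (dtens x z) a b
  = ntensor (- 4 * A * K * Y) (4 * A * K * X) (- 2 * (A ^+ 2 + K ^+ 2))
     (2 * (A ^+ 2 + K ^+ 2) * X * Y)
     (fun a b => outer x b a) (fun a b => outer y b a) a b.
Proof.
rewrite /contr2; under eq_bigr => s _ do under eq_bigr => t _ do rewrite !dtens_ten.
rewrite (pairing_tensor (fun c => ten1 x c a.1) (fun c => ten2 x c a.1)
  (fun c => ten1 x c b.1) (fun c => ten2 x c b.1)
  (fun c => ten2 y c a.2) (fun c => ten1 y c a.2)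
  (fun c => ten2 y c b.2) (fun c => ten1 y c b.2) (conj_real _) (conj_real _)).
rewrite !pairing11' !pairing12' !pairing21' !pairing22' nrm2y -/X -/(outer x _ _) -/(outer y _ _).
rewrite /ntensor /delta -/A -/K.
move: (outer x _ _) (outer y _ _) ((_ == _)%:R : C) ((_ == _)%:R : C).
by move: A K X Y => *; ring.
Qed.

(** The two terms of the integrand of [Psi], up to constants; they depend on
    the blocks [x] and [z] only through their norms. *)
Definition derivative_term : C :=
  k1 * (X ^+ 2 - c * X) * Y * (2 * (A ^+ 2 * (p%:R * q%:R - 3)
      + 2 * A * K * (p%:R - 3 * q%:R) + K ^+ 2 * (p%:R * q%:R - 3)))
  + k2 * (Y ^+ 2 - c' * Y) * X * (2 * (A ^+ 2 * (p%:R * q%:R - 3)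
      + 2 * A * K * (3 * p%:R - q%:R) + K ^+ 2 * (p%:R * q%:R - 3))).

Definition algebraic_term : C :=
  k1 ^+ 3 * q%:R * (X ^+ 2 - c * X) * (X - 2 * c)
  + k2 ^+ 3 * p%:R * (Y ^+ 2 - c' * Y) * (Y - 2 * c').

Lemma sum_contr : \sum_a \sum_b (2 * (Num.conj (htens x z a b) * contr1 (dtens x z) a b)
     + htens x z a b * contr2 (dtens x z) a b) = derivative_term.
Proof.
have yy : dot (outer y) (@delta q) = Y by rewrite dot_outer_delta nrm2y.
have yy' : dot (fun a b => outer y b a) (@delta q) = Y by rewrite dot_outer_delta' nrm2y.
have y2 : dot (fun a b => outer y b a) (outer y) = Y ^+ 2 by rewrite dot_outer nrm2y.
have S1 : \sum_a \sum_b Num.conj (htens x z a b) * contr1 (dtens x z) a b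
  = k1 * (X ^+ 2 - c * X) * ((A ^+ 2 * p%:R * Y - 2 * A * K * Y) * q%:R
       + (- 2 * A ^+ 2 + 2 * A * K * (p%:R - q%:R) + K ^+ 2 * (p%:R * q%:R - 2)) * Y)
    + k2 * (Y ^+ 2 - c' * Y) * ((A ^+ 2 * q%:R * X + 2 * A * K * X) * p%:R
       + (- 2 * A ^+ 2 + 2 * A * K * (p%:R - q%:R) + K ^+ 2 * (p%:R * q%:R - 2)) * X).
  rewrite -(contract_tensor k1 k2 _ _ _ (K ^+ 2 * X * Y) (dot_outer x) (dot_outer_delta' x)
    (etrans (dotC _ _) (dot_outer_delta x)) y2 yy' (etrans (dotC _ _) yy) cX cY).
  by apply: eq_bigr => a _; apply: eq_bigr => b _; rewrite conj_htens contr1_dtens.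
have S2 : \sum_a \sum_b htens x z a b * contr2 (dtens x z) a b
  = k1 * (X ^+ 2 - c * X) * ((- 4 * A * K * Y) * q%:R + (- 2 * (A ^+ 2 + K ^+ 2)) * Y)
    + k2 * (Y ^+ 2 - c' * Y) * ((4 * A * K * X) * p%:R + (- 2 * (A ^+ 2 + K ^+ 2)) * X).
  rewrite -(contract_tensor k1 k2 _ _ _ (2 * (A ^+ 2 + K ^+ 2) * X * Y)
    (etrans (dotC _ _) (dot_outer x)) (dot_outer_delta x)
    (etrans (dotC _ _) (dot_outer_delta' x)) (etrans (dotC _ _) y2) yy
    (etrans (dotC _ _) yy') cX cY).
  by apply: eq_bigr => a _; apply: eq_bigr => b _; rewrite htens_htensor contr2_dtens.
under eq_bigr => a _ do rewrite big_split -mulr_sumr /=.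
rewrite big_split -mulr_sumr /= S1 S2 /derivative_term.
by move: k1 k2 c c' X Y A K (p%:R : C) (q%:R : C) => *; ring.
Qed.

(** The square of a rank-one matrix is a multiple of it. *)
Lemma outer_sqr k (w : 'I_k -> C) (e : C) a b :
  \sum_i (outer w a i - e * delta a i) * (outer w i b - e * delta i b)
  = (nrm2 w - 2 * e) * outer w a b + e ^+ 2 * delta a b.
Proof.
transitivity (\sum_i (outer w a b * (w i * Num.conj (w i)))
   - e * (\sum_i outer w a i * (i == b)%:R) - e * (\sum_i (a == i)%:R * outer w i b)
   + e ^+ 2 * \sum_i (a == i)%:R * (i == b)%:R).
  rewrite !mulr_sumr -!sumrB -big_split; apply: eq_bigr => i _.
  rewrite /outer /delta /=.
  move: (w i) (Num.conj (w i)) (Num.conj (w a)) (w b) => ? ? ? ?.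
  by move: ((a == i)%:R : C) ((i == b)%:R : C) => *; ring.
rewrite -mulr_sumr -/(nrm2 w) sum_deltar sum_delta sum_delta /delta.
by move: (outer w a b) (nrm2 w) ((a == b)%:R : C) => *; ring.
Qed.

Lemma htens_sqr a b : \sum_d htens x z a d * htens x z d b
  = ntensor (k1 ^+ 2 * (X - 2 * c) - 2 * k1 * k2 * c')
      (k2 ^+ 2 * (Y - 2 * c') - 2 * k1 * k2 * c) (2 * k1 * k2)
      (k1 ^+ 2 * c ^+ 2 + 2 * k1 * k2 * c * c' + k2 ^+ 2 * c' ^+ 2)
      (outer x) (outer y) a b.
Proof.
pose u i j : C := outer x i j - c * delta i j.
pose w i j : C := outer y i j - c' * delta i j.
have sumpair (F : 'I_p -> 'I_q -> C) : \sum_(d : cpair) F d.1 d.2 = \sum_i \sum_j F i j.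
  by rewrite pair_big.
transitivity (k1 ^+ 2 * ((\sum_i u a.1 i * u i b.1) * delta a.2 b.2)
   + 2 * k1 * k2 * (u a.1 b.1 * w a.2 b.2)
   + k2 ^+ 2 * (delta a.1 b.1 * (\sum_j w a.2 j * w j b.2))); last first.
  rewrite /u /w !outer_sqr nrm2y -/X /ntensor.
  move: (outer x _ _) (outer y _ _) (delta _ _) (delta _ _) => *.
  by move: k1 k2 X Y c c' => *; ring.
have tens (f f' : 'I_p -> C) (g g' : 'I_q -> C) :
  \sum_(d : cpair) (f d.1 * f' d.1) * (g d.2 * g' d.2)
    = (\sum_i f i * f' i) * (\sum_j g j * g' j).
  rewrite (sumpair (fun i j => (f i * f' i) * (g j * g' j))) mulr_suml.
  by apply: eq_bigr => i _; rewrite mulr_sumr.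
have dl k (i : 'I_k) (f : 'I_k -> C) : \sum_j delta i j * f j = f i by exact: sum_delta.
have dr k (i : 'I_k) (f : 'I_k -> C) : \sum_j f j * delta j i = f i by exact: sum_deltar.
have T1 : (\sum_i u a.1 i * u i b.1) * delta a.2 b.2
    = \sum_d (u a.1 d.1 * u d.1 b.1) * (delta a.2 d.2 * delta d.2 b.2).
  by rewrite (tens (u a.1) (u^~ b.1) (delta a.2) ((@delta q)^~ b.2)) dl.
have T2 : u a.1 b.1 * w a.2 b.2
    = \sum_d (u a.1 d.1 * delta d.1 b.1) * (delta a.2 d.2 * w d.2 b.2).
  by rewrite (tens (u a.1) ((@delta p)^~ b.1) (delta a.2) (w^~ b.2)) dl dr.
have T3 : u a.1 b.1 * w a.2 b.2
    = \sum_d (delta a.1 d.1 * u d.1 b.1) * (w a.2 d.2 * delta d.2 b.2).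
  by rewrite (tens (delta a.1) (u^~ b.1) (w a.2) ((@delta q)^~ b.2)) dl dr.
have T4 : delta a.1 b.1 * (\sum_j w a.2 j * w j b.2)
    = \sum_d (delta a.1 d.1 * delta d.1 b.1) * (w a.2 d.2 * w d.2 b.2).
  by rewrite (tens (delta a.1) ((@delta p)^~ b.1) (w a.2) (w^~ b.2)) dl.
rewrite T1 T4.
transitivity (k1 ^+ 2 * (\sum_d (u a.1 d.1 * u d.1 b.1) * (delta a.2 d.2 * delta d.2 b.2))
   + k1 * k2 * (\sum_d (u a.1 d.1 * delta d.1 b.1) * (delta a.2 d.2 * w d.2 b.2))
   + k1 * k2 * (\sum_d (delta a.1 d.1 * u d.1 b.1) * (w a.2 d.2 * delta d.2 b.2))
   + k2 ^+ 2 * (\sum_d (delta a.1 d.1 * delta d.1 b.1) * (w a.2 d.2 * w d.2 b.2))).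
  rewrite !mulr_sumr -!big_split; apply: eq_bigr => d _.
  rewrite !htens_htensor /htensor -/(u _ _) -/(u _ _) -/(w _ _) -/(w _ _).
  move: (u _ _) (u _ _) (w _ _) (w _ _) => ? ? ? ?.
  by move: (delta _ _) (delta _ _) (delta _ _) (delta _ _) => ? ? ? ? /=; ring.
rewrite -T2 -T3; move: (_ * \sum_d _) (_ * \sum_d _) (u _ _ * w _ _) => *.
ring.
Qed.

Lemma htens_cube :
  \sum_a \sum_b (\sum_d htens x z a d * htens x z d b) * Num.conj (htens x z a b) = algebraic_term.
Proof.
have yy : dot (outer y) (@delta q) = Y by rewrite dot_outer_delta nrm2y.
have yy' : dot (fun a b => outer y b a) (@delta q) = Y by rewrite dot_outer_delta' nrm2y.
have y2 : dot (fun a b => outer y b a) (outer y) = Y ^+ 2 by rewrite dot_outer nrm2y.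
have := contract_tensor k1 k2 (k1 ^+ 2 * (X - 2 * c) - 2 * k1 * k2 * c')
      (k2 ^+ 2 * (Y - 2 * c') - 2 * k1 * k2 * c) (2 * k1 * k2)
      (k1 ^+ 2 * c ^+ 2 + 2 * k1 * k2 * c * c' + k2 ^+ 2 * c' ^+ 2) (dot_outer x) (dot_outer_delta' x)
    (etrans (dotC _ _) (dot_outer_delta x)) y2 yy' (etrans (dotC _ _) yy) cX cY.
move=> E; transitivity (k1 * (X ^+ 2 - c * X) * ((k1 ^+ 2 * (X - 2 * c) - 2 * k1 * k2 * c') * q%:R
    + 2 * k1 * k2 * (c' * q%:R))
  + k2 * (Y ^+ 2 - c' * Y) * ((k2 ^+ 2 * (Y - 2 * c') - 2 * k1 * k2 * c) * p%:R
    + 2 * k1 * k2 * (c * p%:R))).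
  rewrite cX cY -E; apply: eq_bigr => a _; apply: eq_bigr => b _.
  by rewrite htens_sqr conj_htens mulrC.
rewrite /algebraic_term.
by move: k1 k2 X Y c c' (p%:R : C) (q%:R : C) => *; ring.
Qed.
End Data.
End Evaluate.

(** * The two terms of the integrand *)

Section Integrands.
Context {R : realType} {p q : nat}.
Local Notation C := (R[i]).
Local Notation Re := complex.Re.
Local Notation n := (p + q)%N.
Local Notation M := 'M[C]_n.
Local Notation cpair := ('I_p * 'I_q)%type.
Local Notation scale := (@mbasis_scale R p q).
Local Notation T := (mbasis_index p q).

Variables (v : 'cV[C]_n) (g : M).
Hypotheses (p0 : (0 < p)%N) (q0 : (0 < q)%N).
Let x i := usubmx (g^t* *m v) i 0.
Let z j := dsubmx (g^t* *m v) j 0.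
Let e := e_field (killing_of (herm v)).
Let A : T -> T -> R := sesq (fun s t => 'i%C * htens x z s t).
Let W : T -> T -> R := sesq (fun s t => 'i%C * (s == t)%:R).
Let F s t r : R := 2 * scale * cyc3 (dtens x z) s t r.

Let aE s t : e g (vec2 (mbasis s) (mbasis t)) = A s t.
Proof. exact: e_field_frame. Qed.

Let wE s t : omega g (vec2 (mbasis s) (mbasis t)) = W s t.
Proof. exact: omega_frame. Qed.

Let fE s t r : ext_d e g (vec3 (mbasis s) (mbasis t) (mbasis r)) = F s t r.
Proof. exact: ext_d_frame. Qed.

Let AC s t : A s t = - A t s.
Proof. by apply: sesqC; exact: antiherm_ihtens. Qed.

Let WC s t : W s t = - W t s.
Proof.
apply: sesqC => a b; rewrite rmorphM rmorph_nat /= eq_sym.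
have -> : Num.conj ('i%C : C) = - 'i%C by rewrite /=; congr (_ +i* _)%C; rewrite oppr0.
by rewrite mulNr.
Qed.

Let i_sqr (a b : C) : ('i%C * a) * ('i%C * b) = - (a * b).
Proof. by rewrite mulrACA -expr2 sqr_i mulN1r. Qed.

Let i_conj (a b : C) : ('i%C * a) * Num.conj ('i%C * b) = a * Num.conj b.
Proof.
rewrite rmorphM /=.
have -> : Num.conj ('i%C : C) = - 'i%C by rewrite /=; congr (_ +i* _)%C; rewrite oppr0.
by rewrite mulNr mulrN i_sqr opprK.
Qed.

Let AW : \sum_s \sum_t A s t * W s t = 0.
Proof.
rewrite sesq_ip (eq_bigr (fun a => htens x z a a)) => [|a _].
  by rewrite htens_trace // mulr0.
rewrite -[RHS](sum_delta a (fun b => htens x z a b)); apply: eq_bigr => b _.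
by rewrite i_conj rmorph_nat mulrC.
Qed.

Let WA : \sum_s \sum_t W s t * A s t = 0.
Proof. by rewrite -[RHS]AW; apply: eq_bigr => s _; apply: eq_bigr => t _; rewrite mulrC. Qed.

(* [omega] acts as the complex structure, that is, as multiplication by [i] *)
Let W_mul (K : cpair -> cpair -> C) s r :
  \sum_t W s t * sesq (fun a b => 'i%C * K a b) t r = - sesq K s r.
Proof.
rewrite sesq_mul /sesq -raddfN -mulrN; congr (Re (_ * _)).
rewrite -[in RHS](sum_delta (cidx s) (fun b => K b (cidx r))) -sumrN.
by apply: eq_bigr => b _; rewrite i_sqr.
Qed.

Let mul_W (K : cpair -> cpair -> C) s r :
  \sum_t sesq (fun a b => 'i%C * K a b) s t * W t r = - sesq K s r.
Proof.
rewrite sesq_mul /sesq -raddfN -mulrN; congr (Re (_ * _)).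
rewrite -[in RHS](sum_delta (cidx r) (fun b => K (cidx s) b)) -sumrN.
by apply: eq_bigr => b _; rewrite i_sqr mulrC [cidx r == b]eq_sym.
Qed.

Lemma form_ip_ee_ew :
  form_ip (form_field_wedge e e g) (form_field_wedge e omega g) = - 2 * Re (algebraic_term x z).
Proof.
rewrite /form_field_wedge (form_ip_wedge22 aE wE AC WC AW) mulNr; congr (- _).
rewrite -htens_cube // -sesq_ip.
transitivity (\sum_s0 \sum_s3 (\sum_s2 A s0 s2 * A s2 s3) * \sum_s1 A s0 s1 * W s1 s3).
  apply: eq_bigr => s0 _; rewrite exchange_big /=.
  under eq_bigr => s2 _ do rewrite exchange_big /=.
  rewrite exchange_big /=; apply: eq_bigr => s3 _.
  rewrite mulr_suml; apply: eq_bigr => s2 _; rewrite mulr_sumr; apply: eq_bigr => s1 _.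
  by move: (A s0 s1) (A s2 s3) (A s0 s2) (W s1 s3) => *; ring.
apply: eq_bigr => s _; apply: eq_bigr => t _.
rewrite mul_W sesq_mul.
have -> : sesq (fun a c => \sum_b 'i%C * htens x z a b * ('i%C * htens x z b c)) s t
    = - sesq (fun a c => \sum_b htens x z a b * htens x z b c) s t.
  rewrite /sesq -raddfN -mulrN -sumrN; congr (Re (_ * _)).
  by apply: eq_bigr => b _; rewrite i_sqr.
by rewrite mulrNN.
Qed.

Lemma form_ip_wde_ede :
  form_ip (form_field_wedge omega (ext_d e) g) (form_field_wedge e (ext_d e) g)
  = - (2 / n%:R) * Re (derivative_term x z).
Proof.
have LA : cskew (dtens x z) by exact: cskew_dtens.
have FC1 s t r : F s t r = - F t s r by rewrite /F cyc3C1 // mulrN.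
have FC2 s t r : F s t r = - F s r t by rewrite /F cyc3C2 // mulrN.
have WF r : \sum_s \sum_t W s t * F s t r = 0.
  transitivity (2 * scale * \sum_s \sum_t W s t * cyc3 (dtens x z) s t r).
    rewrite mulr_sumr; apply: eq_bigr => s _; rewrite mulr_sumr; apply: eq_bigr => t _.
    by rewrite /F mulrCA.
  by rewrite cyc3_contract ?mulr0 // => c; exact: dtens_trace.
rewrite /form_field_wedge (form_ip_wedge23 aE wE fE AC WC FC1 FC2 WA WF).
transitivity (- 2^-1 * ((2 * scale) ^+ 2 * \sum_s1 \sum_s2 sesq (htens x z) s1 s2
    * \sum_s3 \sum_s4 cyc3 (dtens x z) s1 s3 s4 * cyc3 (dtens x z) s2 s3 s4)).
  congr (_ * _); rewrite mulr_sumr; apply: eq_bigr => s1 _; rewrite mulr_sumr.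
  apply: eq_bigr => s2 _.
  have -> : \sum_s0 W s0 s1 * A s0 s2 = sesq (htens x z) s1 s2.
    rewrite -[RHS]opprK -W_mul -sumrN; apply: eq_bigr => s0 _.
    by rewrite (WC s0 s1) mulNr.
  rewrite mulrCA; congr (_ * _); rewrite mulr_sumr; apply: eq_bigr => s3 _.
  by rewrite mulr_sumr; apply: eq_bigr => s4 _; rewrite /F; ring.
rewrite sesq_cyc3_contract // sum_contr //.
have n0 : (0 < n)%N by rewrite addn_gt0 p0.
have nn0 : n%:R != 0 :> R by rewrite pnatr_eq0 -lt0n.
have -> : (2 * scale) ^+ 2 = n%:R^-1.
  apply: (mulfI nn0); rewrite divff //; apply: etrans (scale_sqr n0).
  by move: scale => r; ring.
by move: (Re _) (n%:R^-1) => a b; field.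
Qed.
End Integrands.

(** * Averaging over rank-one Killing fields *)

Lemma bilinear_delta3 (K : comPzRingType) n (H : 'M[K]_n) (a b c a' b' c' : K) (i j k : 'I_n) :
  ((a' *: (delta_mx 0 i : 'rV[K]_n) + b' *: delta_mx 0 j + c' *: delta_mx 0 k) *m H
    *m (a *: (delta_mx i 0 : 'cV[K]_n) + b *: delta_mx j 0 + c *: delta_mx k 0)) 0 0
  = a' * a * H i i + a' * b * H i j + a' * c * H i k
  + b' * a * H j i + b' * b * H j j + b' * c * H j k
  + c' * a * H k i + c' * b * H k j + c' * c * H k k.
Proof.
have entry d e (r s : 'I_n) :
    (d *: (delta_mx 0 r : 'rV[K]_n) *m H *m (e *: (delta_mx s 0 : 'cV[K]_n))) 0 0
    = d * e * H r s.
  by rewrite -trace_mx11 tr_delta2_mul eqxx mul1r.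
rewrite !mulmxDl !mulmxDr.
have addE (A B : 'M[K]_1) : (A + B) 0 0 = A 0 0 + B 0 0 by rewrite mxE.
rewrite !addE !entry; ring.
Qed.

Section Averaging.
Context {R : realType}.
Local Notation C := (R[i]).

(** With the weights [wt], these points carry a signed measure of mass zero
    whose moments [xi^a conj(xi)^b], for [a] and [b] at most three, are one if
    [a = b > 0] and zero otherwise. *)
Definition node (r : 'I_5) : C := nth 0 [:: 0; 1; 'i%C; - 1; - 'i%C] r.
Definition wt (r : 'I_5) : R := nth 0 [:: - 1; 4^-1; 4^-1; 4^-1; 4^-1] r.

Let i2 : 'i%C * 'i%C = - 1 :> C.
Proof. by rewrite -expr2 sqr_i. Qed.

Let iJ : Num.conj ('i%C : C) = - 'i%C.
Proof. by rewrite /=; congr (_ +i* _)%C; rewrite oppr0. Qed.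

Lemma sum_node (f : C -> C -> C) :
  \sum_r (wt r)%:C%C * f (node r) (Num.conj (node r))
  = 4^-1 * (f 1 1 + f 'i%C (- 'i%C) + f (- 1) (- 1) + f (- 'i%C) 'i%C) - f 0 0.
Proof.
rewrite !big_ord_recl big_ord0 /node /wt /= !rmorphN /= iJ opprK rmorph0 !rmorph1.
rewrite fmorphV !rmorph_nat.
by move: (f 0 0) (f 1 1) (f _ _) (f (- 1) (- 1)) (f _ _) => *; ring.
Qed.

Lemma node_cube (a b c d : C) :
  \sum_r (wt r)%:C%C * (a + node r * b + Num.conj (node r) * c
     + node r * Num.conj (node r) * d) ^+ 3
  = 3 * a ^+ 2 * d + 3 * a * d ^+ 2 + d ^+ 3 + 6 * a * b * c + 6 * b * c * d.
Proof.
rewrite (sum_node (fun t t' => (a + t * b + t' * c + t * t' * d) ^+ 3)).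
move: ('i%C : C) i2 => I II; apply: (mulfI (_ : (4 : C) != 0)); first by rewrite pnatr_eq0.
rewrite mulrBr mulrA mulfV ?pnatr_eq0 // mul1r.
ring: II.
Qed.

(** As each of the three measures has mass zero, only the monomials that
    involve all three variables contribute; balanced exponents leave one term
    for each permutation of the three indices. *)
Lemma node_perm (h : 'I_3 -> 'I_3 -> C) :
  let h11 := h o30 o30 in let h12 := h o30 o31 in let h13 := h o30 o32 in
  let h21 := h o31 o30 in let h22 := h o31 o31 in let h23 := h o31 o32 in
  let h31 := h o32 o30 in let h32 := h o32 o31 in let h33 := h o32 o32 in
  \sum_r3 (wt r3)%:C%C * \sum_r2 (wt r2)%:C%C * \sum_r1 (wt r1)%:C%C *
    (let x1 := node r1 in let x2 := node r2 in let x3 := node r3 in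
     let y1 := Num.conj x1 in let y2 := Num.conj x2 in let y3 := Num.conj x3 in
     (y1 * x1 * h11 + y1 * x2 * h12 + y1 * x3 * h13
      + y2 * x1 * h21 + y2 * x2 * h22 + y2 * x3 * h23
      + y3 * x1 * h31 + y3 * x2 * h32 + y3 * x3 * h33) ^+ 3)
  = 6 * (h11 * h22 * h33 + h12 * h23 * h31 + h13 * h32 * h21
       + h11 * h23 * h32 + h22 * h13 * h31 + h33 * h12 * h21).
Proof.
move=> h11 h12 h13 h21 h22 h23 h31 h32 h33.
pose G a b c d : C := 3 * a ^+ 2 * d + 3 * a * d ^+ 2 + d ^+ 3 + 6 * a * b * c + 6 * b * c * d.
pose G2 (x2 y2 x3 y3 : C) : C :=
  G (y2 * x2 * h22 + y2 * x3 * h23 + y3 * x2 * h32 + y3 * x3 * h33)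
    (y2 * h21 + y3 * h31) (x2 * h12 + x3 * h13) h11.
transitivity (\sum_r3 (wt r3)%:C%C * \sum_r2 (wt r2)%:C%C *
   G2 (node r2) (Num.conj (node r2)) (node r3) (Num.conj (node r3))).
  apply: eq_bigr => r3 _; congr (_ * _); apply: eq_bigr => r2 _; congr (_ * _).
  rewrite /G2 /G -node_cube; apply: eq_bigr => r1 _; congr (_ * _ ^+ 3).
  move: (node r1) (node r2) (node r3) => ? ? ?.
  by move: (Num.conj _) (Num.conj _) (Num.conj _) => *; ring.
transitivity (\sum_r3 (wt r3)%:C%C * (4^-1 *
  (G2 1 1 (node r3) (Num.conj (node r3)) + G2 'i%C (- 'i%C) (node r3) (Num.conj (node r3))
   + G2 (- 1) (- 1) (node r3) (Num.conj (node r3)) + G2 (- 'i%C) 'i%C (node r3) (Num.conj (node r3)))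
   - G2 0 0 (node r3) (Num.conj (node r3)))).
  apply: eq_bigr => r3 _; congr (_ * _).
  exact: (sum_node (fun t t' => G2 t t' (node r3) (Num.conj (node r3)))).
pose G3 (x3 y3 : C) : C := 4^-1 * (G2 1 1 x3 y3 + G2 'i%C (- 'i%C) x3 y3
   + G2 (- 1) (- 1) x3 y3 + G2 (- 'i%C) 'i%C x3 y3) - G2 0 0 x3 y3.
rewrite (sum_node G3) /G3 /G2 /G.
clear G3 G2 G; clearbody h11 h12 h13 h21 h22 h23 h31 h32 h33.
move: ('i%C : C) i2 => I II.
by field: II.
Qed.

Section Probe.
Variable n : nat.
Local Notation J := (('I_n * 'I_n * 'I_n) * ('I_5 * 'I_5 * 'I_5))%type.

Definition probe (j : J) : 'cV[C]_n :=
  node j.2.1.1 *: delta_mx j.1.1.1 0 + node j.2.1.2 *: delta_mx j.1.1.2 0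
  + node j.2.2 *: delta_mx j.1.2 0.

Definition probe_wt (j : J) : R := wt j.2.1.1 * wt j.2.1.2 * wt j.2.2.

Definition avg (f : 'cV[C]_n -> C) : C := \sum_j (probe_wt j)%:C%C * f (probe j).

Lemma avgD f g : avg (fun v => f v + g v) = avg f + avg g.
Proof. by rewrite /avg -big_split; apply: eq_bigr => j _; rewrite mulrDr. Qed.

Lemma avgZ a f : avg (fun v => a * f v) = a * avg f.
Proof. by rewrite /avg mulr_sumr; apply: eq_bigr => j _; rewrite mulrCA. Qed.

Definition quadratic (H : 'M[C]_n) (v : 'cV[C]_n) : C := (v^t* *m H *m v) 0 0.

Lemma quadratic_probe (H : 'M[C]_n) (a b c : C) (i j k : 'I_n) :
  quadratic H (a *: delta_mx i 0 + b *: delta_mx j 0 + c *: delta_mx k 0)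
  = Num.conj a * a * H i i + Num.conj a * b * H i j + Num.conj a * c * H i k
  + Num.conj b * a * H j i + Num.conj b * b * H j j + Num.conj b * c * H j k
  + Num.conj c * a * H k i + Num.conj c * b * H k j + Num.conj c * c * H k k.
Proof.
have ct d (l : 'I_n) : (d *: delta_mx l 0 : 'cV[C]_n)^t* = Num.conj d *: delta_mx 0 l.
  by apply/matrixP => r s; rewrite !mxE rmorphM rmorph_nat andbC.
rewrite /quadratic.
have -> : (a *: delta_mx i 0 + b *: delta_mx j 0 + c *: delta_mx k 0 : 'cV[C]_n)^t*
   = Num.conj a *: delta_mx 0 i + Num.conj b *: delta_mx 0 j + Num.conj c *: delta_mx 0 k.
  by rewrite !linearD /= !map_mxD !ct.
exact: bilinear_delta3.
Qed.

(** Six times the third moment of a hermitian form at a standard complex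
    Gaussian vector: finitely many weighted vectors replace a unitarily
    invariant mean. *)
Lemma avg_quadratic_cube (H : 'M[C]_n) :
  avg (fun v => quadratic H v ^+ 3)
  = 6 * (\tr H ^+ 3 + 3 * \tr H * \tr (H *m H) + 2 * \tr (H *m H *m H)).
Proof.
transitivity (\sum_i \sum_j \sum_k 6 * (H i i * H j j * H k k + H i j * H j k * H k i
   + H i k * H k j * H j i + H i i * H j k * H k j + H j j * H i k * H k i
   + H k k * H i j * H j i)).
  rewrite pair_big pair_big /= /avg.
  rewrite -(pair_big xpredT xpredT (fun a b =>
    (probe_wt (a, b))%:C%C * quadratic H (probe (a, b)) ^+ 3)) /=.
  apply: eq_bigr => -[[i j] k] _ /=.
  have := node_perm (fun a b => H (nth i [:: i; j; k] a) (nth i [:: i; j; k] b)).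
  rewrite /= => <-.
  rewrite -(pair_big xpredT xpredT (fun r12 r3 =>
    (probe_wt ((i, j, k), (r12, r3)))%:C%C * quadratic H (probe ((i, j, k), (r12, r3))) ^+ 3)) /=.
  rewrite exchange_big; apply: eq_bigr => r3 _; rewrite mulr_sumr /=.
  rewrite -(pair_big xpredT xpredT (fun r1 r2 =>
    (probe_wt ((i, j, k), ((r1, r2), r3)))%:C%C
      * quadratic H (probe ((i, j, k), ((r1, r2), r3))) ^+ 3)) /= exchange_big.
  apply: eq_bigr => r2 _; rewrite !mulr_sumr; apply: eq_bigr => r1 _.
  rewrite /probe /probe_wt quadratic_probe /= !rmorphM /=.
  by move: (_ ^+ 3) (wt r1)%:C%C (wt r2)%:C%C (wt r3)%:C%C => *; ring.
have t2 : \tr (H *m H) = \sum_i \sum_j H i j * H j i.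
  by apply: eq_bigr => i _; rewrite mxE.
have t3 : \tr (H *m H *m H) = \sum_i \sum_j \sum_k H i j * H j k * H k i.
  apply: eq_bigr => i _; rewrite mxE exchange_big; apply: eq_bigr => k _ /=.
  by rewrite mxE mulr_suml.
have S1 : \sum_i \sum_j \sum_k H i i * H j j * H k k = \tr H ^+ 3.
  rewrite !exprS expr0 mulr1 {1}/mxtrace mulr_suml; apply: eq_bigr => i _.
  rewrite {1}/mxtrace mulr_suml mulr_sumr; apply: eq_bigr => j _.
  by rewrite /mxtrace !mulr_sumr; apply: eq_bigr => k _; rewrite mulrA.
have S2 : \sum_i \sum_j \sum_k H i k * H k j * H j i = \tr (H *m H *m H).
  by rewrite t3; apply: eq_bigr => i _; rewrite exchange_big.
have S3 : \sum_i \sum_j \sum_k H i i * H j k * H k j = \tr H * \tr (H *m H).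
  rewrite t2 mulr_suml; apply: eq_bigr => i _; rewrite mulr_sumr; apply: eq_bigr => j _.
  by rewrite mulr_sumr; apply: eq_bigr => k _; rewrite mulrA.
have S4 : \sum_i \sum_j \sum_k H j j * H i k * H k i = \tr H * \tr (H *m H).
  by rewrite exchange_big -S3.
have S5 : \sum_i \sum_j \sum_k H k k * H i j * H j i = \tr H * \tr (H *m H).
  rewrite -S4; apply: eq_bigr => i _; exact: exchange_big.
transitivity (6 * (\tr H ^+ 3 + \tr (H *m H *m H) + \tr (H *m H *m H)
    + \tr H * \tr (H *m H) + \tr H * \tr (H *m H) + \tr H * \tr (H *m H))); last first.
  by move: (\tr H) (\tr (H *m H)) (\tr (H *m H *m H)) => *; ring.
pose S (f : 'I_n -> 'I_n -> 'I_n -> C) := \sum_i \sum_j \sum_k f i j k.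
have SD f h : S f + S h = S (fun i j k => f i j k + h i j k).
  by rewrite /S -big_split; apply: eq_bigr => i _; rewrite -big_split;
     apply: eq_bigr => j _; rewrite -big_split.
have SM e f : e * S f = S (fun i j k => e * f i j k).
  by rewrite /S mulr_sumr; apply: eq_bigr => i _; rewrite mulr_sumr;
     apply: eq_bigr => j _; rewrite mulr_sumr.
transitivity (6 * (S (fun i j k => H i i * H j j * H k k) + S (fun i j k => H i j * H j k * H k i)
   + S (fun i j k => H i k * H k j * H j i) + S (fun i j k => H i i * H j k * H k j)
   + S (fun i j k => H j j * H i k * H k i) + S (fun i j k => H k k * H i j * H j i))).
  by rewrite !SD SM.
by rewrite /S S1 S2 S3 S4 S5 -t3.
Qed.

End Probe.

Section Split.
Variables (p q : nat) (g : 'M[C]_(p + q)) (a b : C).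
Hypothesis gU : g^t* *m g = 1%:M.

Let D : 'M[C]_(p + q) := block_mx a%:M 0 0 b%:M.

Lemma quadratic_split (v : 'cV[C]_(p + q)) :
  quadratic (g *m D *m g^t*) v
  = a * nrm2 (fun i => usubmx (g^t* *m v) i 0) + b * nrm2 (fun j => dsubmx (g^t* *m v) j 0).
Proof.
have -> : quadratic (g *m D *m g^t*) v = quadratic D (g^t* *m v).
  by rewrite /quadratic ctrmxM ctrmxK !mulmxA.
move: (g^t* *m v) => u; rewrite /quadratic /D -{1 2}[u]vsubmxK.
rewrite tr_col_mx map_row_mx mul_row_block mul_row_col !mulmx0 addr0 add0r.
rewrite !mul_mx_scalar -!scalemxAl !mxE.
by congr (_ * _ + _ * _); apply: eq_bigr => i _; rewrite !mxE mulrC.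
Qed.

Lemma tr_split k : \tr ((g *m D *m g^t*) ^+ k) = a ^+ k * p%:R + b ^+ k * q%:R.
Proof.
have -> : (g *m D *m g^t*) ^+ k = g *m D ^+ k *m g^t*.
  elim: k => [|k IH].
    rewrite !expr0 mulmx1; exact: esym (mulmx1C gU).
  rewrite exprS IH [D ^+ k.+1]exprS -[LHS]/(mulmx _ _) -[D * _]/(mulmx _ _).
  by rewrite !mulmxA -[_ *m g^t* *m g]mulmxA gU mulmx1.
rewrite mxtrace_mulC mulmxA gU mul1mx.
have -> : D ^+ k = block_mx (a ^+ k)%:M 0 0 (b ^+ k)%:M.
  elim: k => [|k IH]; first by rewrite !expr0 -scalar_mx_block.
  rewrite exprS IH -[LHS]/(mulmx _ _) mulmx_block !mulmx0 !mul0mx !addr0 add0r.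
  by rewrite -!scalar_mxM -!exprS.
by rewrite mxtrace_block !mxtrace_scalar !mulr_natr.
Qed.

Lemma avg_split : avg (fun v => (a * nrm2 (fun i => usubmx (g^t* *m v) i 0)
     + b * nrm2 (fun j => dsubmx (g^t* *m v) j 0)) ^+ 3)
  = 6 * ((a * p%:R + b * q%:R) ^+ 3
    + 3 * (a * p%:R + b * q%:R) * (a ^+ 2 * p%:R + b ^+ 2 * q%:R)
    + 2 * (a ^+ 3 * p%:R + b ^+ 3 * q%:R)).
Proof.
have -> : avg (fun v => (a * nrm2 (fun i => usubmx (g^t* *m v) i 0)
     + b * nrm2 (fun j => dsubmx (g^t* *m v) j 0)) ^+ 3)
   = avg (fun v => quadratic (g *m D *m g^t*) v ^+ 3).
  by apply: eq_bigr => j _; rewrite quadratic_split.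
rewrite avg_quadratic_cube; set H := g *m D *m g^t*.
have E1 : \tr H = a * p%:R + b * q%:R.
  by have := tr_split 1; rewrite !expr1.
have E2 : \tr (H *m H) = a ^+ 2 * p%:R + b ^+ 2 * q%:R.
  by rewrite -tr_split [in RHS]expr2.
have E3 : \tr (H *m H *m H) = a ^+ 3 * p%:R + b ^+ 3 * q%:R.
  by rewrite -tr_split [in RHS]exprSr expr2.
by rewrite E1 E2 E3.
Qed.
End Split.

Section Moments.
Variables (p q : nat) (g : 'M[C]_(p + q)).
Hypothesis gU : g^t* *m g = 1%:M.
Let X (v : 'cV[C]_(p + q)) := nrm2 (fun i => usubmx (g^t* *m v) i 0).
Let Y (v : 'cV[C]_(p + q)) := nrm2 (fun j => dsubmx (g^t* *m v) j 0).

(** Each of the monomials is a combination of cubes of linear combinations of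
    the two norms; such a combination is a quadratic form in [v] that [g]
    conjugates to a diagonal one, and conjugation does not change the traces
    in [avg_quadratic_cube]. *)
Lemma avg_moments (c1 c2 c3 c4 : C) :
  avg (fun v => c1 * (X v ^+ 2 * Y v) + c2 * (X v * Y v ^+ 2) + c3 * X v ^+ 3 + c4 * Y v ^+ 3)
  = 6 * (c1 * (p%:R * (p%:R + 1) * q%:R) + c2 * (p%:R * q%:R * (q%:R + 1))
      + c3 * (p%:R * (p%:R + 1) * (p%:R + 2)) + c4 * (q%:R * (q%:R + 1) * (q%:R + 2))).
Proof.
transitivity (avg (fun v => (c1 + c2) / 6 * (1 * X v + 1 * Y v) ^+ 3
    + (c2 - c1) / 6 * (1 * X v + (- 1) * Y v) ^+ 3 + (c3 - c2 / 3) * (1 * X v + 0 * Y v) ^+ 3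
    + (c4 - c1 / 3) * (0 * X v + 1 * Y v) ^+ 3)).
  apply: eq_bigr => j _; congr (_ * _); move: (X _) (Y _) => s t.
  by field.
rewrite !avgD !avgZ !avg_split //.
by field.
Qed.
End Moments.
End Averaging.

(** * Integration over the special unitary group *)

Section Tame.
Context {R : realType} {n : nat}.
Local Notation C := (R[i]).
Local Notation M := 'M[C]_n.
Local Notation Re := complex.Re.
Local Notation Im := complex.Im.

(** Compactness of [SU(n)] enters only through this class of functions, which
    contains every polynomial in the matrix entries and their conjugates. *)
Definition tame (h : M -> C) : Prop :=
  ccont h /\ exists B : R, forall g, SU g -> `|h g| <= B%:C%C.

Lemma tame_cst c : tame (fun=> c).
Proof.
split; first exact: ccont_cst.
by exists (Re `|c|) => g _; rewrite RRe_real // normr_real.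
Qed.

Lemma SU_unitary (g : M) : SU g -> g^t* *m g = 1%:M.
Proof. by move=> [/unitarymxP gU _]; exact: mulmx1C. Qed.

Lemma tame_entry i j : tame (fun g => g i j).
Proof.
split; first exact: ccont_entry.
exists 1 => g gSU; rewrite rmorph1.
have /matrixP/(_ j j) := SU_unitary gSU; rewrite !mxE eqxx mulr1n => E.
rewrite -(ler_pXn2r (_ : (0 < 2)%N)) ?nnegrE // expr1n normCK -E (bigD1 i) //=.
rewrite !mxE mulrC lerDl; apply: sumr_ge0 => k _.
by rewrite !mxE mulrC mul_conjC_ge0.
Qed.

Lemma tameD h k : tame h -> tame k -> tame (fun g => h g + k g).
Proof.
move=> [hc [B hB]] [kc [B' kB]]; split; first exact: ccontD.
exists (B + B') => g gSU; rewrite rmorphD.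
by apply: le_trans (ler_normD _ _) _; apply: lerD; [exact: hB | exact: kB].
Qed.

Lemma tameM h k : tame h -> tame k -> tame (fun g => h g * k g).
Proof.
move=> [hc [B hB]] [kc [B' kB]]; split; first exact: ccontM.
exists (B * B') => g gSU; rewrite rmorphM normrM.
by apply: ler_pM; rewrite ?normr_ge0 //; [exact: hB | exact: kB].
Qed.

Lemma tameX (h : M -> C) k : tame h -> tame (fun g => h g ^+ k).
Proof.
move=> ht; elim: k => [|k IH]; first exact: tame_cst.
by under eq_fun do rewrite exprS; exact: tameM.
Qed.

Lemma tame_conj h : tame h -> tame (fun g => Num.conj (h g)).
Proof.
move=> [hc [B hB]]; split; first exact: ccont_conj.
by exists B => g gSU; rewrite norm_conjC; exact: hB.
Qed.

Lemma tame_sum (I : finType) (h : I -> M -> C) :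
  (forall i, tame (h i)) -> tame (fun g => \sum_i h i g).
Proof.
move=> ht; elim: (index_enum I) => [|i s IH].
  by under eq_fun do rewrite big_nil; exact: tame_cst.
by under eq_fun do rewrite big_cons; exact: tameD.
Qed.

Lemma measurable_continuous (f : M -> R) (D : set (borelM R n)) :
  continuous f -> measurable D -> measurable_fun D (f : borelM R n -> R).
Proof.
move=> /continuousP cf mD.
apply: (measurability _ (RGenOpens.measurableE R)).
move=> _ [_ [a [b ->] <-]]; apply: measurableI => //.
by apply: sub_sigma_algebra; apply: cf; exact: interval_open.
Qed.

Lemma measurable_ccont_level (h : M -> C) (c : C) :
  ccont h -> measurable ([set g | h g = c] : set (borelM R n)).
Proof.
move=> [hR hI].
have -> : [set g | h g = c] = [set g | Re (h g) = Re c] `&` [set g | Im (h g) = Im c].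
  apply/seteqP; split=> g /=; first by move=> ->.
  by move=> [E1 E2]; apply/eqP; rewrite eq_complex E1 E2 !eqxx.
have level (f : M -> R) (r : R) : continuous f ->
    measurable ([set g | f g = r] : set (borelM R n)).
  move=> fc; have := measurable_continuous fc measurableT.
  by move=> /(_ measurableT _ (measurable_set1 r)); rewrite setTI.
by apply: measurableI; exact: level.
Qed.

(** [SU(n)] is cut out by finitely many equations between continuous
    functions. *)
Lemma measurable_SU : measurable (SU : set (borelM R n)).
Proof.
have -> : (SU : set M) = [set g | \det g = 1] `&`
    \bigcap_(ij in [set: 'I_n * 'I_n])
      [set g | (g *m g^t*) ij.1 ij.2 = (1%:M : M) ij.1 ij.2].
  apply/seteqP; split=> g /=.
    by move=> [/unitarymxP gU g1]; split=> // ij _ /=; rewrite gU.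
  move=> [g1 gU]; split=> //; apply/unitarymxP/matrixP => i j; exact: (gU (i, j)).
apply: measurableI; first by apply: measurable_ccont_level; exact: ccont_det.
apply: fin_bigcap_measurable; first exact: finite_finset.
move=> [i j] _; apply: measurable_ccont_level; apply: ccont_mulmx => a b.
  exact: ccont_entry.
by apply: ccont_ctrmx => c d; exact: ccont_entry.
Qed.

Section Integral.
Variable mu : {measure set (borelM R n) -> \bar R}.
Hypothesis mu_fin : (mu (SU : set (borelM R n)) < +oo)%E.

Definition SU_integral (h : M -> C) : R :=
  \int[mu]_(g in (SU : set (borelM R n))) Re (h g).

Lemma tame_integrable h : tame h ->
  mu.-integrable (SU : set (borelM R n)) (EFin \o (fun g => Re (h g))).
Proof.
move=> [[hR _] [B hB]]; apply: measurable_bounded_integrable => //.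
- exact: measurable_SU.
- by apply: measurable_continuous => //; exact: measurable_SU.
exists B; split; first exact: num_real.
move=> r Br g gSU /=; apply: le_trans (ltW Br).
by rewrite -lecR; apply: le_trans (normc_ge_Re _) _; exact: hB.
Qed.

Lemma SU_integralD h k : tame h -> tame k ->
  SU_integral (fun g => h g + k g) = SU_integral h + SU_integral k.
Proof.
move=> ht kt; rewrite /SU_integral -RintegralD; last 3 first.
- exact: measurable_SU.
- exact: tame_integrable.
- exact: tame_integrable.
by congr Rintegral; apply/funext => g; rewrite raddfD.
Qed.

Lemma SU_integralZ (a : R) h : tame h ->
  SU_integral (fun g => a%:C%C * h g) = a * SU_integral h.
Proof.
move=> ht; rewrite /SU_integral -RintegralZl; last 2 first.
- exact: measurable_SU.
- exact: tame_integrable.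
by congr Rintegral; apply/funext => g; case: (h g) => b c; simpc.
Qed.

Lemma SU_integral_sum (I : finType) (w : I -> R) (h : I -> M -> C) :
    (forall i, tame (h i)) ->
  SU_integral (fun g => \sum_i (w i)%:C%C * h i g) = \sum_i w i * SU_integral (h i).
Proof.
move=> ht; elim: (index_enum I) => [|i s IH].
  rewrite big_nil /SU_integral; under eq_Rintegral do rewrite big_nil.
  by rewrite Rintegral_cst ?mul0r //; exact: measurable_SU.
rewrite big_cons -IH -SU_integralZ // -SU_integralD.
- by congr SU_integral; apply/funext => g; rewrite big_cons.
- by apply: tameM => //; exact: tame_cst.
elim: s {IH} => [|j s IH].
  by under eq_fun do rewrite big_nil; exact: tame_cst.
under eq_fun do rewrite big_cons.
by apply: tameD => //; apply: tameM => //; exact: tame_cst.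
Qed.

Lemma SU_integral_cst h (c : C) : (forall g, SU g -> h g = c) ->
  SU_integral h = Re c * fine (mu (SU : set (borelM R n))).
Proof.
move=> hc; rewrite -Rintegral_cst; last exact: measurable_SU.
by apply: eq_Rintegral => g /set_mem gSU; rewrite hc.
Qed.
End Integral.
End Tame.

(** * The obstruction polynomial *)

(** For integers [s] and [t] it is nonzero as soon as both are at least two. *)
Definition mean_density (F : fieldType) (s t : F) : F :=
  - 192 / (s * t) ^+ 2 * (s + t) * (s * t - 1) * (s ^+ 2 - 1) ^+ 2 * (t ^+ 2 - 1) ^+ 2.

Lemma rmorph_mean_density (F K : fieldType) (f : {rmorphism F -> K}) s t :
  f (mean_density s t) = mean_density (f s) (f t).
Proof.
rewrite /mean_density rmorphM rmorphXn rmorphB rmorph1 rmorphXn.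
rewrite rmorphM rmorphXn rmorphB rmorph1 rmorphXn.
rewrite rmorphM rmorphB rmorph1 rmorphM rmorphM rmorphD.
by rewrite rmorphM fmorphV rmorphXn rmorphM rmorphN rmorph_nat.
Qed.

Lemma mean_density_neq0 (F : realFieldType) (s t : F) :
  1 < s -> 1 < t -> mean_density s t != 0.
Proof.
move=> s1 t1.
have s0 : 0 < s by exact: lt_trans ltr01 s1.
have t0 : 0 < t by exact: lt_trans ltr01 t1.
have sqr_sub_neq0 (r : F) : 1 < r -> (r ^+ 2 - 1) ^+ 2 != 0.
  by move=> r1; rewrite expf_neq0 // subr_eq0 gt_eqF // exprn_egt1.
have st0 : s * t != 0 by rewrite mulf_neq0 ?gt_eqF.
have st1 : s * t - 1 != 0 by rewrite subr_eq0 gt_eqF // mulr_egt1.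
apply: mulf_neq0 (sqr_sub_neq0 _ t1); apply: mulf_neq0 (sqr_sub_neq0 _ s1).
apply: mulf_neq0 st1; apply: mulf_neq0; last by rewrite gt_eqF // addr_gt0.
by apply: mulf_neq0; rewrite ?invr_eq0 ?expf_neq0 // oppr_eq0 pnatr_eq0.
Qed.

Section Obstruction.
Context {R : realType} {p q : nat}.
Local Notation C := (R[i]).
Local Notation n := (p + q)%N.
Local Notation M := 'M[C]_n.
Hypotheses (p0 : (0 < p)%N) (q0 : (0 < q)%N).

Definition upper_part (v : 'cV[C]_n) (g : M) (i : 'I_p) : C := usubmx (g^t* *m v) i 0.
Definition lower_part (v : 'cV[C]_n) (g : M) (j : 'I_q) : C := dsubmx (g^t* *m v) j 0.

Lemma tame_entry_act (v : 'cV[C]_n) (k : 'I_n) : tame (fun g : M => (g^t* *m v) k 0).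
Proof.
under eq_fun do rewrite mxE; apply: tame_sum => i; apply: tameM; last exact: tame_cst.
by under eq_fun do rewrite !mxE; apply: tame_conj; exact: tame_entry.
Qed.

Lemma tame_nrm2_upper v : tame (fun g : M => nrm2 (upper_part v g)).
Proof.
apply: tame_sum => i; rewrite /upper_part.
under eq_fun do rewrite mxE; apply: tameM; last apply: tame_conj; exact: tame_entry_act.
Qed.

Lemma tame_nrm2_lower v : tame (fun g : M => nrm2 (lower_part v g)).
Proof.
apply: tame_sum => i; rewrite /lower_part.
under eq_fun do rewrite mxE; apply: tameM; last apply: tame_conj; exact: tame_entry_act.
Qed.

Let a : C := (q%:R ^+ 2 - 1) / q%:R.
Let b : C := (p%:R ^+ 2 - 1) / p%:R.
Let d : C := a / p%:R - b / q%:R.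

Definition coef21 : C := (2 * a) * (1 - p%:R^-1)
  * (2 * ((a + b) ^+ 2 * (p%:R * q%:R - 3) + 2 * (a + b) * d * (p%:R - 3 * q%:R)
          + d ^+ 2 * (p%:R * q%:R - 3))).
Definition coef12 : C := (2 * b) * (1 - q%:R^-1)
  * (2 * ((a + b) ^+ 2 * (p%:R * q%:R - 3) + 2 * (a + b) * d * (3 * p%:R - q%:R)
          + d ^+ 2 * (p%:R * q%:R - 3))).
Definition coef30 : C := (2 * a) ^+ 3 * q%:R * (1 - p%:R^-1) * (1 - 2 / p%:R).
Definition coef03 : C := (2 * b) ^+ 3 * p%:R * (1 - q%:R^-1) * (1 - 2 / q%:R).

Let alphaE : (@alpha R q)%:C%C = a.
Proof. by rewrite /alpha /a rmorphM fmorphV rmorphB rmorphXn rmorph1 !rmorph_nat. Qed.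

Let betaE : (@beta R p)%:C%C = b.
Proof. by rewrite /beta /b rmorphM fmorphV rmorphB rmorphXn rmorph1 !rmorph_nat. Qed.

Let kappaE : (@kappa R p q)%:C%C = d.
Proof.
rewrite /kappa rmorphB; congr (_ - _); rewrite rmorphM fmorphV rmorph_nat.
  by congr (_ / _); exact: alphaE.
by congr (_ / _); exact: betaE.
Qed.

Lemma derivative_termE (x : 'I_p -> C) (z : 'I_q -> C) : derivative_term x z
  = coef21 * (nrm2 x ^+ 2 * nrm2 z) + coef12 * (nrm2 x * nrm2 z ^+ 2).
Proof.
have k1E : (2 * @alpha R q)%:C%C = 2 * a.
  by rewrite rmorphM rmorph_nat; congr (_ * _); exact: alphaE.
have k2E : (2 * @beta R p)%:C%C = 2 * b.
  by rewrite rmorphM rmorph_nat; congr (_ * _); exact: betaE.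
have AE : (@alpha R q + @beta R p)%:C%C = a + b.
  by rewrite rmorphD; congr (_ + _); [exact: alphaE | exact: betaE].
rewrite /derivative_term k1E k2E AE kappaE /coef21 /coef12.
move: (nrm2 x) (nrm2 z) (p%:R^-1 : C) (q%:R^-1 : C) => X Y pi qi.
ring.
Qed.

Lemma algebraic_termE (x : 'I_p -> C) (z : 'I_q -> C) :
  algebraic_term x z = coef30 * nrm2 x ^+ 3 + coef03 * nrm2 z ^+ 3.
Proof.
have k1E : (2 * @alpha R q)%:C%C = 2 * a.
  by rewrite rmorphM rmorph_nat; congr (_ * _); exact: alphaE.
have k2E : (2 * @beta R p)%:C%C = 2 * b.
  by rewrite rmorphM rmorph_nat; congr (_ * _); exact: betaE.
rewrite /algebraic_term k1E k2E /coef30 /coef03.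
move: (nrm2 x) (nrm2 z) (p%:R^-1 : C) (q%:R^-1 : C) => X Y pi qi.
ring.
Qed.

Lemma tame_derivative_term v : tame (fun g => derivative_term (upper_part v g) (lower_part v g)).
Proof.
under eq_fun do rewrite derivative_termE.
have tX := tame_nrm2_upper v; have tY := tame_nrm2_lower v.
apply: tameD; apply: (tameM (tame_cst _)).
  exact: tameM (tameX 2 tX) tY.
exact: tameM tX (tameX 2 tY).
Qed.

Lemma tame_algebraic_term v : tame (fun g => algebraic_term (upper_part v g) (lower_part v g)).
Proof.
under eq_fun do rewrite algebraic_termE.
apply: tameD; apply: (tameM (tame_cst _)).
  exact: tameX (tame_nrm2_upper v).
exact: tameX (tame_nrm2_lower v).
Qed.

(** The integrand of [Psi] at [killing_of (herm v)], by [form_ip_wde_ede] and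
    [form_ip_ee_ew]. *)
Definition density (v : 'cV[C]_n) (g : M) : C :=
  (- (12 / n%:R))%:C%C * derivative_term (upper_part v g) (lower_part v g)
  + 8%:C%C * algebraic_term (upper_part v g) (lower_part v g).

Lemma tame_density v : tame (density v).
Proof.
apply: tameD; apply: (tameM (tame_cst _)); [exact: tame_derivative_term | exact: tame_algebraic_term].
Qed.

Lemma Psi_integral (mu : {measure set (borelM R n) -> \bar R}) v :
    (mu (SU : set (borelM R n)) < +oo)%E ->
  Psi mu (killing_of (herm v)) = SU_integral mu (density v).
Proof.
move=> mu_fin; have tq := tame_derivative_term v; have tc := tame_algebraic_term v.
rewrite /density SU_integralD //; first last.
- exact: tameM (tame_cst _) tc.
- exact: tameM (tame_cst _) tq.
rewrite !SU_integralZ // /Psi /L2_ip.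
have E1 : \int[mu]_(g in (SU : set (borelM R n)))
    form_ip (form_field_wedge omega (ext_d (e_field (killing_of (herm v)))) g)
      (form_field_wedge (e_field (killing_of (herm v)))
        (ext_d (e_field (killing_of (herm v)))) g)
    = - (2 / n%:R) * SU_integral mu (fun g => derivative_term (upper_part v g) (lower_part v g)).
  rewrite -SU_integralZ // /SU_integral; apply: eq_Rintegral => g _.
  rewrite form_ip_wde_ede //; move: (derivative_term _ _) => u.
  by case: u => s t; simpc.
have E2 : \int[mu]_(g in (SU : set (borelM R n)))
    form_ip (form_field_wedge (e_field (killing_of (herm v))) (e_field (killing_of (herm v))) g)
      (form_field_wedge (e_field (killing_of (herm v))) omega g)
    = - 2 * SU_integral mu (fun g => algebraic_term (upper_part v g) (lower_part v g)).
  rewrite -SU_integralZ // /SU_integral; apply: eq_Rintegral => g _.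
  rewrite form_ip_ee_ew //; move: (algebraic_term _ _) => u.
  by case: u => s t; simpc.
rewrite E1 E2.
by move: (SU_integral _ _) (SU_integral _ _) (n%:R^-1 : R) => s t r; ring.
Qed.

(** Averaging over [v] removes the dependence on the group element before any
    integration. *)
Lemma avg_density g : SU g -> avg (fun v => density v g)
  = mean_density p%:R q%:R.
Proof.
move=> /SU_unitary gU.
have nE : (- (12 / n%:R) : R)%:C%C = - (12 / n%:R).
  by rewrite rmorphN rmorphM fmorphV !rmorph_nat.
have eE : (8 : R)%:C%C = 8 by rewrite rmorph_nat.
have pn0 : (p%:R : C) != 0 by rewrite pnatr_eq0 -lt0n.
have qn0 : (q%:R : C) != 0 by rewrite pnatr_eq0 -lt0n.
have nn0 : (p%:R + q%:R : C) != 0.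
  by rewrite -natrD pnatr_eq0 -lt0n addn_gt0 p0.
transitivity (avg (fun v => - (12 / n%:R) * coef21
      * (nrm2 (upper_part v g) ^+ 2 * nrm2 (lower_part v g))
    + - (12 / n%:R) * coef12 * (nrm2 (upper_part v g) * nrm2 (lower_part v g) ^+ 2)
    + 8 * coef30 * nrm2 (upper_part v g) ^+ 3 + 8 * coef03 * nrm2 (lower_part v g) ^+ 3)).
  apply: eq_bigr => j _; congr (_ * _).
  rewrite /density nE eE derivative_termE algebraic_termE; move: (nrm2 _) (nrm2 _) => X Y.
  by move: (- (12 / n%:R) : C) coef21 coef12 coef30 coef03 => *; ring.
rewrite /upper_part /lower_part avg_moments // /coef21 /coef12 /coef30 /coef03 /d /a /b.
rewrite /mean_density natrD; move: (p%:R : C) (q%:R : C) pn0 qn0 nn0 => s t s0 t0 st0.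
by field; rewrite s0 t0 st0.
Qed.
End Obstruction.

Theorem corollary7p8 (R : realType) (np nm : nat)
    (hnp : (2 <= np)%N) (hnm : (2 <= nm)%N)
    (mu : {measure set (borelM R (np + nm)) -> \bar R})
    (hmu : is_haar_SU mu) :
  exists X : 'M[R[i]]_(np + nm) -> 'M[R[i]]_(np + nm),
    killing_field X /\ Psi mu X <> 0.
Proof.
have p0 : (0 < np)%N by exact: ltnW.
have q0 : (0 < nm)%N by exact: ltnW.
have [mu_gt0 mu_fin _ _] := hmu.
suff [v vP] : exists v, Psi mu (killing_of (herm v)) <> 0.
  by exists (killing_of (herm v)); split => //; exact/killing_field_killing_of/skew_herm.
(* if all these values vanish, so does their weighted sum over the probes,
   which is the integral of a nonzero constant *)
apply: contrapT => noX.
have Psi0 v : Psi mu (killing_of (herm v)) = 0.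
  by apply: contrapT => H; apply: noX; exists v.
pose K : R := mean_density np%:R nm%:R.
have KE (g : 'M[R[i]]_(np + nm)) : SU g -> avg (fun v => @density R np nm v g) = K%:C%C.
  move=> gSU; rewrite avg_density //.
  have E := rmorph_mean_density (real_complex R : {rmorphism R -> R[i]}) np%:R nm%:R.
  by rewrite /K [RHS]E !rmorph_nat.
have K0 : K != 0 by apply: mean_density_neq0; rewrite ltr1n.
have mass : fine (mu (SU : set (borelM R (np + nm)))) != 0.
  by rewrite gt_eqF // fine_gt0 // mu_gt0.
suff : K * fine (mu (SU : set (borelM R (np + nm)))) = 0.
  by move/eqP; rewrite mulf_eq0 (negPf K0) (negPf mass).
have td j : tame (density (probe j : 'cV[R[i]]_(np + nm))) by exact: tame_density.
transitivity (\sum_j probe_wt j * Psi mu (killing_of (herm (probe j)))).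
  rewrite -[K]/(complex.Re K%:C%C) -(SU_integral_cst mu KE) SU_integral_sum //.
  by apply: eq_bigr => j _; rewrite Psi_integral.
by rewrite big1 // => j _; rewrite Psi0 mulr0.
Qed.
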